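(* Let Assumption (SL) (see context) hold with $\delta=\frac{d}{\alpha c}\in(0,1)$ and let $Z$ be the associated self-similar CBI process started at $0$. Then, for any $0<s<t$, the conditional law of $Z(t)$, given $g_t(Z)=s$, is the Linnik law $\nu^{t-s}$ on the positive reals, with Laplace transform $$\mathbb E\left(e^{-\lambda Z(t)}\,\middle|\,g_t(Z)=s\right)=\big(1+\alpha c\,(t-s)\,\lambda^\alpha\big)^{-1},\qquad\lambda\ge0.$$
   Context: $\mathbb N=\{0,1,2,\dots\}$. $\mu,\nu$ are probability distributions on $\mathbb N$ with $\mu(1)<1$ and $\nu(0)>0$, with generating functions $f(s)=\sum_{n}s^n\mu(n)$, $g(s)=\sum_n s^n\nu(n)$. Assumption (SL): for $s\in(0,1)$, $f(s)=s+c(1-s)^{1+\alpha}\ell(1-s)$ and $g(s)=1-d(1-s)^\alpha k(1-s)$ for some constants $c,d>0$, $\alpha\in(0,1]$ and functions $\ell,k:(0,1)\to(0,\infty)$ slowly varying at $0$ with $\ell(s)/k(s)\to1$ as $s\to0$. (Only $\alpha,c,d$ enter the law of $Z$.) CBI process: $Z$ is the $[0,\infty)$-valued càdlàg Feller Markov process characterised by $\mathbb E_z(e^{-\lambda Z(t)})=(1+\alpha c\lambda^\alpha t)^{-\delta}\exp\!\big(-\lambda z(1+\alpha c\lambda^\alpha t)^{-1/\alpha}\big)$ for $z,t,\lambda\ge0$, with $\delta=\frac{d}{\alpha c}$, started at $Z(0)=0$. $g_t(Z)=\sup\{s\le t:Z(s)=0\}$. The Linnik law $\nu^l$ ($l>0$)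 is the law on $[0,\infty)$ with Laplace transform $\lambda\mapsto(1+\alpha c\,l\,\lambda^\alpha)^{-1}$. The conditional law is understood as a regular conditional distribution of $Z(t)$ given $g_t(Z)$. *)

(* Defs.v *)
(* MathComp-Analysis. *)
From HB Require Import structures.
From mathcomp Require Export all_boot all_order all_algebra.
From mathcomp Require Export all_classical all_reals all_analysis.
Set Implicit Arguments.
Unset Strict Implicit.
Unset Printing Implicit Defensive.
Import Order.TTheory GRing.Theory Num.Theory.
Import numFieldNormedType.Exports.
Local Open Scope classical_set_scope.
Local Open Scope ring_scope.

Definition pgf (R : realType) (mu : probability nat R) (s : R) : R :=
  limn (series (fun n => s ^+ n * fine (mu [set n]))).

(* A function (0,1) -> (0,oo), represented by a total function of which only
   the values on (0,1) matter, slowly varying at 0. *)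
Definition slowly_varying0 (R : realType) (l : R -> R) : Prop :=
  (forall x, 0 < x < 1 -> 0 < l x) /\
  (forall a, 0 < a -> l (a * x) / l x @[x --> 0^'+] --> (1 : R)).

Definition assumption_SL (R : realType) (mu nu : probability nat R)
    (alpha c d : R) : Prop :=
  [/\ 0 < alpha <= 1, 0 < c, 0 < d &
   exists l k : R -> R,
   [/\ slowly_varying0 l,
       slowly_varying0 k,
       forall s, 0 < s < 1 ->
         pgf mu s = s + c * (1 - s) `^ (1 + alpha) * l (1 - s),
       forall s, 0 < s < 1 ->
         pgf nu s = 1 - d * (1 - s) `^ alpha * k (1 - s) &
       l s / k s @[s --> 0^'+] --> (1 : R)]].

Definition laplace (R : realType) (m : {measure set R -> \bar R}) (lam : R) : \bar R :=
  (\int[m]_x (expR (- lam * x))%:E)%E.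

(* Markov transition semigroup on the state space [0,oo): [Q t z] is a
   probability on R for all reals t and z, but only t, z >= 0 matter. *)
Definition transition_semigroup (R : realType) (Q : R -> R.-pker R ~> R) : Prop :=
  [/\ forall t z, 0 <= t -> 0 <= z -> Q t z `[0, +oo[%classic = 1%E,
      forall z, 0 <= z -> forall B, measurable B -> Q 0 z B = \d_z B &
      forall s t z, 0 <= s -> 0 <= t -> 0 <= z -> forall B, measurable B ->
        Q (s + t) z B = (\int[Q s z]_y Q t y B)%E].

(* Continuous functions on [0,oo) vanishing at infinity. *)
Definition C0 (R : realType) (phi : R -> R) : Prop :=
  {within `[0, +oo[%classic, continuous phi} /\ phi x @[x --> +oo] --> (0 : R).

Definition feller (R : realType) (Q : R -> R.-pker R ~> R) : Prop :=
  transition_semigroup Q /\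
  forall phi, C0 phi ->
    (forall t, 0 <= t -> C0 (fun z => Rintegral (Q t z) `[0, +oo[%classic phi)) /\
    (forall e, 0 < e -> \forall t \near 0^'+, forall z, 0 <= z ->
       `| Rintegral (Q t z) `[0, +oo[%classic phi - phi z | <= e).

(* Processes are indexed by all reals, but only times t >= 0 matter. *)
Definition cadlag (R : realType) (x : R -> R) : Prop :=
  (forall t, 0 <= t -> x u @[u --> t^'+] --> x t) /\
  (forall t, 0 < t -> cvg (x u @[u --> t^'-])).

Definition natural_filtration (dT : measure_display) (T : measurableType dT)
    (R : realType) (Z : R -> T -> R) (s : R) : set (set T) :=
  <<s [set A | exists r B, [/\ 0 <= r <= s, measurable B & A = Z r @^-1` B]] >>.

Definition markov (dT : measure_display) (T : measurableType dT)
    (R : realType) (P : probability T R) (Z : R -> T -> R)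
    (Q : R -> R.-pker R ~> R) : Prop :=
  forall s t, 0 <= s -> 0 <= t ->
  forall A B, natural_filtration Z s A -> measurable B ->
    P (A `&` Z (s + t) @^-1` B) = (\int[P]_(w in A) Q t (Z s w) B)%E.

(* Q t z is the law of Z(t) under P_z, and d / (alpha * c) is the exponent
   usually denoted delta. Since alpha > 0, lam `^ alpha is 0 at lam = 0. *)
Definition CBI_process (dT : measure_display) (T : measurableType dT)
    (R : realType) (P : probability T R) (alpha c d : R)
    (Z : R -> T -> R) : Prop :=
  [/\ forall t, 0 <= t -> measurable_fun setT (Z t),
      forall t w, 0 <= t -> 0 <= Z t w,
      forall w, cadlag (Z ^~ w),
      {ae P, forall w, Z 0 w = 0} &
      exists Q : R -> R.-pker R ~> R,
      [/\ feller Q,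
          forall t z lam, 0 <= t -> 0 <= z -> 0 <= lam ->
            laplace (Q t z) lam =
            ((1 + alpha * c * lam `^ alpha * t) `^ (- (d / (alpha * c))) *
             expR (- lam * z *
                   (1 + alpha * c * lam `^ alpha * t) `^ (- alpha^-1)))%:E &
          markov P Z Q]].

(* g_t(Z); the set of zeros contains 0 almost surely, so the convention
   sup set0 = 0 only matters on a null set. *)
Definition last_zero (R : realType) (T : Type) (Z : R -> T -> R) (t : R)
    (w : T) : R :=
  sup [set s | 0 <= s <= t /\ Z s w = 0].

(* [kappa] is a regular conditional distribution of Y given X. Here X need not
   be measurable for the (possibly incomplete) sigma-algebra of T: it is
   required to be almost surely equal to a random variable G, and the
   defining property does not depend on the choice of G. *)
Definition regular_cond_distribution (dT : measure_display)
    (T : measurableType dT) (R : realType) (P : probability T R)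
    (Y X : T -> R) (kappa : R.-pker R ~> R) : Prop :=
  exists G : {RV P >-> R},
    {ae P, forall w, G w = X w} /\
    forall A B : set R, measurable A -> measurable B ->
      P (G @^-1` A `&` Y @^-1` B) =
      (\int[distribution P G]_(s in A) kappa s B)%E.

(* Taking lam = 0 shows that m has total mass 1. *)
Definition linnik_law (R : realType) (alpha c l : R)
    (m : {measure set R -> \bar R}) : Prop :=
  m `[0, +oo[%classic = 1%E /\
  forall lam, 0 <= lam ->
    laplace m lam = ((1 + alpha * c * l * lam `^ alpha)^-1)%:E.

(* Main.v *)
(* Write a = alpha c lam^alpha. Let W have density proportional to
   w^(-delta) / (1 + w) on (0, oo) and let sigma = t w / (1 + w), which will be
   the law of the last zero before t. The transform E_z(e^(-lam Z(tau))) minus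
   an explicit mixture over W is a function K(tau, z) which vanishes at z = 0,
   tends to e^(-lam z) as tau -> 0, and for which K(t - r, Z(r)) is a
   martingale as long as Z stays away from 0, up to an error that is negligible
   along fine grids. Stopping it when Z gets close to 0 yields
     E(e^(-lam Z(t)); inf_[s,t] Z > 0) = E_W((1 + a (t - sigma))^(-1); sigma < s),
   and the injectivity of the Laplace transform turns this into the joint law
   of Z(t) and of the last time at which Z approaches 0. Optional stopping of
   E_{Z(r)}(e^(-Z(t-r))) at the passage times below 1/m and at their limit shows
   that Z actually vanishes at such a time, so that the latter is almost surely
   the last zero. The Linnik law is a Beta mixture of dilated convolution powers
   of the law of Z(1). *)
From HB Require Import structures.
From mathcomp Require Import ring lra measurable_realfun.
Require Import Defs.
Set Implicit Arguments.
Unset Strict Implicit.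
Unset Printing Implicit Defensive.
Import Order.TTheory GRing.Theory Num.Theory.
Import numFieldNormedType.Exports.
Local Open Scope classical_set_scope.
Local Open Scope ring_scope.

(** Why the mixture has its form: [Q] maps [decay sigma] to (1 + h / sigma)^(-del) times
    [decay (sigma + h)], so that sigma^(-del) [decay sigma] z is space-time harmonic; up to a
    constant it can be read as the intensity, seen from z, of zeros at time sigma. Weighing it by
    (tau - sigma)^(del - 1), the tail of the excursion lengths, and by the Linnik transform at tau -
    sigma accounts for the paths with a last zero at sigma. In the variable w = sigma / (tau -
    sigma) the weights no longer depend on tau. The obstacle is that moving last zeros forward by h
    creates none in the first h units of time, so K is harmonic only up to these. The defect is at
    most [decay h z], which for z away from 0 is of order h^2 because alpha <= 1; n steps of length
    1/n thus cost O(1/n). The last zero is not a stopping time. It is approached through the events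
    without zeros on [s, t], and all stopping takes place on deterministic grids, where the Markov
    property at fixed times is enough. *)

Section bounded_functions.
Context d (T : measurableType d) (R : realType) (mu : {measure set T -> \bar R}).
Variables (D : set T) (mD : measurable D) (muD : (mu D < +oo)%E).

Lemma bounded_integrable (f : T -> R) M : measurable_fun D f ->
  (forall x, D x -> `|f x| <= M) -> mu.-integrable D (EFin \o f).
Proof.
move=> mf fM; apply: measurable_bounded_integrable => //.
exists M; split; first exact: num_real.
by move=> N MN x Dx; apply: le_trans (fM x Dx) (ltW MN).
Qed.

Lemma Rintegral_bound (f : T -> R) M : measurable_fun D f ->
  (forall x, D x -> `|f x| <= M) ->
  `| \int[mu]_(x in D) f x | <= M * fine (mu D).
Proof.
move=> mf fM.
have fi := bounded_integrable mf fM.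
apply: (le_trans (le_normr_Rintegral mD fi)).
rewrite -Rintegral_cst//; apply: le_Rintegral => //.
- exact: (integrable_norm fi).
- by apply: (@bounded_integrable _ `|M|).
Qed.

Lemma bounded_cvg_Rintegral (f_ : nat -> T -> R) (f : T -> R) M :
  (forall n, measurable_fun D (f_ n)) ->
  (forall n x, D x -> `|f_ n x| <= M) ->
  (forall x, D x -> f_ n x @[n --> \oo] --> f x) ->
  \int[mu]_(x in D) f_ n x @[n --> \oo] --> \int[mu]_(x in D) f x.
Proof.
move=> mf fM ff.
have cst_int : mu.-integrable D (EFin \o cst M).
  by apply: (@bounded_integrable _ `|M|).
have mfl : measurable_fun D f by exact: (measurable_fun_cvg mf ff).
have := @dominated_convergence _ _ _ mu D mD (fun n => EFin \o f_ n)
  (EFin \o f) (EFin \o cst M).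
case => //.
- by move=> n; exact/measurable_EFinP.
- exact/measurable_EFinP.
- by apply: aeW => x Dx; apply: cvg_EFin; [exact: nearW|exact: ff].
- by apply: aeW => x Dx n; rewrite lee_fin; exact: fM.
move=> fint _ h.
apply: fine_cvg; rewrite fineK//.
exact: integrable_fin_num.
Qed.

End bounded_functions.

Section image_measure.
Context d d' (T : measurableType d) (T' : measurableType d') (R : realType).
Variables (m : {measure set T -> \bar R}) (f : T -> T').
Hypothesis mf : measurable_fun setT f.

Definition image_measure : {measure set T' -> \bar R}.
Proof. by refine (pushforward m f : {measure set T' -> \bar R}). Defined.

Lemma image_measureE A : image_measure A = m (f @^-1` A).
Proof. by []. Qed.

Lemma ge0_integral_image_measure (g : T' -> \bar R) :
  measurable_fun setT g -> (forall x, 0 <= g x)%E ->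
  (\int[image_measure]_x g x = \int[m]_x g (f x))%E.
Proof. by move=> mg g0; rewrite (ge0_integral_pushforward mf m)//. Qed.

End image_measure.

Lemma measurable_funVr d (T : measurableType d) (R : realType) (D : set T)
  (f : T -> R) : measurable_fun D f -> measurable_fun D (fun x => (f x)^-1).
Proof.
move=> mf.
(* Squaring makes the base nonnegative, where [powR] with exponent -1 is the inverse; the outer
   factor restores the sign and the value 0 at 0. *)
have -> : (fun x => (f x)^-1) = (fun x => f x * (f x * f x) `^ (-1)).
  apply/funext => x; rewrite powR_inv1; last by rewrite -expr2 sqr_ge0.
  by have [->|f0] := eqVneq (f x) 0; [rewrite mul0r invr0|rewrite invfM mulrA divff ?mul1r].
apply: measurable_funM => //.
apply: (@measurableT_comp _ _ _ _ _ _ (fun x : R => x `^ (-1))).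
  exact: measurable_powR.
exact: measurable_funM.
Qed.

(** Normalising by a total mass of 1 changes nothing. The Dirac mass is only the fallback that
    [mnormalize] asks for, and the space has a point because its mass is not 0. *)
Lemma exists_probability d (T : measurableType d) (R : realType) (m : {measure set T -> \bar R}) :
  m setT = 1%E -> exists P : probability T R, forall A, P A = m A.
Proof.
move=> mT.
have [x _] : exists x : T, True.
  apply: contrapT => h; move: mT.
  have -> : [set: T] = set0 by apply/seteqP; split=> // x _; apply: h; exists x.
  by rewrite measure0 => /eqP; rewrite eqe eq_sym oner_eq0.
exists (mnormalize m (dirac x)) => A.
have h : mnormalize m (dirac x) = m :> (set T -> \bar R).
  apply/funext => B; rewrite /mnormalize mT; case: ifPn => [|_].
    by rewrite eqe oner_eq0.
  by rewrite invr1 mule1.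
by rewrite -[in RHS]h.
Qed.

(** * Uniqueness of Laplace transforms *)

Section laplace_uniqueness.
Context (R : realType).
Implicit Types (x y q lam c : R).

Lemma bernoulli_ineq y n : 0 <= y <= 1 -> 1 - n%:R * y <= (1 - y) ^+ n.
Proof.
move=> /andP[y0 y1]; elim: n => [|n IH]; first by rewrite mul0r subr0 expr0.
rewrite exprS; apply: (@le_trans _ _ ((1 - y) * (1 - n%:R * y))).
  rewrite -natr1; have := mulr_ge0 (ler0n R n) (mulr_ge0 y0 y0); lra.
by apply: ler_wpM2l => //; rewrite subr_ge0.
Qed.

(** With r the square root of q, (1 - r) n r^n <= 1 by induction, hence n q^n <= r^n / (1 - r). *)
Lemma cvg_natmul_expr q : 0 <= q < 1 -> n%:R * q ^+ n @[n --> \oo] --> (0 : R).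
Proof.
move=> /andP[q0 q1].
pose r := Num.sqrt q.
have r0 : 0 <= r by exact: sqrtr_ge0.
have r1 : r < 1 by rewrite -sqrtr1 ltr_sqrt.
have qE : q = r * r by rewrite -expr2 sqr_sqrtr.
have bound n : (1 - r) * (n%:R * r ^+ n) <= 1.
  elim: n => [|n IH]; first by rewrite mul0r mulr0.
  have rn1 : r ^+ n <= 1 by apply: exprn_ile1 => //; exact: ltW.
  have rn0 : 0 <= r ^+ n by exact: exprn_ge0.
  have r1' : 0 <= 1 - r by lra.
  rewrite exprS -natr1.
  have -> : (1 - r) * ((n%:R + 1) * (r * r ^+ n)) =
    r * ((1 - r) * (n%:R * r ^+ n)) + (1 - r) * (r * r ^+ n) by ring.
  have h1 : r * ((1 - r) * (n%:R * r ^+ n)) <= r * 1 by apply: ler_wpM2l.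
  have h2 : (1 - r) * (r * r ^+ n) <= (1 - r) * 1.
    by apply: ler_wpM2l => //; rewrite mulr_ile1// ltW.
  lra.
have := @cvg_geometric R (1 - r)^-1 r.
rewrite ger0_norm// => /(_ r1) cg.
apply: (squeeze_cvgr _ (cvg_cst _) cg).
apply: nearW => n; rewrite mulr_ge0 ?exprn_ge0//= /geometric /=.
rewrite qE exprMn mulrA; apply: ler_wpM2r; first exact: exprn_ge0.
by rewrite -[leRHS]mulr1 ler_pdivlMl//; lra.
Qed.

(** For y < 1/2, Bernoulli's inequality bounds the power below by 1 - n (2 y)^n. For y >= 1/2 one
    has y^n >= 2^(-n), so that 2^n factors together are at most e^(-1); the extra exponent n sends
    this to 0, even at y = 1/2. *)
Lemma cvg_threshold y : 0 <= y <= 1 ->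
  (1 - y ^+ n) ^+ (n * 2 ^ n) @[n --> \oo] --> (if y < 2^-1 then 1 else 0 : R).
Proof.
move=> /andP[y0 y1].
have yn n : 0 <= y ^+ n <= 1 by rewrite exprn_ge0//= exprn_ile1.
case: ifPn => y2.
  have : 1 - n%:R * (2 * y) ^+ n @[n --> \oo] --> (1 - 0 : R).
    apply: cvgB; first exact: cvg_cst.
    by apply: cvg_natmul_expr; apply/andP; split; lra.
  rewrite subr0 => h.
  apply: (squeeze_cvgr _ h (cvg_cst _)); apply: nearW => n.
  have /andP[yn0 yn1] := yn n.
  apply/andP; split; last by apply: exprn_ile1; lra.
  apply: le_trans (bernoulli_ineq _ (yn n)).
  by rewrite natrM natrX exprMn mulrA.
rewrite -leNgt in y2.
have e1 : expR (-1) < 1 :> R by rewrite -[ltRHS]expR0 ltr_expR ltrN10.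
have := @cvg_geometric R 1 (expR (-1)).
rewrite ger0_norm ?expR_ge0// => /(_ e1) cg.
apply: (squeeze_cvgr _ (cvg_cst _) cg); apply: nearW => n.
have /andP[yn0 yn1] := yn n.
rewrite exprn_ge0 /geometric/= ?mul1r; last by lra.
rewrite mulnC exprM; apply: lerXn2r; rewrite ?nnegrE ?expR_ge0 ?exprn_ge0 //; first by lra.
have h : 1 - y ^+ n <= expR (- (2^-1) ^+ n).
  apply: le_trans (expR_ge1Dx _).
  by rewrite lerD2l lerN2 lerXn2r// nnegrE invr_ge0.
apply: (@le_trans _ _ (expR (- (2^-1) ^+ n) ^+ (2 ^ n))).
  by apply: lerXn2r h; rewrite ?nnegrE ?expR_ge0//; lra.
rewrite -expRM_natl ler_expR natrX mulrN -exprMn divff ?expr1n//.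
Qed.

Local Notation Rp := (`[0, +oo[%classic : set R).

Lemma expRN_bounds lam x : 0 <= lam -> 0 <= x -> 0 <= expR (- lam * x) <= 1.
Proof.
by move=> l0 x0; rewrite expR_ge0 -expR0 ler_expR mulNr oppr_le0 mulr_ge0.
Qed.

Lemma measurable_expRM lam (D : set R) : measurable_fun D (fun x => expR (lam * x)).
Proof. by apply: measurableT_comp => //; apply: measurable_funM. Qed.

(* With y = e^(-x ln 2 / c), [cvg_threshold] turns (1 - y^n)^(n 2^n), a
   combination of exponentials of x, into the indicator of x > c. *)
Definition tail_approx (m : {measure set R -> \bar R}) c n : R :=
  let p : {poly R} := (1 - 'X^n) ^+ (n * 2 ^ n) in
  \sum_(i < size p) p`_i * fine (laplace m (i%:R * (ln 2 / c))).

Section one_measure.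
Variable m : {measure set R -> \bar R}.
Hypothesis mfin : (m setT < +oo)%E.
Hypothesis mneg : m `]-oo, 0[%classic = 0%E.

Let mRp : (m Rp < +oo)%E.
Proof. by apply: le_lt_trans mfin; apply: le_measure; rewrite ?inE. Qed.

Lemma laplace_Rintegral lam : 0 <= lam ->
  \int[m]_(x in Rp) expR (- lam * x) = fine (laplace m lam).
Proof.
move=> l0; congr fine; rewrite /laplace [RHS](@ge0_negligible_integral _ _ R m setT `]-oo, 0[%classic)//.
- by congr (\int[_]_(_ in _) _)%E; rewrite setTD setCitvl.
- by apply/measurable_EFinP; exact: measurable_expRM.
Qed.

Lemma Rintegral_poly_exp (p : {poly R}) lam : 0 <= lam ->
  \int[m]_(x in Rp) p.[expR (- lam * x)] =
  \sum_(i < size p) p`_i * fine (laplace m (i%:R * lam)).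
Proof.
move=> l0.
under eq_Rintegral do rewrite horner_coef.
rewrite /Rintegral; under eq_integral do rewrite -sumEFin.
have pi (i : 'I_(size p)) : m.-integrable Rp
    (fun x => (p`_i * expR (- lam * x) ^+ i)%:E).
  apply: (@bounded_integrable _ _ _ _ _ _ _ _ `|p`_i|) => //.
    apply: measurable_funM => //; apply: measurable_funX; exact: measurable_expRM.
  move=> x /=; rewrite in_itv/= andbT => x0.
  have /andP[e0 e1] := expRN_bounds l0 x0.
  rewrite normrM ler_piMr// ger0_norm ?exprn_ge0 ?exprn_ile1//.
rewrite integral_sum// -sum_fine; last first.
  by move=> i _; exact: integrable_fin_num.
apply: eq_bigr => i _.
have il0 : 0 <= i%:R * lam by rewrite mulr_ge0.
rewrite -laplace_Rintegral// -RintegralZl//.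
  by apply: eq_Rintegral => x _; rewrite -expRM_natl; congr (_ * expR _); ring.
apply: (@bounded_integrable _ _ _ _ _ _ _ _ 1) => //; first exact: measurable_expRM.
move=> x /=; rewrite in_itv/= andbT => x0.
by have /andP[e0 e1] := expRN_bounds il0 x0; rewrite ger0_norm.
Qed.

Lemma tail_cvg_laplace c : 0 < c ->
  tail_approx m c n @[n --> \oo] --> fine (m `]c, +oo[%classic).
Proof.
move=> c0; have l0 : 0 <= ln 2 / c :> R.
  by rewrite divr_ge0 ?ln_ge0 ?ltW// ltr1n.
have -> : fine (m `]c, +oo[%classic) =
    \int[m]_(x in Rp) (if expR (- (ln 2 / c) * x) < 2^-1 then 1 else 0 : R).
  have -> : `]c, +oo[%classic = Rp `&` `]c, +oo[%classic.
    by apply/esym/setIidr => x /=; rewrite !in_itv/= !andbT => /(lt_trans c0)/ltW.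
  rewrite -[LHS](mul1r) -Rintegral_cst//; last exact: measurableI.
  rewrite Rintegral_mkcondr; apply: eq_Rintegral => x _.
  rewrite patchE /= mem_setE in_itv/= andbT.
  have -> : 2^-1 = expR (- ln 2) :> R by rewrite expRN lnK// posrE.
  by rewrite ltr_expR mulNr ltrN2 mulrAC ltr_pdivlMr// ltr_pM2l// ln_gt0// ltr1n.
under eq_fun do rewrite /tail_approx -Rintegral_poly_exp//.
apply: (@bounded_cvg_Rintegral _ _ _ m Rp (measurable_itv _) mRp
  (fun n x => ((1 - 'X^n) ^+ (n * 2 ^ n) : {poly R}).[expR (- (ln 2 / c) * x)])
  (fun x => (if expR (- (ln 2 / c) * x) < 2^-1 then 1 else 0 : R)) 1).
- move=> n; apply: (eq_measurable_fun (fun x =>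
    (1 - (expR (- (ln 2 / c) * x)) ^+ n) ^+ (n * 2 ^ n))).
    by move=> x _; rewrite !hornerE.
  apply: measurable_funX; apply: measurable_funB => //.
  by apply: measurable_funX; exact: measurable_expRM.
- move=> n x /=; rewrite in_itv/= andbT => x0.
  have /andP[e0 e1] := expRN_bounds l0 x0.
  rewrite !hornerE.
  have h : 0 <= expR (- (ln 2 / c) * x) ^+ n <= 1 by rewrite exprn_ge0//= exprn_ile1.
  move: (_ ^+ n) h => z /andP[z0 z1].
  by rewrite ger0_norm ?exprn_ge0 ?exprn_ile1//; lra.
- move=> x /=; rewrite in_itv/= andbT => x0.
  under eq_fun do rewrite !hornerE.
  exact: (cvg_threshold (expRN_bounds l0 x0)).
Qed.

End one_measure.

(** The transform at 0 is the total mass, so both measures are finite. The transforms determine the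
    tails beyond c > 0; c = 0 follows by continuity from below, and for c < 0 the tail carries all
    the mass. Tails are stable under intersection and generate the Borel sets. *)
Lemma laplace_inj (m1 m2 : {measure set R -> \bar R}) :
  (m1 setT < +oo)%E ->
  m1 `]-oo, 0[%classic = 0%E -> m2 `]-oo, 0[%classic = 0%E ->
  (forall lam, 0 <= lam -> laplace m1 lam = laplace m2 lam) ->
  forall B, measurable B -> m1 B = m2 B.
Proof.
move=> m1fin m1neg m2neg m12.
have laplace0 (m : {measure set R -> \bar R}) : laplace m 0 = m setT.
  rewrite /laplace; under eq_integral do rewrite oppr0 mul0r expR0.
  by rewrite integral_cst// mul1e.
have mT : m1 setT = m2 setT by rewrite -!laplace0 m12.
have m2fin : (m2 setT < +oo)%E by rewrite -mT.
have finite (m : {measure set R -> \bar R}) (A : set R) : (m setT < +oo)%E ->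
    measurable A -> m A \is a fin_num.
  move=> mfin mA; rewrite ge0_fin_numE//; apply: le_lt_trans mfin.
  by apply: le_measure; rewrite ?inE.
have tail_gt0 c : 0 < c -> m1 `]c, +oo[%classic = m2 `]c, +oo[%classic.
  move=> c0; rewrite -[LHS]fineK ?finite// -[RHS]fineK ?finite//; congr EFin.
  have h1 := tail_cvg_laplace m1fin m1neg c0.
  have h2 := tail_cvg_laplace m2fin m2neg c0.
  have E : tail_approx m1 c = tail_approx m2 c.
    apply/funext => n; apply: eq_bigr => i _; congr (_ * fine _).
    by rewrite m12// mulr_ge0// divr_ge0 ?ln_ge0 ?ler1n// ltW.
  by move: h1; rewrite E => h1; exact: (cvg_unique _ h1 h2).
have tail c : m1 `]c, +oo[%classic = m2 `]c, +oo[%classic.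
  have [/tail_gt0//|c0|<-] := ltgtP 0 c.
    have tl (m : {measure set R -> \bar R}) : (m setT < +oo)%E ->
        m `]-oo, 0[%classic = 0%E -> m `]c, +oo[%classic = m setT.
      move=> mfin mneg.
      have mle : m `]-oo, c]%classic = 0%E.
        apply/eqP; rewrite eq_le measure_ge0 andbT -mneg.
        apply: le_measure; rewrite ?inE//.
        by move=> x /=; rewrite !in_itv/= => /le_lt_trans; apply.
      rewrite -(setUv `]-oo, c]%classic) measureU ?setICr//; last exact: measurableC.
      by rewrite setCitvl [X in (X + _)%E]mle add0e.
    by rewrite !tl.
  have E : `]0, +oo[%classic = \bigcup_n (`]n.+1%:R^-1, +oo[%classic : set R).
    apply/seteqP; split=> x /=.
      rewrite in_itv/= andbT => x0; exists (Num.truncn x^-1) => //=.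
      rewrite in_itv/= andbT invf_plt ?posrE// truncnS_gt//.
    by move=> [n _]/=; rewrite !in_itv/= !andbT; apply: lt_trans; rewrite invr_gt0.
  have cv (m : {measure set R -> \bar R}) :
      m (`]n.+1%:R^-1, +oo[%classic : set R) @[n --> \oo] --> m (`]0, +oo[%classic : set R).
    rewrite E; apply: nondecreasing_cvg_mu => //; first exact: bigcup_measurable.
    apply/nondecreasing_seqP => n; apply/subsetPset => x /=.
    rewrite !in_itv/= !andbT; apply: le_lt_trans.
    by rewrite lef_pV2 ?posrE// ler_nat.
  have E12 : (fun n => m1 (`]n.+1%:R^-1, +oo[%classic : set R)) =
             (fun n => m2 (`]n.+1%:R^-1, +oo[%classic : set R)).
    by apply/funext => n; rewrite tail_gt0.
  by have := cv m1; rewrite E12 => h1; exact: (cvg_unique _ h1 (cv m2)).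
move=> B mB.
apply: (measure_unique (@RGenOInfty.G R) (fun n => `](- n%:R), +oo[%classic)) => //.
- exact: RGenOInfty.measurableE.
- move=> _ _ [x ->] [y ->]; exists (Num.max x y).
  by apply/seteqP; split=> z /=; rewrite !in_itv/= !andbT gt_max => /andP.
- by move=> i; exists (- i%:R).
- apply/seteqP; split=> // x _; exists (Num.truncn `|x|).+1 => //=.
  rewrite in_itv/= andbT ltrNl; apply: le_lt_trans (truncnS_gt _).
  by rewrite -normrN ler_norm.
- by move=> A [x ->].
- by move=> k; rewrite -ge0_fin_numE// finite.
Qed.

End laplace_uniqueness.

(** * Measures and probabilities given by a density *)

Section density_measure.
Import HBNNSimple.

(** The formula is the definition of m on indicators; it extends to simple functions by linearity
    and to nonnegative functions by monotone convergence on both sides. *)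
Lemma exists_density_measure d (T : measurableType d) (R : realType)
    (mu : {measure set T -> \bar R}) (w : T -> R) :
  measurable_fun setT w -> (forall x, 0 <= w x) ->
  exists m : {measure set T -> \bar R}, forall f : T -> \bar R,
    measurable_fun setT f -> (forall x, 0 <= f x)%E ->
    (\int[m]_x f x = \int[mu]_x (f x * (w x)%:E))%E.
Proof.
move=> mw w0.
have mw' : measurable_fun setT (EFin \o w) by exact/measurable_EFinP.
pose nu (A : set T) := (\int[mu]_(x in A) (w x)%:E)%E.
have nu0 : nu set0 = 0%E by rewrite /nu integral_set0.
have nu_ge0 A : (0 <= nu A)%E by apply: integral_ge0 => x _; rewrite lee_fin.
have nu_sigma : semi_sigma_additive nu.
  move=> F mF tF mUF; rewrite /nu; apply: cvg_toP.
    apply: ereal_nondecreasing_is_cvgn => m n mn.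
    by apply: lee_sum_nneg_natr => // k _ _; exact: nu_ge0.
  rewrite ge0_integral_bigcup//=; first exact: measurable_funTS.
  by move=> x _; rewrite lee_fin.
pose m : {measure set T -> \bar R} :=
  HB.pack nu (isMeasure.Build _ _ _ nu nu0 nu_ge0 nu_sigma).
exists m => f mf f0.
pose f_ := nnsfun_approx measurableT mf.
have f_cvg x : EFin \o f_ ^~ x @ \oo --> f x by exact: cvg_nnsfun_approx.
have nd x : {homo (fun n => (f_ n x)%:E) : i j / (i <= j)%N >-> (i <= j)%E}.
  by move=> i j ij; rewrite lee_fin; exact/lefP/nd_nnsfun_approx.
have h1 : (\int[m]_x (f_ n x)%:E)%E @[n --> \oo] --> (\int[m]_x f x)%E.
  rewrite (_ : (fun x => f x) = (fun x => limn (fun n => (f_ n x)%:E))); last first.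
    by apply/funext => x; apply/esym/cvg_lim => //; exact: f_cvg.
  apply: cvg_monotone_convergence => //.
  by move=> n; exact/measurable_EFinP.
  by move=> n x _; rewrite lee_fin.
have h2 : (\int[mu]_x ((f_ n x)%:E * (w x)%:E))%E @[n --> \oo] -->
    (\int[mu]_x (f x * (w x)%:E))%E.
  rewrite (_ : (fun x => f x * (w x)%:E)%E =
      (fun x => limn (fun n => (f_ n x)%:E * (w x)%:E)%E)); last first.
    apply/funext => x; apply/esym/cvg_lim => //.
    by apply: cvgeZr => //; exact: f_cvg.
  apply: cvg_monotone_convergence => //.
  - by move=> n; apply: emeasurable_funM => //; exact/measurable_EFinP.
  - by move=> n x _; rewrite mule_ge0 ?lee_fin.
  - by move=> x _ i j ij; apply: lee_wpmul2r; [rewrite lee_fin|exact: nd].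
apply: (cvg_unique _ h1) => //.
suff -> : (fun n => \int[m]_x (f_ n x)%:E)%E =
  (fun n => \int[mu]_x ((f_ n x)%:E * (w x)%:E))%E by exact: h2.
apply/funext => n; move: (f_ n) => g.
under eq_integral do rewrite fimfunE -fsumEFin//.
rewrite ge0_integral_fsum//; last 2 first.
- by move=> r; apply/measurable_EFinP/measurable_funM.
- by move=> r x _; rewrite EFinM nnfun_muleindic_ge0.
transitivity (\int[mu]_x (\sum_(y \in range g) (y * \1_(g @^-1` [set y]) x)%:E * (w x)%:E))%E;
  last first.
  apply: eq_integral => x _.
  by rewrite [in RHS]fimfunE -[in RHS]fsumEFin// ge0_mule_fsuml// => r; exact: nnfun_muleindic_ge0.
rewrite ge0_integral_fsum//; last 2 first.
- move=> r; apply: emeasurable_funM => //.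
  by apply/measurable_EFinP/measurable_funM.
- by move=> r x _; apply: mule_ge0; [rewrite EFinM nnfun_muleindic_ge0|rewrite lee_fin].
apply: eq_fsbigr => r; rewrite inE => -[x _ rE].
have r0 : 0 <= r by rewrite -rE.
have mgr : measurable (g @^-1` [set r]) by exact: measurable_sfunP.
under eq_integral do rewrite EFinM.
under [RHS]eq_integral do rewrite EFinM -muleA.
rewrite !ge0_integralZl//.
- congr (_ * _)%E; rewrite integral_indic// setIT.
  rewrite [LHS]/= /nu integral_mkcond; apply: eq_integral => z _.
  by rewrite patchE indicE; case: (z \in _); rewrite ?mul1e ?mul0e.
- by apply: emeasurable_funM => //; exact/measurable_EFinP.
- by move=> z _; rewrite mule_ge0 ?lee_fin.
- exact/measurable_EFinP.
Qed.

End density_measure.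

Lemma exists_density_probability (R : realType) (w : R -> R) (J : R) :
  measurable_fun setT w -> (forall x, 0 <= w x) -> 0 < J ->
  (\int[@lebesgue_measure R]_x (w x)%:E = J%:E)%E ->
  exists W : probability R R, forall f : R -> \bar R,
    measurable_fun setT f -> (forall x, 0 <= f x)%E ->
    (J%:E * \int[W]_x f x = \int[@lebesgue_measure R]_x (f x * (w x)%:E))%E.
Proof.
move=> mw w_ge0 J0 Jint.
pose mu := @lebesgue_measure R.
pose w0 x := w x / J.
have w0_ge0 x : 0 <= w0 x by rewrite divr_ge0 // ltW.
have mw0 : measurable_fun setT w0 by exact: measurable_funM.
have [m mP] : exists m : {measure set R -> \bar R}, forall f : R -> \bar R,
    measurable_fun setT f -> (forall x, 0 <= f x)%E ->
    (\int[m]_x f x = \int[mu]_x (f x * (w0 x)%:E))%E.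
  have [m0 m0P] := exists_density_measure mu mw0 w0_ge0.
  (* Lebesgue measure lives on [measurableTypeR R]; pushing forward along the identity brings the
     density measure to [R]. *)
  have mid : measurable_fun setT (id : measurableTypeR R -> R).
    by move=> _ Y mY; rewrite setTI.
  exists (image_measure m0 mid) => f mf f0.
  by rewrite ge0_integral_image_measure// m0P.
have mT : m setT = 1%E.
  rewrite -[LHS]mul1e -integral_cst// mP//=.
  under eq_integral do rewrite mul1e /w0 EFinM muleC.
  rewrite ge0_integralZl//=; last 3 first.
  - exact/measurable_EFinP.
  - by move=> x _; rewrite lee_fin.
  - by rewrite lee_fin invr_ge0 ltW.
  by rewrite Jint -EFinM mulVf ?gt_eqF.
have [W WmE] := exists_probability mT.
exists W => f mf f0.
have -> : (\int[W]_x f x = \int[m]_x f x)%E.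
  by apply: eq_measure_integral => A mA _; exact: WmE.
rewrite mP// -ge0_integralZl//; last 3 first.
- by apply: emeasurable_funM => //; exact/measurable_EFinP.
- by move=> x _; rewrite mule_ge0// lee_fin.
- by rewrite lee_fin ltW.
apply: eq_integral => x _; rewrite muleCA -EFinM; congr (_ * _%:E)%E.
by rewrite /w0 mulrCA divff ?mulr1// gt_eqF.
Qed.

(** * The law proportional to [w^(-del) / (1 + w)] *)

Section power_integrals.
Context (R : realType).
Local Notation mu := (@lebesgue_measure R).
Implicit Types (r x p q : R).

Lemma powR_continuous r x : 0 < x -> {for x, continuous (fun y => y `^ r)}.
Proof.
move=> x0; apply: differentiable_continuous; apply/derivable1_diffP.
by apply: derivable_powR; rewrite in_itv/= andbT.
Qed.

Lemma integral_powR r p q : 0 < p -> p < q -> r + 1 != 0 ->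
  (\int[mu]_(x in `[p, q]) (x `^ r)%:E =
   ((q `^ (r + 1) - p `^ (r + 1)) / (r + 1))%:E)%E.
Proof.
move=> p0 pq r1.
pose F := (r + 1)^-1 \*o (fun x : R => x `^ (r + 1)).
have cF x : 0 < x -> {for x, continuous F}.
  by move=> x0; apply: cvgM; [exact: cvg_cst|exact: powR_continuous].
rewrite (@continuous_FTC2 _ (fun x => x `^ r) F)//.
- by rewrite -EFinB /F/= -mulrBr mulrC.
- apply: continuous_in_subspaceT => x /set_mem/=; rewrite in_itv/= => /andP[px _].
  exact/powR_continuous/(lt_le_trans p0).
- split.
  + move=> x; rewrite in_itv/= => /andP[px _].
    apply: derivableM; first exact: derivable_cst.
    by apply: derivable_powR; rewrite in_itv/= andbT (lt_trans p0).
  + exact/cvg_at_right_filter/cF.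
  + exact/cvg_at_left_filter/cF/(lt_trans p0).
- move=> x; rewrite in_itv/= => /andP[px _].
  have x0 : 0 < x by exact: lt_trans px.
  have dp : derivable (fun x : R => x `^ (r + 1)) x 1.
    by apply: derivable_powR; rewrite in_itv/= andbT.
  rewrite derive1E deriveMl// -derive1E powR_derive1 ?in_itv/= ?andbT//.
  by rewrite addrK mulrA mulVf ?mul1r.
Qed.

(** k times the image of Lebesgue measure under x -> k x + l gives ]a, b] its length, so it is
    Lebesgue measure by uniqueness. *)
Lemma lebesgue_affine (k l : R) (f : R -> \bar R) : 0 < k ->
  measurable_fun setT f -> (forall x, 0 <= f x)%E ->
  (k%:E * \int[mu]_x f (k * x + l)%R = \int[mu]_x f x)%E.
Proof.
move=> k0 mf f0.
pose phi (x : measurableTypeR R) : measurableTypeR R := k * x + l.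
have mphi : measurable_fun setT phi.
  by apply: measurable_funD => //; apply: measurable_funM.
pose m : {measure set (measurableTypeR R) -> \bar R} :=
  mscale (NngNum (ltW k0)) (image_measure mu mphi).
have mE A : measurable A -> mu A = m A.
  apply: (@lebesgue_measure_unique _ m) => _ [[a b]] _ <- /=.
  rewrite /m /= /mscale image_measureE /=.
  have -> : phi @^-1` `]a, b] = `](a - l) / k, (b - l) / k]%classic.
    apply/seteqP; split => x /=; rewrite !in_itv/= /phi.
      by rewrite ltr_pdivrMr// ler_pdivlMr// (mulrC x); move=> /andP[? ?]; apply/andP; split; lra.
    by rewrite ltr_pdivrMr// ler_pdivlMr// (mulrC x); move=> /andP[? ?]; apply/andP; split; lra.
  rewrite !lebesgue_measure_itv/= !lte_fin ltr_pM2r ?invr_gt0// ltrD2r.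
  case: ifPn => _; last by rewrite mule0.
  by rewrite -!EFinD -EFinM; congr EFin; field; rewrite gt_eqF.
have -> : (\int[mu]_x f x = \int[m]_x f x)%E.
  by apply: eq_measure_integral => A mA _; exact: mE.
rewrite ge0_integral_mscale//; congr (_ * _)%E.
by rewrite ge0_integral_image_measure.
Qed.

End power_integrals.

Section euler_integral.
Context (R : realType) (del : R).
Hypothesis del01 : 0 < del < 1.
Local Notation mu := (@lebesgue_measure R).
Implicit Types (a v w x tau : R).

Let del0 : 0 < del. Proof. by case/andP: del01. Qed.
Let del1 : del < 1. Proof. by case/andP: del01. Qed.

(** In the variable w / (1 + w) this is the unnormalised Beta(1 - del, del) density, the generalised
    arcsine law of the last zero. *)
Definition euler_fun w : R := if 0 < w then w `^ (- del) / (1 + w) else 0.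

Lemma euler_fun_ge0 w : 0 <= euler_fun w.
Proof.
rewrite /euler_fun; case: ifPn => // w0; rewrite divr_ge0 ?powR_ge0//.
by rewrite addr_ge0// ltW.
Qed.

Lemma measurable_euler_fun : measurable_fun setT euler_fun.
Proof.
apply: measurable_fun_ifT => //; first exact: measurable_fun_ltr.
apply: measurable_funM; first exact: measurable_powR.
by apply: measurable_funVr; apply: measurable_funD.

Qed.

(** Cutting at 1 leaves the majorant x^(-del) near 0, integrable as del < 1, and x^(-del - 1) near
    infinity, integrable as del > 0. Their integrals are bounded by the two terms, uniformly in
    n. *)
Lemma integral_euler_fun_bound n :
  (\int[mu]_(x in `[n.+2%:R^-1%R, n.+2%:R%R]) (euler_fun x)%:E
   <= ((1 - del)^-1 + del^-1)%:E)%E.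
Proof.
have mE : measurable_fun setT (EFin \o euler_fun).
  by apply/measurable_EFinP; exact: measurable_euler_fun.
have n1 : n.+2%:R^-1 < 1 :> R by rewrite invf_lt1// ltr1n.
have n2 : 1 < n.+2%:R :> R by rewrite ltr1n.
have n0 : 0 < n.+2%:R^-1 :> R by rewrite invr_gt0.
apply: (@le_trans _ _ (\int[mu]_(x in `[n.+2%:R^-1%R, 1%R]) (x `^ (- del))%:E
  + \int[mu]_(x in `[1%R, n.+2%:R%R]) (x `^ (- del - 1))%:E)%E).
  apply: (@le_trans _ _ (\int[mu]_(x in `[n.+2%:R^-1%R, 1%R]) (euler_fun x)%:E
    + \int[mu]_(x in `[1%R, n.+2%:R%R]) (euler_fun x)%:E)%E).
    rewrite (@itv_bndbnd_setU _ _ _ (BRight 1)) ?bnd_simp; [|exact/ltW..].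
    rewrite ge0_integral_setU//=.
    - by rewrite leeD2l// integral_itv_obnd_cbnd//; exact: measurable_funTS.
    - exact: measurable_funTS.
    - by move=> x _; rewrite lee_fin euler_fun_ge0.
    - apply/disj_setPS => y [/=]; rewrite !in_itv/= => /andP[_ y1] /andP[].
      by rewrite ltNge y1.
  apply: leeD; apply: ge0_le_integral => //=.
  - by move=> x _; rewrite lee_fin euler_fun_ge0.
  - exact: measurable_funTS.
  - by apply/measurable_EFinP/measurable_funTS; exact: measurable_powR.
  - move=> x; rewrite in_itv/= => /andP[nx _].
    have x0 : 0 < x by exact: lt_le_trans nx.
    rewrite lee_fin /euler_fun x0 ler_pdivrMr; last lra.
    by rewrite ler_peMr ?powR_ge0//; lra.
  - by move=> x _; rewrite lee_fin euler_fun_ge0.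
  - exact: measurable_funTS.
  - by apply/measurable_EFinP/measurable_funTS; exact: measurable_powR.
  - move=> x; rewrite in_itv/= => /andP[x1 _].
    have x0 : 0 < x by exact: lt_le_trans x1.
    rewrite lee_fin /euler_fun x0 powRB; last by rewrite (gt_eqF x0) implybT.
    rewrite powRr1; last exact: ltW.
    apply: ler_wpM2l; first exact: powR_ge0.
    by rewrite lef_pV2 ?lerDr// ?posrE// addr_gt0.
have e1 : - del + 1 != 0 by rewrite gt_eqF// addrC subr_gt0.
have e2 : - del - 1 + 1 != 0 by rewrite subrK oppr_eq0 gt_eqF.
rewrite !integral_powR//.
rewrite subrK !powR1 -EFinD lee_fin lerD//.
  rewrite (addrC (- del)) ler_pdivrMr ?subr_gt0// mulVf ?gt_eqF ?subr_gt0//.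
rewrite invrN mulrN -mulNr opprB ler_pdivrMr// mulVf ?gt_eqF//.
Qed.

Definition euler_cst : R := fine (\int[mu]_x (euler_fun x)%:E).

Lemma integral_euler_fun : (\int[mu]_x (euler_fun x)%:E = euler_cst%:E)%E /\ 0 < euler_cst.
Proof.
have mE D : measurable_fun D (EFin \o euler_fun).
  by apply: measurable_funTS; apply/measurable_EFinP; exact: measurable_euler_fun.
have fin : (\int[mu]_x (euler_fun x)%:E <= ((1 - del)^-1 + del^-1)%:E)%E.
  pose K n : set R := `[n.+2%:R^-1, n.+2%:R]%classic.
  have -> : (\int[mu]_x (euler_fun x)%:E =
             \int[mu]_(x in \bigcup_n K n) (euler_fun x)%:E)%E.
    rewrite [RHS]integral_mkcond; apply: eq_integral => x _.
    rewrite patchE; case: ifPn => // /negP xn.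
    rewrite /euler_fun; case: ifPn => // x0; case: xn; apply/mem_set.
    (* The index has to exceed both x and 1 / x. *)
    exists (Num.truncn (Num.max x x^-1)) => //=.
    have h : Num.max x x^-1 < (Num.truncn (Num.max x x^-1)).+2%:R.
      by apply: (lt_trans (truncnS_gt _)); rewrite ltr_nat.
    move: h; rewrite gt_max => /andP[h1 h2].
    rewrite /K /= in_itv/= (ltW h1) andbT.
    by rewrite invf_ple ?posrE ?(ltW h2).
  have cv : (\int[mu]_(x in K i) (euler_fun x)%:E @[i --> \oo] -->
      \int[mu]_(x in \bigcup_i K i) (euler_fun x)%:E)%E.
    apply: ge0_nondecreasing_set_cvg_integral => //.
    - apply/nondecreasing_seqP => n; apply/subsetPset => x; rewrite /K /= !in_itv/=.
      move=> /andP[x1 x2]; apply/andP; split.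
        by apply: le_trans x1; rewrite lef_pV2 ?posrE// ler_nat.
      by apply: (le_trans x2); rewrite ler_nat.
    - by move=> n; exact: measurable_itv.
    - by move=> n; exact: mE.
    - by move=> n x _; rewrite lee_fin euler_fun_ge0.
  rewrite -(cvg_lim _ cv)//; apply: lime_le.
    by apply/cvg_ex; eexists; exact: cv.
  by apply: nearW => n; exact: integral_euler_fun_bound.
have h : (\int[mu]_x (euler_fun x)%:E = euler_cst%:E)%E.
  rewrite /euler_cst fineK// ge0_fin_numE; first exact: le_lt_trans fin (ltry _).
  by apply: integral_ge0 => x _; rewrite lee_fin euler_fun_ge0.
split=> //; rewrite -lte_fin -h.
(* A constant minorant on [1, 2] makes the total mass positive. *)
apply: (@lt_le_trans _ _ (\int[mu]_(x in `[1%R, 2%R]) (cst (2 `^ (- del) / 3)%:E x))%E).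
  rewrite integral_cst//= lebesgue_measure_itv/= lte_fin ltr1n /= -EFinD -EFinM lte_fin.
  by rewrite mulr_gt0 ?divr_gt0 ?powR_gt0//; lra.
apply: (@le_trans _ _ (\int[mu]_(x in `[1%R, 2%R]) (euler_fun x)%:E)%E).
  apply: ge0_le_integral => //=.
  - exact: mE.
  - move=> x; rewrite in_itv/= => /andP[x1 x2].
    have x0 : 0 < x by lra.
    rewrite lee_fin /euler_fun x0; apply: ler_pM; rewrite ?powR_ge0 ?invr_ge0//.
      rewrite !powRN lef_pV2 ?posrE ?powR_gt0//.
      by apply: ge0_ler_powR; rewrite ?nnegrE// ltW.
    by rewrite lef_pV2 ?posrE; lra.
apply: ge0_subset_integral => //; first exact: mE.
by move=> x _; rewrite lee_fin euler_fun_ge0.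
Qed.

End euler_integral.

Section euler_law.
Context (R : realType) (del : R).
Hypothesis del01 : 0 < del < 1.
Local Notation mu := (@lebesgue_measure R).
Local Notation efun := (euler_fun del).
Local Notation ecst := (euler_cst del).

Local Notation Rpos := (`]0, +oo[%classic : set R).

(* [W] has density proportional to [euler_fun del]. The two identities are the
   substitutions [w -> (1 + b) w] and [w -> (1 + h / tau) w + h / tau]; the
   latter moves a last zero [tau w / (1 + w)] forward in time by [h]. *)
Lemma exists_euler_law : exists W : probability R R,
  [/\ W Rpos = 1%E,
   forall b, 0 <= b ->
     (\int[W]_(w in Rpos) ((1 + w) / (1 + w + b))%:E)%E = ((1 + b) `^ (- del))%:E &
   forall tau h (F : R -> R), 0 < tau -> 0 <= h ->
     measurable_fun setT F -> (forall x, 0 <= F x) ->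
     (\int[W]_(w in Rpos)
        (F (tau / (1 + w)) * (1 + h * (1 + w) / (tau * w)) `^ (- del))%:E)%E =
     (\int[W]_(w in Rpos)
        (if h < (tau + h) * w / (1 + w)
         then F ((tau + h) / (1 + w)) else 0)%:E)%E].
Proof.
have [Jint J0] := integral_euler_fun del01.
have mE : measurable_fun setT (EFin \o efun).
  by apply/measurable_EFinP; exact: measurable_euler_fun.
have [W WP] := exists_density_probability (measurable_euler_fun del)
  (@euler_fun_ge0 _ del) J0 Jint.
have WE (f : R -> \bar R) : measurable_fun Rpos f ->
    (forall x, 0 < x -> (0 <= f x)%E) ->
    (ecst%:E * \int[W]_(x in Rpos) f x =
     \int[mu]_(x in Rpos) (f x * (x `^ (- del) / (1 + x))%:E))%E.
  move=> mf f0.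
  have f0' x : (0 <= (f \_ Rpos) x)%E.
    by rewrite patchE; case: ifPn => // /set_mem/=; rewrite in_itv/= andbT => /f0.
  have mf' : measurable_fun setT (f \_ Rpos).
    by apply/(measurable_restrictT _ _).1.
  rewrite integral_mkcond WP// [in RHS]integral_mkcond.
  apply: eq_integral => x _; rewrite !patchE.
  case: ifPn => [/set_mem/=|_]; last by rewrite mul0e.
  by rewrite in_itv/= andbT /euler_fun => ->.
have cancel (x y : \bar R) : (ecst%:E * x = ecst%:E * y)%E -> x = y.
  move/(congr1 (fun z => (ecst^-1)%:E * z)%E).
  by rewrite !muleA -!EFinM mulVf ?gt_eqF// !mul1e.
have eulerE : (\int[mu]_(x in Rpos) (x `^ (- del) / (1 + x))%:E = ecst%:E)%E.
  rewrite -Jint [LHS]integral_mkcond; apply: eq_integral => x _.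
  rewrite patchE mem_setE in_itv/= andbT /euler_fun.
  by case: ifPn.
exists W; split.
- apply: cancel; rewrite -[X in (_ * X)%E]mul1e -integral_cst// WE//=.
  by under eq_integral do rewrite mul1e; rewrite eulerE mule1.
- move=> b b0; apply: cancel; rewrite WE; last 2 first.
  + apply/measurable_EFinP; apply: measurable_funM; first exact: measurable_funD.
    by apply: measurable_funVr; apply: measurable_funD => //; exact: measurable_funD.
  + by move=> x x0; rewrite lee_fin divr_ge0// ?addr_ge0// ltW.
  have k0 : 0 < 1 + b by rewrite ltr_wpDr.
  pose f x : \bar R := if 0 < x then (x `^ (- del) / (1 + x + b))%:E else 0%E.
  have -> : (\int[mu]_(x in Rpos) (((1 + x) / (1 + x + b))%:E *
      (x `^ (- del) / (1 + x))%:E) = \int[mu]_x f x)%E.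
    rewrite [LHS]integral_mkcond; apply: eq_integral => x _.
    rewrite patchE mem_setE in_itv/= andbT /f; case: ifPn => // x0.
    rewrite -EFinM; congr EFin; field.
    by rewrite !gt_eqF//; lra.
  rewrite -(@lebesgue_affine _ (1 + b) 0); last 3 first.
  + exact: k0.
  + rewrite /f; apply: measurable_fun_ifT => //; first exact: measurable_fun_ltr.
    apply/measurable_EFinP; apply: measurable_funM; first exact: measurable_powR.
    by apply: measurable_funVr; apply: measurable_funD => //; exact: measurable_funD.
  + move=> x; rewrite /f; case: ifPn => // x0.
    by rewrite lee_fin divr_ge0 ?powR_ge0// !addr_ge0// ltW.
  have -> : (\int[mu]_x f ((1 + b) * x + 0)%R =
      \int[mu]_x (((1 + b) `^ (- del) / (1 + b))%:E * (efun x)%:E))%E.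
    apply: eq_integral => x _; rewrite /f addr0 pmulr_rgt0// /euler_fun.
    case: ifPn => x0; last by rewrite mule0.
    rewrite -EFinM; congr EFin; rewrite powRM ?(ltW x0) ?(ltW k0)//; field.
    by rewrite !gt_eqF//; nra.
  rewrite ge0_integralZl//; last 2 first.
  + by move=> x _; rewrite lee_fin euler_fun_ge0.
  + by rewrite lee_fin divr_ge0 ?powR_ge0 ?ltW.
  rewrite Jint -!EFinM; congr EFin; field.
  by rewrite gt_eqF.
- move=> tau h F tau0 h0 mF F0; apply: cancel.
  have m1 (g : R -> R) : measurable_fun setT g -> measurable_fun setT (fun x => g x / (1 + x)).
    by move=> mg; apply: measurable_funM => //; apply: measurable_funVr; exact: measurable_funD.
  have mc (c : R) : measurable_fun setT (fun x : R => c / (1 + x)) by apply: m1.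
  have mcond : measurable_fun setT (fun w : R => h < (tau + h) * w / (1 + w)).
    apply: measurable_fun_ltr => //.
    apply: (m1 (fun w => (tau + h) * w)); exact: measurable_funM.
  rewrite WE; last 2 first.
  + apply/measurable_EFinP; apply: measurable_funTS; apply: measurable_funM.
      apply: (@measurableT_comp _ _ _ _ _ _ F) => //; exact: mc.
    apply: (@measurableT_comp _ _ _ _ _ _ (fun x : R => x `^ (- del))).
      exact: measurable_powR.
    apply: measurable_funD => //; apply: measurable_funM.
      by apply: measurable_funM => //; exact: measurable_funD.
    by apply: measurable_funVr; exact: measurable_funM.
  + by move=> x x0; rewrite lee_fin mulr_ge0 ?powR_ge0.
  rewrite WE; last 2 first.
  + apply/measurable_EFinP; apply: measurable_funTS; apply: measurable_fun_ifT => //.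
    by apply: (@measurableT_comp _ _ _ _ _ _ F) => //; exact: mc.
  + by move=> x x0; rewrite lee_fin; case: ifPn.
  pose f x : \bar R := (if h < (tau + h) * x / (1 + x)
     then F ((tau + h) / (1 + x)) * efun x else 0)%:E.
  have -> : (\int[mu]_(x in Rpos) ((if h < (tau + h) * x / (1 + x)
     then F ((tau + h) / (1 + x)) else 0)%:E * (x `^ (- del) / (1 + x))%:E) =
     \int[mu]_x f x)%E.
    rewrite [LHS]integral_mkcond; apply: eq_integral => x _.
    rewrite patchE mem_setE in_itv/= andbT /f /euler_fun; case: ifPn => // x0.
      by rewrite -EFinM; congr EFin; case: ifPn => //; rewrite mul0r.
    by rewrite mulr0 if_same.
  have k0 : 0 < 1 + h / tau by rewrite ltr_wpDr// divr_ge0// ltW.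
  have mf : measurable_fun setT f.
    apply/measurable_EFinP; apply: measurable_fun_ifT => //.
    apply: measurable_funM; last exact: measurable_euler_fun.
    by apply: (@measurableT_comp _ _ _ _ _ _ F) => //; exact: mc.
  rewrite -(@lebesgue_affine _ (1 + h / tau) (h / tau)); last 3 first.
  + exact: k0.
  + exact: mf.
  + by move=> x; rewrite lee_fin; case: ifPn => // _; rewrite mulr_ge0 ?euler_fun_ge0.
  rewrite -ge0_integralZl//; last 3 first.
  + apply: (measurableT_comp mf).
    by apply: measurable_funD => //; exact: measurable_funM.
  + by move=> x _; rewrite lee_fin; case: ifPn => // _; rewrite mulr_ge0 ?euler_fun_ge0.
  + by rewrite lee_fin ltW.
  rewrite [LHS]integral_mkcond; apply: eq_integral => w _.
  rewrite patchE mem_setE in_itv/= andbT /f -EFinM.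
  have taun : tau != 0 by rewrite gt_eqF.
  set w' := (1 + h / tau) * w + h / tau.
  (* Consequently (tau + h) / (1 + w') = tau / (1 + w): the time elapsed since the last zero does
     not change under the shift. *)
  have w'E : 1 + w' = (1 + w) * (tau + h) / tau by rewrite /w'; field.
  have th0 : 0 < tau + h by rewrite ltr_wpDr.
  have condE : 0 < 1 + w -> (h < (tau + h) * w' / (1 + w')) = (0 < w).
    move=> w1; rewrite w'E; have -> : (tau + h) * w' / ((1 + w) * (tau + h) / tau) =
        h + tau * w / (1 + w).
      by rewrite /w'; field; rewrite taun !gt_eqF.
    by rewrite ltrDl pmulr_lgt0 ?invr_gt0// pmulr_rgt0.
  have [w0'|w0'] := ltP 0 w.
    have w1 : 0 < 1 + w by rewrite addr_gt0.
    have w'0 : 0 < w' by rewrite ltr_pwDl ?mulr_gt0// divr_ge0// ltW.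
    have FE : (tau + h) / (1 + w') = tau / (1 + w).
      by rewrite w'E; field; rewrite taun !gt_eqF.
    rewrite condE// w0' FE -EFinM; congr EFin.
    have w'M : w' = w * (1 + h * (1 + w) / (tau * w)).
      by rewrite /w'; field; rewrite taun gt_eqF.
    rewrite /euler_fun w'0 {1}w'M powRM ?(ltW w0')//; last first.
      by rewrite addr_ge0// divr_ge0// mulr_ge0// ltW.
    rewrite w'E; field.
    by rewrite taun !gt_eqF.
  (* Here w <= 0. Either 1 + w > 0 and the shifted last zero is at most h, so the test fails, or w'
     < 0 and the density vanishes. *)
  rewrite /euler_fun; case: ifPn => [c1|_]; last by rewrite ?mule0 ?mulr0.
  case: ifPn => [w'0|_]; last by rewrite ?mule0 ?mulr0 ?mule0.
  exfalso.
  have w1 : 0 < 1 + w.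
    have : 0 < 1 + w' by rewrite addr_gt0.
    by rewrite w'E pmulr_lgt0 ?invr_gt0// pmulr_lgt0.
  by move: c1; rewrite condE// ltNge w0'.
Qed.

End euler_law.

(** * Existence of the Linnik law *)

Section linnik_existence.
Context (R : realType).
Local Notation mu := (@lebesgue_measure R).
Local Notation Rp := (`[0, +oo[%classic : set R).
Local Notation Rpos := (`]0, +oo[%classic : set R).

(** V has density proportional to (1 + y)^(-kap), so that y / (1 + y) has a Beta(1, kap - 1) law.
    Since (1 + y) (1 + a y / (1 + y)) = 1 + (1 + a) y, the integrand times the density is the
    density at (1 + a) y, and the substitution produces the factor 1 / (1 + a). *)
Lemma exists_pareto_law (kap : R) : 2 <= kap ->
  exists V : probability R R,
  [/\ V Rpos = 1%E &
   forall a, 0 <= a ->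
     (\int[V]_(y in Rpos) ((1 + a * (y / (1 + y))) `^ (- kap))%:E)%E
     = ((1 + a)^-1)%:E].
Proof.
move=> kap2; have h2 : 0 < (2^-1 : R) < 1 by apply/andP; split; lra.
pose w (x : R) := if 0 < x then (1 + x) `^ (- kap) else 0.
have w_ge0 x : 0 <= w x by rewrite /w; case: ifPn; rewrite ?powR_ge0.
have mpow (g : R -> R) : measurable_fun setT g -> measurable_fun setT (fun x => (g x) `^ (- kap)).
  by move=> mg; exact: (measurableT_comp (@measurable_powR R (- kap)) mg).
have mw : measurable_fun setT w.
  apply: measurable_fun_ifT => //; first exact: measurable_fun_ltr.
  by apply: mpow; apply: measurable_funD.
(* As kap >= 2, the density lies below the Euler density of exponent 1/2, whose integral is already
   known to be finite. *)
have w_le x : w x <= euler_fun 2^-1 x.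
  rewrite /w /euler_fun; case: ifPn => // x0.
  have x1 : 1 <= 1 + x by lra.
  apply: (@le_trans _ _ ((1 + x) `^ (- 2))); first by apply: ler_powR => //; lra.
  have -> : (1 + x) `^ (- 2) = (1 + x) `^ (-1) * (1 + x)^-1.
    by rewrite powR_invn ?powR_inv1 -?expr2 ?exprVn//; lra.
  apply: ler_wpM2r; first by rewrite invr_ge0; lra.
  apply: (@le_trans _ _ ((1 + x) `^ (- 2^-1))); first by apply: ler_powR => //; lra.
  rewrite !powRN lef_pV2 ?posrE ?powR_gt0//; last lra.
  by apply: ge0_ler_powR; rewrite ?nnegrE; lra.
have [Eint E0] := integral_euler_fun h2.
have wfin : (\int[mu]_x (w x)%:E)%E \is a fin_num.
  rewrite ge0_fin_numE; last by apply: integral_ge0 => x _; rewrite lee_fin.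
  apply: (@le_lt_trans _ _ (\int[mu]_x (euler_fun 2^-1 x)%:E)%E); last by rewrite Eint ltry.
  apply: ge0_le_integral => //.
  - by move=> x _; rewrite lee_fin.
  - exact/measurable_EFinP.
  - by apply/measurable_EFinP; exact: measurable_euler_fun.
  - by move=> x _; rewrite lee_fin.
pose J := fine (\int[mu]_x (w x)%:E)%E.
have Jint : (\int[mu]_x (w x)%:E = J%:E)%E by rewrite /J fineK.
have J0 : 0 < J.
  rewrite -lte_fin -Jint.
  apply: (@lt_le_trans _ _ (\int[mu]_(x in `[1%R, 2%R]) (cst (3 `^ (- kap))%:E x))%E).
    rewrite integral_cst//= lebesgue_measure_itv/= lte_fin ltr1n /= -EFinD -EFinM lte_fin.
    by rewrite mulr_gt0 ?powR_gt0//; lra.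
  apply: (@le_trans _ _ (\int[mu]_(x in `[1%R, 2%R]) (w x)%:E)%E).
    apply: ge0_le_integral => //=.
    - by apply: measurable_funTS; apply/measurable_EFinP.
    - move=> x; rewrite in_itv/= => /andP[x1 x2].
      have x0 : 0 < x by apply: lt_le_trans x1.
      rewrite lee_fin /w x0 !powRN lef_pV2 ?posrE ?powR_gt0 ?addr_gt0//.
      apply: ge0_ler_powR; rewrite ?nnegrE ?addr_ge0 ?(ltW x0)//; lra.
  apply: ge0_subset_integral => //.
  - exact/measurable_EFinP.
  - by move=> x _; rewrite lee_fin.
have [V VP] := exists_density_probability mw w_ge0 J0 Jint.
have cancel (x y : \bar R) : (J%:E * x = J%:E * y)%E -> x = y.
  move/(congr1 (fun z => (J^-1)%:E * z)%E).
  by rewrite !muleA -!EFinM mulVf ?gt_eqF// !mul1e.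
have VE (f : R -> R) : measurable_fun setT f ->
    (forall x, 0 < x -> 0 <= f x) ->
    (J%:E * \int[V]_(x in Rpos) (f x)%:E =
     \int[mu]_x (if (0 < x)%R then f x * (1 + x) `^ (- kap) else 0)%:E)%E.
  move=> mf f0; rewrite integral_mkcond VP.
  - apply: eq_integral => x _; rewrite patchE mem_setE in_itv/= andbT /w.
    by case: ifPn => _; rewrite ?mule0 -?EFinM.
  - apply/(measurable_restrictT _ _).1 => //.
    by apply: measurable_funTS; exact/measurable_EFinP.
  - by move=> x; rewrite patchE mem_setE in_itv/= andbT; case: ifPn => // /f0.
exists V; split.
- apply: cancel; rewrite -[X in (_ * X)%E]mul1e -integral_cst// VE//= mule1 -Jint.
  by apply: eq_integral => x _; rewrite /w mul1r.
- move=> a a0; apply: cancel.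
  have mratio : measurable_fun setT (fun y : R => y / (1 + y)).
    by apply: measurable_funM => //; apply: measurable_funVr; exact: measurable_funD.
  rewrite VE; last 2 first.
  + by apply: mpow; apply: measurable_funD => //; apply: measurable_funM.
  + by move=> x x0; rewrite powR_ge0.
  have a1 : 0 < 1 + a by rewrite ltr_wpDr.
  rewrite -Jint -(@lebesgue_affine _ (1 + a) 0 (fun x => (w x)%:E))//; last exact/measurable_EFinP.
  rewrite muleAC -EFinM mulfV ?gt_eqF// mul1e.
  apply: eq_integral => x _; congr EFin; rewrite addr0 /w pmulr_rgt0//.
  case: ifPn => // x0; have x1 : 0 < 1 + x by rewrite addr_gt0.
  rewrite -powRM ?(ltW x1)//; last by rewrite addr_ge0// mulr_ge0// divr_ge0// ltW.
  by congr (_ `^ _); field; rewrite gt_eqF.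
Qed.

Lemma exists_convolution (m q : probability R R) (phi psi : R -> R) :
  m Rp = 1%E -> q Rp = 1%E ->
  (forall lam, 0 <= lam -> laplace m lam = (phi lam)%:E) ->
  (forall lam, 0 <= lam -> laplace q lam = (psi lam)%:E) ->
  exists p : probability R R, p Rp = 1%E /\
    (forall lam, 0 <= lam -> laplace p lam = (phi lam * psi lam)%:E).
Proof.
move=> mRp qRp mlap qlap.
have madd : measurable_fun setT (fun z : R * R => z.1 + z.2) by exact: measurable_funD.
have mRpM : measurable Rp by exact: measurable_itv.
pose I : {measure set R -> \bar R} := image_measure (m \x q)%E madd.
(* A lower bound suffices, a probability being at most 1. It comes from the product of the half
   lines, which the addition maps into the half line. *)
have IRp : (1 <= I Rp)%E.
  have <- : ((m \x q)%E (Rp `*` Rp) = 1)%E.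
    by rewrite product_measure1E// [X in (X * _)%E]mRp [X in (_ * X)%E]qRp mule1.
  rewrite image_measureE; apply: le_measure; rewrite ?inE.
  - exact: measurableX.
  - by have := madd measurableT _ mRpM; rewrite setTI.
  - by move=> [x y]/=; rewrite !in_itv/= !andbT => -[x0 y0]; rewrite addr_ge0.
have IT : I setT = 1%E.
  transitivity ((m \x q)%E (setT `*` setT)); first by rewrite setXTT.
  by rewrite product_measure1E// [X in (X * _)%E](@probability_setT _ _ _ m) [X in (_ * X)%E](@probability_setT _ _ _ q) mule1.
have [p pI] := exists_probability IT.
exists p; split.
  by apply/eqP; rewrite eq_le probability_le1//= pI.
move=> lam l0.
have -> : laplace p lam = laplace I lam.
  by apply: eq_measure_integral => A mA _; exact: pI.
rewrite /laplace ge0_integral_image_measure//; last first.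
  by apply/measurable_EFinP; exact: measurable_expRM.
rewrite fubini_tonelli1//=; last first.
  apply/measurable_EFinP; apply: measurableT_comp => //.
  by apply: measurable_funM.
rewrite EFinM -mlap// -qlap// /laplace muleC -ge0_integralZl//; last 2 first.
- by apply/measurable_EFinP; exact: measurable_expRM.
- by apply: integral_ge0 => x _; rewrite lee_fin expR_ge0.
apply: eq_integral => x _; rewrite /fubini_F/=.
rewrite muleC -ge0_integralZl//; last first.
  by apply/measurable_EFinP; exact: measurable_expRM.
by apply: eq_integral => y _; rewrite -EFinM -expRD mulrDr.
Qed.

Lemma exists_convolution_power (q : probability R R) (phi : R -> R) n :
  q Rp = 1%E ->
  (forall lam, 0 <= lam -> laplace q lam = (phi lam)%:E) ->
  exists p : probability R R, p Rp = 1%E /\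
    (forall lam, 0 <= lam -> laplace p lam = (phi lam ^+ n.+1)%:E).
Proof.
move=> qRp qlap; elim: n => [|n [p [pRp plap]]]; first by exists q.
have [p' [h1 h2]] := exists_convolution pRp qRp plap qlap.
by exists p'; split => // lam l0; rewrite h2// [in RHS]exprSr.
Qed.

Lemma exists_scaled_law (alpha : R) (V m : probability R R) (phi : R -> R) :
  0 < alpha -> V Rpos = 1%E -> m Rp = 1%E ->
  (forall lam, 0 <= lam -> laplace m lam = (phi (lam `^ alpha))%:E) ->
  exists p : probability R R, p Rp = 1%E /\
    (forall lam, 0 <= lam -> laplace p lam =
      (\int[V]_(y in Rpos) (phi (lam `^ alpha * (y / (1 + y))))%:E)%E).
Proof.
move=> al0 VRpos mRp mlap.
have mratio : measurable_fun setT (fun y : R => (y / (1 + y)) `^ alpha^-1).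
  apply: (@measurableT_comp _ _ _ _ _ _ (fun x : R => x `^ alpha^-1)).
    exact: measurable_powR.
  by apply: measurable_funM => //; apply: measurable_funVr; exact: measurable_funD.
have mscal : measurable_fun setT (fun z : R * R => (z.1 / (1 + z.1)) `^ alpha^-1 * z.2).
  apply: measurable_funM => //.
  exact: (measurableT_comp mratio measurable_fst).
have mRpM : measurable Rp by exact: measurable_itv.
pose I : {measure set R -> \bar R} := image_measure (V \x m)%E mscal.
have IRp : (1 <= I Rp)%E.
  have <- : ((V \x m)%E (Rpos `*` Rp) = 1)%E.
    by rewrite product_measure1E// [X in (X * _)%E]VRpos [X in (_ * X)%E]mRp mule1.
  rewrite image_measureE; apply: le_measure; rewrite ?inE.
  - exact: measurableX.
  - by have := mscal measurableT _ mRpM; rewrite setTI.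
  - by move=> [x y]/=; rewrite !in_itv/= !andbT => -[x0 y0]; rewrite mulr_ge0 ?powR_ge0.
have IT : I setT = 1%E.
  transitivity ((V \x m)%E (setT `*` setT)); first by rewrite setXTT.
  by rewrite product_measure1E// [X in (X * _)%E](@probability_setT _ _ _ V) [X in (_ * X)%E](@probability_setT _ _ _ m) mule1.
have [p pI] := exists_probability IT.
exists p; split.
  by apply/eqP; rewrite eq_le probability_le1//= pI.
move=> lam l0.
have -> : laplace p lam = laplace I lam.
  by apply: eq_measure_integral => A mA _; exact: pI.
rewrite /laplace ge0_integral_image_measure//; last first.
  by apply/measurable_EFinP; exact: measurable_expRM.
have mf : measurable_fun setT (fun z : R * R =>
    (expR (- lam * ((z.1 / (1 + z.1)) `^ alpha^-1 * z.2)))%:E).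
  apply/measurable_EFinP; apply: measurableT_comp => //.
  by apply: measurable_funM.
have f0 (z : R * R) : (0 <= (expR (- lam * ((z.1 / (1 + z.1)) `^ alpha^-1 * z.2)))%:E)%E.
  by rewrite lee_fin expR_ge0.
rewrite fubini_tonelli1//=.
rewrite (@ge0_negligible_integral _ _ R V setT (~` Rpos))//; last 4 first.
- exact: measurableC.
- exact: measurable_fun_fubini_tonelli_F.
- by move=> x _; apply: integral_ge0 => y _.
- by have := probability_setC V (measurable_itv `]0%R, +oo[); rewrite VRpos subee.
rewrite setTD setCK; apply: eq_integral => y /set_mem/=; rewrite in_itv/= andbT => y0.
have r0 : 0 <= y / (1 + y) by rewrite divr_ge0// ?addr_ge0// ltW.
have <- : (lam * (y / (1 + y)) `^ alpha^-1) `^ alpha = lam `^ alpha * (y / (1 + y)).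
  by rewrite (powRM alpha l0 (powR_ge0 _ _)) -powRrM mulVf ?gt_eqF// powRr1.
rewrite -mlap ?mulr_ge0 ?powR_ge0// /laplace.
by apply: eq_integral => x _; rewrite mulNr mulrA mulNr.
Qed.

(* A Beta mixture of the powers (1 + a u)^(-k), k >= 2, gives (1 + a)^(-1). As
   [q] has transform (1 + A lam^alpha)^(-del), a convolution power of [q] gives
   k = n del, and mixing over u amounts to rescaling by u^(1/alpha). *)
Lemma exists_linnik_law (alpha A del : R) (q : probability R R) :
  0 < alpha -> 0 <= A -> 0 < del -> q Rp = 1%E ->
  (forall lam, 0 <= lam -> laplace q lam = ((1 + A * lam `^ alpha) `^ (- del))%:E) ->
  exists p : probability R R, p Rp = 1%E /\
    (forall lam, 0 <= lam -> laplace p lam = ((1 + A * lam `^ alpha)^-1)%:E).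
Proof.
move=> al0 A0 del0 qRp qlap.
(* Chosen so that the exponent (n + 1) del of the convolution power is at least 2, as
   [exists_pareto_law] requires. *)
pose n := Num.truncn (2 / del).
have n2 : 2 <= n.+1%:R * del.
  by rewrite -ler_pdivrMr//; apply/ltW; exact: truncnS_gt.
have [m [mRp mlap]] := exists_convolution_power n qRp qlap.
have [V [VRpos VE]] := exists_pareto_law n2.
pose phi (x : R) := (1 + A * x) `^ (- (n.+1%:R * del)).
have mlap' lam : 0 <= lam -> laplace m lam = (phi (lam `^ alpha))%:E.
  move=> l0; rewrite mlap//; congr EFin; cbv beta.
  rewrite -powR_mulrn ?powR_ge0// -powRrM.
  by congr (_ `^ _); ring.
have [p [pRp plap]] := exists_scaled_law al0 VRpos mRp mlap'.
exists p; split => // lam l0; rewrite plap//.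
rewrite -VE ?mulr_ge0 ?powR_ge0//.
by apply: eq_integral => y _; rewrite /phi mulrA.
Qed.

End linnik_existence.

(** * Kernels obtained by rescaling one law *)

Section scale_kernel.
Context (R : realType) (N : probability R R) (g : R -> R).

Let mul_measurable s : measurable_fun setT (fun x : R => g s * x).
Proof. exact: measurable_funM. Qed.

Definition scale_kernel (mg : measurable_fun setT g) (s : R) :
  {measure set R -> \bar R} := image_measure N (mul_measurable s).

Variable mg : measurable_fun setT g.

Let scale_kernel_measurable U : measurable U ->
  measurable_fun setT (fun s => scale_kernel mg s U).
Proof.
move=> mU.
pose f (z : R * R) := g z.1 * z.2.
have mf : measurable_fun setT f.
  by apply: measurable_funM => //; exact: (measurableT_comp mg measurable_fst).
have mfU : measurable (f @^-1` U) by have := mf measurableT _ mU; rewrite setTI.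
have -> : (fun s => scale_kernel mg s U) = N \o xsection (f @^-1` U).
  apply/funext => s /=; congr (N _); apply/seteqP; split => x /=.
    by move=> h; rewrite /xsection/=; apply/mem_set.
  by rewrite /xsection/= => /set_mem.
exact: measurable_fun_xsection.
Qed.

HB.instance Definition _ := isKernel.Build _ _ R R R (scale_kernel mg)
  scale_kernel_measurable.

Let scale_kernel_setT s : scale_kernel mg s setT = 1%E.
Proof. exact: probability_setT. Qed.

HB.instance Definition _ := Kernel_isProbability.Build _ _ R R R
  (scale_kernel mg) scale_kernel_setT.

End scale_kernel.

Section linnik_kernel.
Context (R : realType) (alpha c t : R) (N : probability R R).
Hypothesis alpha0 : 0 < alpha.
Hypothesis NRp : N `[0, +oo[%classic = 1%E.
Hypothesis Nlap : forall lam, 0 <= lam ->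
  laplace N lam = ((1 + alpha * c * lam `^ alpha)^-1)%:E.

Let mroot : measurable_fun setT (fun s : R => (t - s) `^ alpha^-1).
Proof.
apply: (@measurableT_comp _ _ _ _ _ _ (fun x : R => x `^ alpha^-1)).
  exact: measurable_powR.
exact: measurable_funB.
Qed.

(** Linnik laws are self-similar: the law of parameter l is that of l^(1/alpha) X, with X of
    parameter 1. One law [N] thus yields the whole family, measurably in s. For s > t the power
    takes a default value, but the kernel remains a probability. *)
Definition linnik_kernel : R.-pker R ~> R := scale_kernel N mroot.

Lemma linnik_kernel_law s : s < t -> linnik_law alpha c (t - s) (linnik_kernel s).
Proof.
move=> st; split.
  rewrite -[RHS]NRp; congr (N _); apply/seteqP; split => x /=; rewrite !in_itv/= !andbT.
    by rewrite pmulr_rge0// powR_gt0// subr_gt0.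
  by move=> x0; rewrite mulr_ge0 ?powR_ge0.
move=> lam l0.
rewrite /laplace ge0_integral_image_measure//; last first.
  by apply/measurable_EFinP; exact: measurable_expRM.
have -> : alpha * c * (t - s) * lam `^ alpha =
    alpha * c * (lam * (t - s) `^ alpha^-1) `^ alpha.
  rewrite (powRM alpha l0 (powR_ge0 _ _)) -powRrM mulVf ?gt_eqF// powRr1; last first.
    by rewrite subr_ge0 ltW.
  by ring.
rewrite -Nlap ?mulr_ge0 ?powR_ge0//.
by apply: eq_integral => x _; rewrite mulNr mulrA mulNr.
Qed.

End linnik_kernel.

(** * Transforms split according to the last zero *)

Section absolute_value.
Context (R : realType) (m : {measure set R -> \bar R}).
Hypothesis mT : m setT = 1%E.
Hypothesis mRp : m `[0, +oo[%classic = 1%E.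

Lemma half_line_null : m `]-oo, 0[%classic = 0%E.
Proof.
have h : m setT = (m (`]-oo, 0%R[%classic : set R) + m (`[0%R, +oo[%classic : set R))%E.
  rewrite -measureU//; last first.
    by apply/seteqP; split => x //=; rewrite !in_itv/= andbT => -[x0]; rewrite leNgt x0.
  congr (m _); apply/seteqP; split => x //= _; rewrite !in_itv/= andbT.
  by case: (ltP x 0); [left|right].
move: h; rewrite mT mRp.
have : (0 <= m (`]-oo, 0%R[%classic : set R))%E by [].
case: (m _) => [r| |]//=; rewrite lee_fin => r0.
by rewrite -EFinD => -[] h; congr EFin; lra.
Qed.

Lemma integral_half_line (f : R -> \bar R) : measurable_fun setT f ->
  (forall x, 0 <= f x)%E ->
  (\int[m]_x f x = \int[m]_(x in `[0%R, +oo[) f x)%E.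
Proof.
move=> mf f0; rewrite (@ge0_negligible_integral _ _ R m setT `]-oo, 0[%classic)//.
  by rewrite setTD setCitvl.
exact: half_line_null.
Qed.

Lemma integral_normr (f : R -> \bar R) : measurable_fun setT f ->
  (forall x, 0 <= f x)%E -> (\int[m]_x f `|x|%R = \int[m]_x f x)%E.
Proof.
move=> mf f0; rewrite !integral_half_line//; last first.
  by apply: measurableT_comp => //; exact: normr_measurable.
by apply: eq_integral => x /set_mem/=; rewrite in_itv/= andbT => x0; rewrite ger0_norm.
Qed.

End absolute_value.

Section harmonic_functions.
Context (R : realType) (alpha c del : R) (W : probability R R)
  (Q : R -> R.-pker R ~> R).
Hypothesis alpha0 : 0 < alpha.
Hypothesis c0 : 0 < c.
Hypothesis del01 : 0 < del < 1.
Local Notation Rpos := (`]0, +oo[%classic : set R).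
Hypothesis WRpos : W Rpos = 1%E.
Hypothesis Wtot : forall b, 0 <= b ->
  (\int[W]_(w in Rpos) ((1 + w) / (1 + w + b))%:E)%E = ((1 + b) `^ (- del))%:E.
Hypothesis Wshift : forall tau h (F : R -> R), 0 < tau -> 0 <= h ->
     measurable_fun setT F -> (forall x, 0 <= F x) ->
     (\int[W]_(w in Rpos)
        (F (tau / (1 + w)) * (1 + h * (1 + w) / (tau * w)) `^ (- del))%:E)%E =
     (\int[W]_(w in Rpos)
        (if h < (tau + h) * w / (1 + w)
         then F ((tau + h) / (1 + w)) else 0)%:E)%E.
Hypothesis Q_half_line : forall t z, 0 <= t -> 0 <= z ->
  Q t z `[0, +oo[%classic = 1%E.
Hypothesis Q_laplace : forall t z lam, 0 <= t -> 0 <= z -> 0 <= lam ->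
  laplace (Q t z) lam =
    ((1 + alpha * c * lam `^ alpha * t) `^ (- del) *
     expR (- lam * z * (1 + alpha * c * lam `^ alpha * t) `^ (- alpha^-1)))%:E.

Let A0 : 0 < alpha * c. Proof. exact: mulr_gt0. Qed.
Let del0 : 0 < del. Proof. by case/andP: del01. Qed.

(* [psi lam t z] is E_z(e^(-lam Z(t))) for z >= 0; the absolute value keeps it
   bounded on the whole line. *)
Definition psi (lam t z : R) : R :=
  (1 + alpha * c * lam `^ alpha * t) `^ (- del) *
  expR (- lam * `|z| * (1 + alpha * c * lam `^ alpha * t) `^ (- alpha^-1)).

(* As lam tends to infinity, [psi lam sigma z] is equivalent to
   (alpha c sigma lam^alpha)^(-del) [decay sigma z]. *)
Definition decay (sigma z : R) : R := expR (- (`|z| * (alpha * c * sigma) `^ (- alpha^-1))).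

(** With sigma = tau w / (1 + w) the time left is tau - sigma = tau / (1 + w), so that the quotient
    is the Linnik transform (1 + alpha c lam^alpha (tau - sigma))^(-1). The other factor is the
    influence of the starting point on a last zero at sigma. *)
Definition exc_integrand (lam tau z w : R) : R :=
  (1 + w) / (1 + w + alpha * c * lam `^ alpha * tau) * decay (tau * w / (1 + w)) z.

(* [exc_part] is the part of [psi] carried by the paths having a zero before
   [tau], split according to the position [tau * w / (1 + w)] of the last one;
   [killed] is the part carried by the paths without zero. *)
Definition exc_part (lam tau z : R) : R := \int[W]_(w in Rpos) exc_integrand lam tau z w.

(** The share of [exc_part lam (tau + h) z] due to last zeros within the first h units of time,
    which cannot arise by shifting a last zero forward by h. *)
Definition exc_error (lam tau h z : R) : R := \int[W]_(w in Rpos)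
  (if h < (tau + h) * w / (1 + w) then 0 else exc_integrand lam (tau + h) z w).

Definition killed (lam tau z : R) : R := psi lam tau z - exc_part lam tau z.

Implicit Types (lam tau h z w theta sigma eps eta : R).

Let a_ge0 lam t : 0 <= t -> 0 <= alpha * c * lam `^ alpha * t.
Proof. by move=> t0; rewrite !mulr_ge0 ?powR_ge0// ltW. Qed.

Let a1_gt0 lam t : 0 <= t -> 0 < 1 + alpha * c * lam `^ alpha * t.
Proof. by move=> t0; rewrite ltr_wpDr// a_ge0. Qed.

Lemma Q_setT t z : Q t z setT = 1%E.
Proof. exact: prob_kernel. Qed.

Lemma Q_exp theta h z : 0 <= theta -> 0 <= h -> 0 <= z ->
  (\int[Q h z]_w (expR (- (theta * `|w|%R)))%:E)%E = (psi theta h z)%:E.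
Proof.
move=> th0 h0 z0.
have -> : (\int[Q h z]_w (expR (- (theta * `|w|%R)))%:E)%E = laplace (Q h z) theta.
  rewrite /laplace.
  have := @integral_normr R (Q h z) (Q_setT h z) (Q_half_line h0 z0)
    (fun x => (expR (- theta * x))%:E).
  move=> <-; first by apply: eq_integral => x _; rewrite mulNr.
    by apply/measurable_EFinP; exact: measurable_expRM.
  by move=> x; rewrite lee_fin expR_ge0.
by rewrite Q_laplace// /psi ger0_norm.
Qed.

Lemma psi_bounds lam t z : 0 <= lam -> 0 <= t -> 0 <= psi lam t z <= 1.
Proof.
move=> l0 t0; rewrite /psi mulr_ge0 ?powR_ge0 ?expR_ge0//=.
apply: mulr_ile1; [exact: powR_ge0|exact: expR_ge0| |].
  rewrite powRN invf_le1 ?powR_gt0 ?a1_gt0//.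
  apply: (@le_trans _ _ (1 `^ del)); first by rewrite powR1.
  apply: ge0_ler_powR; [exact: ltW|by rewrite nnegrE|by rewrite nnegrE ltW ?a1_gt0|].
  by rewrite lerDl a_ge0.
by rewrite -[leRHS]expR0 ler_expR !mulNr oppr_le0 !mulr_ge0 ?powR_ge0.
Qed.

Lemma measurable_psi lam t D : measurable_fun D (psi lam t).
Proof.
apply: measurable_funM => //; apply: measurableT_comp => //.
by apply: measurable_funM => //; apply: measurable_funM.
Qed.

(** Up to the factor b^(-del), [psi lam tau] is an exponential with parameter theta = lam
    b^(-1/alpha). Its theta^alpha is lam^alpha / b, so the base of the second step is 1 + x / b and
    the two bases multiply to b + x, the base for tau + h. *)
Lemma Q_psi lam tau h z : 0 <= lam -> 0 <= tau -> 0 <= h -> 0 <= z ->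
  (\int[Q h z]_w (psi lam tau w)%:E)%E = (psi lam (tau + h) z)%:E.
Proof.
move=> l0 tau0 h0 z0.
set b := 1 + alpha * c * lam `^ alpha * tau.
have b0 : 0 < b by exact: a1_gt0.
have th0 : 0 <= lam * b `^ (- alpha^-1) by rewrite mulr_ge0 ?powR_ge0.
transitivity (\int[Q h z]_w ((b `^ (- del))%:E *
    (expR (- (lam * b `^ (- alpha^-1) * `|w|%R)))%:E))%E.
  by apply: eq_integral => w _; rewrite /psi -/b -EFinM; congr (_ * expR _)%:E; ring.
rewrite ge0_integralZl//; last 2 first.
- apply/measurable_EFinP; apply: measurableT_comp => //; apply: measurableT_comp => //.
  by apply: measurable_funM => //; exact: normr_measurable.
- by rewrite lee_fin powR_ge0.
rewrite Q_exp// -EFinM; congr EFin; rewrite /psi.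
have -> : alpha * c * (lam * b `^ (- alpha^-1)) `^ alpha * h =
    (alpha * c * lam `^ alpha * h) / b.
  rewrite (powRM alpha l0 (powR_ge0 _ _)) -powRrM mulNr mulVf ?gt_eqF//.
  by rewrite powR_inv1 ?ltW//; ring.
set x := alpha * c * lam `^ alpha * h.
have x0 : 0 <= x by exact: a_ge0.
have -> : 1 + alpha * c * lam `^ alpha * (tau + h) = b * (1 + x / b).
  by rewrite /b /x; field; rewrite -/b gt_eqF.
have y0 : 0 <= 1 + x / b by rewrite addr_ge0// divr_ge0// ltW.
rewrite !(powRM _ (ltW b0) y0) mulrA; congr (_ * expR _).
by ring.
Qed.

Lemma measurable_exc_integrand lam tau :
  measurable_fun setT (fun p : R * R => exc_integrand lam tau p.1 p.2).
Proof.
have m2 : measurable_fun setT (fun p : R * R => 1 + p.2) by apply: measurable_funD.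
apply: measurable_funM.
  apply: measurable_funM => //; apply: measurable_funVr.
  exact: measurable_funD.
apply: measurableT_comp => //; apply: measurableT_comp => //.
apply: measurable_funM.
  by apply: measurableT_comp => //; exact: normr_measurable.
apply: (measurableT_comp (@measurable_powR R _)).
apply: measurable_funM => //; apply: measurable_funM; last exact: measurable_funVr.
exact: measurable_funM.
Qed.

Lemma measurable_exc_integrand1 lam tau z D : measurable_fun D (exc_integrand lam tau z).
Proof.
apply: measurable_funTS.
have mp : measurable_fun setT (fun w : R => (z, w)) by exact: measurable_pair1.
exact: (measurableT_comp (measurable_exc_integrand lam tau) mp).
Qed.

Lemma decay_bounds sigma z : 0 <= decay sigma z <= 1.
Proof.
by rewrite /decay expR_ge0/= -[leRHS]expR0 ler_expR oppr_le0 mulr_ge0 ?powR_ge0.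
Qed.

Lemma measurable_after_last_zero (T h : R) :
  measurable_fun setT (fun w : R => h < T * w / (1 + w)).
Proof.
apply: measurable_fun_ltr; first exact: measurable_cst.
apply: measurable_funM; first exact: measurable_funM.
by apply: measurable_funVr; exact: measurable_funD.
Qed.

Lemma measurable_decay sigma D : measurable_fun D (decay sigma).
Proof.
by apply: measurableT_comp => //; apply: measurableT_comp => //; apply: measurable_funM.
Qed.

Lemma exc_ratio_bounds lam tau w : 0 <= tau -> 0 < w ->
  0 <= (1 + w) / (1 + w + alpha * c * lam `^ alpha * tau) <= 1.
Proof.
move=> tau0 w0; have w1 : 0 < 1 + w by rewrite addr_gt0.
have d0 : 0 < 1 + w + alpha * c * lam `^ alpha * tau by rewrite ltr_wpDr// a_ge0.
apply/andP; split; first by rewrite divr_ge0// ltW.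
by rewrite ler_pdivrMr// mul1r lerDl a_ge0.
Qed.

Lemma exc_integrand_bounds lam tau z w : 0 <= tau -> 0 < w ->
  0 <= exc_integrand lam tau z w <= 1.
Proof.
move=> tau0 w0; have /andP[r0 r1] := exc_ratio_bounds lam tau0 w0.
have /andP[d0 d1] := decay_bounds (tau * w / (1 + w)) z.
by rewrite /exc_integrand mulr_ge0//= mulr_ile1.
Qed.

Let WRpos_fin : (W Rpos < +oo)%E.
Proof. by rewrite WRpos ltry. Qed.

Let mRpos : measurable Rpos. Proof. exact: measurable_itv. Qed.

Lemma integrable_Rpos (f : R -> R) M : measurable_fun setT f ->
  (forall w, 0 < w -> `|f w| <= M) -> W.-integrable Rpos (EFin \o f).
Proof.
move=> mf fM; apply: (@bounded_integrable _ _ _ _ _ mRpos WRpos_fin _ M).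
  exact: measurable_funTS.
by move=> w /=; rewrite in_itv/= andbT; exact: fM.
Qed.

Lemma integrable_exc_integrand lam tau z : 0 <= tau ->
  W.-integrable Rpos (EFin \o exc_integrand lam tau z).
Proof.
move=> tau0; apply: (@integrable_Rpos _ 1); first exact: measurable_exc_integrand1.
by move=> w /(exc_integrand_bounds lam z tau0) /andP[e0 e1]; rewrite ger0_norm.
Qed.

Lemma exc_partE lam tau z : 0 <= tau ->
  (\int[W]_(w in Rpos) (exc_integrand lam tau z w)%:E)%E = (exc_part lam tau z)%:E.
Proof.
move=> tau0; rewrite /exc_part /Rintegral fineK//.
exact: integrable_fin_num (integrable_exc_integrand lam z tau0).
Qed.

Lemma Rintegral_Rpos_bounds (f : R -> R) : measurable_fun setT f ->
  (forall w, 0 < w -> 0 <= f w <= 1) -> 0 <= \int[W]_(w in Rpos) f w <= 1.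
Proof.
move=> mf f01; apply/andP; split.
  by apply: Rintegral_ge0 => w /=; rewrite in_itv/= andbT => /f01/andP[].
have -> : 1 = \int[W]_(w in Rpos) 1 :> R by rewrite Rintegral_cst// [X in fine X]WRpos mul1r.
apply: le_Rintegral => //.
- apply: (@integrable_Rpos _ 1) => // w /f01/andP[? ?]; by rewrite ger0_norm.
- by apply: (@integrable_Rpos _ 1) => // w _; rewrite normr1.
- by move=> w /=; rewrite in_itv/= andbT => /f01/andP[].
Qed.

Lemma exc_part_bounds lam tau z : 0 <= tau -> 0 <= exc_part lam tau z <= 1.
Proof.
move=> tau0; apply: Rintegral_Rpos_bounds; first exact: measurable_exc_integrand1.
by move=> w w0; exact: exc_integrand_bounds.
Qed.

Lemma measurable_exc_part lam tau D : 0 <= tau -> measurable_fun D (exc_part lam tau).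
Proof.
move=> tau0; apply: measurable_funTS.
apply: (@measurableT_comp _ _ _ _ _ _ (@fine R)); first exact: fine_measurable.
have -> : (fun z => \int[W]_(w in Rpos) (exc_integrand lam tau z w)%:E)%E =
  (fun z => \int[W]_w (exc_integrand lam tau z w * \1_Rpos w)%:E)%E.
  apply/funext => z; rewrite integral_mkcond; apply: eq_integral => w _.
  by rewrite patchE indicE; case: (w \in _); rewrite ?mulr1 ?mulr0.
have mf : measurable_fun setT (fun p : R * R =>
    (exc_integrand lam tau p.1 p.2 * \1_Rpos p.2)%:E).
  apply/measurable_EFinP; apply: measurable_funM; first exact: measurable_exc_integrand.
  apply: (measurableT_comp (f := \1_Rpos : R -> R)) => //.
apply: (@measurable_fun_fubini_tonelli_F _ _ _ _ _ W _ mf) => -[z w] /=.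
rewrite lee_fin indicE mem_setE in_itv/= andbT; case: ltP => w0; last by rewrite mulr0.
by rewrite mulr1; have /andP[] := exc_integrand_bounds lam z tau0 w0.
Qed.

(** The rate theta of the exponential [decay sigma] satisfies alpha c theta^alpha = 1 / sigma, so
    that running time h replaces sigma by sigma + h. The remaining factor is the one that [Wshift]
    absorbs. *)
Lemma Q_decay sigma h z : 0 < sigma -> 0 <= h -> 0 <= z ->
  (\int[Q h z]_x (decay sigma x)%:E)%E =
  ((1 + h / sigma) `^ (- del) * decay (sigma + h) z)%:E.
Proof.
move=> s0 h0 z0.
set theta := (alpha * c * sigma) `^ (- alpha^-1).
have As0 : 0 < alpha * c * sigma by rewrite mulr_gt0.
transitivity (\int[Q h z]_x (expR (- (theta * `|x|%R)))%:E)%E.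
  by apply: eq_integral => x _; rewrite /decay mulrC.
rewrite Q_exp ?powR_ge0// /psi.
have -> : alpha * c * theta `^ alpha * h = h / sigma.
  rewrite /theta -powRrM mulNr mulVf ?gt_eqF// powR_inv1 ?ltW//.
  by field; rewrite !gt_eqF.
have hs0 : 0 <= h / sigma by rewrite divr_ge0// ltW.
congr (_ * expR _)%:E; rewrite -/theta.
have -> : alpha * c * (sigma + h) = (alpha * c * sigma) * (1 + h / sigma).
  by field; rewrite gt_eqF.
rewrite (powRM _ (ltW As0)) ?addr_ge0// -/theta.
by rewrite !mulNr; congr (- _); ring.
Qed.

(** By Fubini, [Q_decay] moves every last zero forward by h. The change of variables [Wshift]
    rewrites the outcome as the integral for tau + h over last zeros after h, and what is missing is
    [exc_error]. *)
Lemma Q_exc_part lam tau h z : 0 < tau -> 0 <= h -> 0 <= z ->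
  (\int[Q h z]_x (exc_part lam tau x)%:E)%E =
  (exc_part lam (tau + h) z - exc_error lam tau h z)%:E.
Proof.
move=> tau0 h0 z0.
have th0 : 0 < tau + h by rewrite ltr_wpDr.
have mf : measurable_fun setT (fun p : R * R =>
    (exc_integrand lam tau p.1 p.2 * \1_Rpos p.2)%:E).
  apply/measurable_EFinP; apply: measurable_funM; first exact: measurable_exc_integrand.
  apply: (measurableT_comp (f := \1_Rpos : R -> R)) => //.
have f0 (p : R * R) : (0 <= (exc_integrand lam tau p.1 p.2 * \1_Rpos p.2)%:E)%E.
  case: p => x w /=.
  rewrite lee_fin indicE mem_setE in_itv/= andbT; case: ltP => w0; last by rewrite mulr0.
  by rewrite mulr1; have /andP[] := exc_integrand_bounds lam x (ltW tau0) w0.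
have [P' P'E] := exists_probability (Q_setT h z).
have QP (f : R -> \bar R) : (\int[Q h z]_x f x = \int[P']_x f x)%E.
  by apply: eq_measure_integral => A mA _; rewrite [RHS]P'E.
transitivity (\int[P']_x \int[W]_w (exc_integrand lam tau x w * \1_Rpos w)%:E)%E.
  rewrite QP; apply: eq_integral => x _; rewrite -exc_partE ?(ltW tau0)//.
  rewrite integral_mkcond; apply: eq_integral => w _.
  by rewrite patchE indicE; case: (w \in _); rewrite ?mulr1 ?mulr0.
rewrite (fubini_tonelli _ mf f0) /=.
(* [Wshift] sees the integrand as a function F of the time x elapsed since the last zero; the
   absolute value makes F nonnegative on the whole line. *)
pose r (x : R) := (1 + alpha * c * lam `^ alpha * `|x|)^-1.
have r0 x : 0 <= r x.
  by rewrite /r invr_ge0 ltW// a1_gt0.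
pose F (x : R) := r x * decay (tau + h - x) z.
have F0 x : 0 <= F x by rewrite mulr_ge0//; have /andP[] := decay_bounds (tau + h - x) z.
have mF : measurable_fun setT F.
  apply: measurable_funM.
    apply: measurable_funVr; apply: measurable_funD => //; apply: measurable_funM => //.
  apply: measurableT_comp => //; apply: measurableT_comp => //.
  apply: measurable_funM => //; apply: (measurableT_comp (@measurable_powR R _)).
  by apply: measurable_funM => //; exact: measurable_funB.
have FE (T w : R) : 0 <= T -> 0 < w -> r (T / (1 + w)) = (1 + w) / (1 + w + alpha * c * lam `^ alpha * T).
  move=> T0 w0; have w1 : 0 < 1 + w by rewrite addr_gt0.
  rewrite /r ger0_norm ?divr_ge0 ?(ltW w1)//.
  rewrite -[X in X^-1](_ : (1 + w + alpha * c * lam `^ alpha * T) / (1 + w) = _).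
    by rewrite invf_div.
  by field; rewrite gt_eqF.
transitivity (\int[W]_(w in Rpos)
    (F (tau / (1 + w)) * (1 + h * (1 + w) / (tau * w)) `^ (- del))%:E)%E.
  rewrite [RHS]integral_mkcond; apply: eq_integral => w _.
  rewrite patchE; case: ifPn => wR; last first.
    under eq_integral do rewrite indicE (negbTE wR) mulr0.
    by rewrite integral0.
  move: (wR) => /set_mem/=; rewrite in_itv/= andbT => w0.
  have w1 : 0 < 1 + w by rewrite addr_gt0.
  have s0 : 0 < tau * w / (1 + w) by rewrite divr_gt0// mulr_gt0.
  under eq_integral do rewrite indicE wR mulr1 /exc_integrand EFinM.
  rewrite -QP ge0_integralZl//; last 3 first.
  - by apply/measurable_EFinP; exact: measurable_decay.
  - by move=> x _; rewrite lee_fin; have /andP[] := decay_bounds (tau * w / (1 + w)) x.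
  - by rewrite lee_fin; have /andP[] := exc_ratio_bounds lam (ltW tau0) w0.
  rewrite Q_decay// -EFinM; congr EFin; rewrite /F FE ?(ltW tau0)//.
  have -> : h / (tau * w / (1 + w)) = h * (1 + w) / (tau * w).
    by field; rewrite !gt_eqF.
  have -> : tau + h - tau / (1 + w) = tau * w / (1 + w) + h.
    by field; rewrite gt_eqF.
  by ring.
rewrite Wshift//.
pose e w := exc_integrand lam (tau + h) z w.
pose g1 w := if h < (tau + h) * w / (1 + w) then e w else 0.
pose g2 w := if h < (tau + h) * w / (1 + w) then 0 else e w.
have mg1 : measurable_fun setT g1.
  apply: measurable_fun_ifT; first exact: measurable_after_last_zero.
    exact: measurable_exc_integrand1.
  exact: measurable_cst.
have mg2 : measurable_fun setT g2.
  apply: measurable_fun_ifT; first exact: measurable_after_last_zero.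
    exact: measurable_cst.
  exact: measurable_exc_integrand1.
have ig1 : W.-integrable Rpos (EFin \o g1).
  apply: (@integrable_Rpos _ 1) => // w /(exc_integrand_bounds lam z (ltW th0)) /andP[e0 e1].
  by rewrite /g1; case: ifPn; rewrite ?normr0// ger0_norm.
have ig2 : W.-integrable Rpos (EFin \o g2).
  apply: (@integrable_Rpos _ 1) => // w /(exc_integrand_bounds lam z (ltW th0)) /andP[e0 e1].
  by rewrite /g2; case: ifPn; rewrite ?normr0// ger0_norm.
transitivity ((\int[W]_(w in Rpos) g1 w)%:E); last first.
  rewrite /exc_error -[X in _ - X]/(\int[W]_(w in Rpos) g2 w); congr EFin.
  apply/eqP; rewrite eq_sym subr_eq -RintegralD//; apply/eqP.
  by apply: eq_Rintegral => w _; rewrite /g1 /g2 /e; case: ifPn; rewrite ?addr0 ?add0r.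
rewrite /Rintegral fineK; last exact: integrable_fin_num ig1.
have FeE w : 0 < w -> F ((tau + h) / (1 + w)) = e w.
  move=> w0; rewrite /F (FE _ _ (ltW th0) w0) /e /exc_integrand.
  have w1 : 1 + w != 0 by apply: lt0r_neq0; exact: addr_gt0.
  have -> : tau + h - (tau + h) / (1 + w) = (tau + h) * w / (1 + w) by field.
  reflexivity.
apply: eq_integral => w wR; have w0 : 0 < w.
  by move: wR => /set_mem; rewrite /= in_itv /= andbT.
by rewrite /g1 (FeE _ w0).
Qed.

Lemma decay_le_time sigma h z : 0 < sigma -> sigma <= h -> decay sigma z <= decay h z.
Proof.
move=> s0 sh; have h0 := lt_le_trans s0 sh.
rewrite /decay ler_expR lerN2; apply: ler_wpM2l => //.
rewrite !powRN lef_pV2 ?posrE ?powR_gt0 ?mulr_gt0//.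
apply: ge0_ler_powR; [by rewrite invr_ge0 ltW|by rewrite nnegrE ltW ?mulr_gt0
  |by rewrite nnegrE ltW ?mulr_gt0|].
by apply: ler_wpM2l => //; exact: ltW.
Qed.

Lemma decay_le_space sigma x z : `|x| <= z -> decay sigma z <= decay sigma x.
Proof.
move=> xz; rewrite /decay ler_expR lerN2; apply: ler_wpM2r; first exact: powR_ge0.
by rewrite (le_trans xz)// ler_norm.
Qed.

(** Only last zeros sigma <= h contribute; there [decay sigma z] <= [decay h z], and the Linnik
    factor is at most 1. *)
Lemma exc_error_le lam tau h z : 0 < tau -> 0 < h ->
  0 <= exc_error lam tau h z <= decay h z.
Proof.
move=> tau0 h0.
have th0 : 0 < tau + h by rewrite addr_gt0.
have e01 w : 0 < w -> 0 <= exc_integrand lam (tau + h) z w <= 1.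
  by move=> w0; apply: exc_integrand_bounds => //; exact: ltW.
apply/andP; split.
  apply: Rintegral_ge0 => w /=; rewrite in_itv/= andbT => /e01/andP[].
  by case: ifPn.
have -> : decay h z = \int[W]_(w in Rpos) decay h z.
  by rewrite Rintegral_cst// [X in fine X]WRpos mulr1.
have /andP[d0 d1] := decay_bounds h z.
apply: le_Rintegral => //.
- apply: (@integrable_Rpos _ 1).
    apply: measurable_fun_ifT; first exact: measurable_after_last_zero.
      exact: measurable_cst.
    exact: measurable_exc_integrand1.
  by move=> w /e01/andP[? ?]; case: ifPn; rewrite ?normr0// ger0_norm.
- by apply: (@integrable_Rpos _ 1) => // w _; rewrite ger0_norm.
- move=> w /=; rewrite in_itv/= andbT => w0; case: ifPn => // _h.
  rewrite -leNgt in _h.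
  have w1 : 0 < 1 + w by rewrite addr_gt0.
  rewrite /exc_integrand; have /andP[r0 r1] := exc_ratio_bounds lam (ltW th0) w0.
  apply: (@le_trans _ _ (decay ((tau + h) * w / (1 + w)) z)).
    apply: ler_piMl; last exact: r1.
    by have /andP[] := decay_bounds ((tau + h) * w / (1 + w)) z.
  by apply: decay_le_time => //; rewrite divr_gt0// mulr_gt0.
Qed.

Lemma exc_part_le_decay lam tau z : 0 < tau -> exc_part lam tau z <= decay tau z.
Proof.
move=> tau0.
have -> : decay tau z = \int[W]_(w in Rpos) decay tau z.
  by rewrite Rintegral_cst// [X in fine X]WRpos mulr1.
have /andP[d0 d1] := decay_bounds tau z.
apply: le_Rintegral => //.
- exact: integrable_exc_integrand (ltW tau0).
- by apply: (@integrable_Rpos _ 1) => // w _; rewrite ger0_norm.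
- move=> w /=; rewrite in_itv/= andbT => w0.
  have w1 : 0 < 1 + w by rewrite addr_gt0.
  rewrite /exc_integrand; have /andP[r0 r1] := exc_ratio_bounds lam (ltW tau0) w0.
  apply: (@le_trans _ _ (decay (tau * w / (1 + w)) z)).
    apply: ler_piMl; last exact: r1.
    by have /andP[] := decay_bounds (tau * w / (1 + w)) z.
  apply: decay_le_time; first by rewrite divr_gt0// mulr_gt0.
  rewrite -mulrA ler_piMr ?(ltW tau0)// ler_pdivrMr// mul1r lerDr//.
Qed.

Lemma measurable_killed lam tau D : 0 <= tau -> measurable_fun D (killed lam tau).
Proof.
by move=> tau0; apply: measurable_funB; [exact: measurable_psi|exact: measurable_exc_part].
Qed.

Lemma killed_bound lam tau z : 0 <= lam -> 0 <= tau -> `|killed lam tau z| <= 1.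
Proof.
move=> l0 tau0; have /andP[p0 p1] := psi_bounds z l0 tau0.
have /andP[e0 e1] := exc_part_bounds lam z tau0.
by rewrite /killed ler_norml; apply/andP; split; lra.
Qed.

Lemma Q_killed lam tau h z : 0 <= lam -> 0 < tau -> 0 <= h -> 0 <= z ->
  \int[Q h z]_x killed lam tau x = killed lam (tau + h) z + exc_error lam tau h z.
Proof.
move=> l0 tau0 h0 z0.
have Qfin : (Q h z setT < +oo)%E by rewrite Q_setT ltry.
rewrite RintegralB//; last 2 first.
- apply: (@bounded_integrable _ _ _ _ _ _ _ _ 1) => //; first exact: measurable_psi.
  by move=> x _; have /andP[p0 p1] := psi_bounds x l0 (ltW tau0); rewrite ger0_norm.
- apply: (@bounded_integrable _ _ _ _ _ _ _ _ 1) => //.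
    exact: measurable_exc_part (ltW tau0).
  by move=> x _; have /andP[p0 p1] := exc_part_bounds lam x (ltW tau0); rewrite ger0_norm.
rewrite /Rintegral Q_psi ?(ltW tau0)// Q_exc_part//= /killed; ring.
Qed.

(** At z = 0 every [decay] is 1, and [Wtot] says that the last zeros then account for all of [psi]:
    a path started at 0 always has a zero. *)
Lemma exc_part0 lam tau : 0 <= tau ->
  exc_part lam tau 0 = (1 + alpha * c * lam `^ alpha * tau) `^ (- del).
Proof.
move=> tau0; apply: EFin_inj; rewrite -exc_partE// -Wtot ?a_ge0//.
apply: eq_integral => w _.
by rewrite /exc_integrand /decay normr0 mul0r oppr0 expR0 mulr1.
Qed.

Lemma psi_at0 lam tau : psi lam tau 0 = (1 + alpha * c * lam `^ alpha * tau) `^ (- del).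
Proof. by rewrite /psi normr0 mulr0 mul0r expR0 mulr1. Qed.

Lemma killed0 lam tau : 0 <= tau -> killed lam tau 0 = 0.
Proof. by move=> tau0; rewrite /killed psi_at0 exc_part0// subrr. Qed.

(** Since [psi] and [exc_part] agree at z = 0, [killed] near 0 is bounded by their variations
    between 0 and z, one for each term. As [decay] grows with time, its value for eta serves all tau
    >= eta; this uniformity fails as tau tends to 0, where [killed] approaches e^(-lam z). *)
Definition killed_modulus (lam eta eps : R) : R :=
  (1 - expR (- lam * eps)) +
  \int[W]_(w in Rpos) (1 - decay (eta * w / (1 + w)) eps).

Lemma killed_le_modulus lam eta eps tau z : 0 <= lam -> 0 < eta -> eta <= tau ->
  `|z| <= eps -> `|killed lam tau z| <= killed_modulus lam eta eps.
Proof.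
move=> l0 eta0 etatau zeps.
have tau0 := lt_le_trans eta0 etatau.
have -> : killed lam tau z = (psi lam tau z - psi lam tau 0) +
    (exc_part lam tau 0 - exc_part lam tau z).
  by rewrite /killed psi_at0 exc_part0 ?(ltW tau0)//; ring.
apply: (le_trans (ler_normD _ _)); apply: lerD.
  rewrite psi_at0 /psi; set b := 1 + _.
  have b1 : 1 <= b by rewrite lerDl a_ge0// ltW.
  have b0 : 0 < b by exact: lt_le_trans b1.
  have pw r : 0 <= r -> 0 <= b `^ (- r) <= 1.
    move=> r0; rewrite powR_ge0/= -[leRHS](powRr0 b).
    by apply: ler_powR => //; rewrite oppr_le0.
  have /andP[p0 p1] := pw _ (ltW del0).
  have /andP[q0 q1] : 0 <= b `^ (- alpha^-1) <= 1 by rewrite pw// invr_ge0 ltW.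
  rewrite -[X in _ - X]mulr1 -mulrBr normrM ger0_norm//.
  have e1 : expR (- lam * eps) <= expR (- lam * `|z| * b `^ (- alpha^-1)).
    rewrite ler_expR !mulNr lerN2 -mulrA; apply: ler_wpM2l => //.
    by apply: le_trans zeps; rewrite ler_piMr.
  have e2 : expR (- lam * `|z| * b `^ (- alpha^-1)) <= 1.
    by rewrite -[leRHS]expR0 ler_expR !mulNr oppr_le0 !mulr_ge0.
  rewrite ler0_norm ?subr_le0// opprB.
  apply: (@le_trans _ _ (1 - expR (- lam * `|z| * b `^ (- alpha^-1)))); last by rewrite lerD2l lerN2.
  by rewrite ler_piMl// subr_ge0.
have iz x := integrable_exc_integrand lam x (ltW tau0).
rewrite /exc_part -RintegralB//.
have md : measurable_fun setT (fun w => 1 - decay (eta * w / (1 + w)) eps).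
  apply: measurable_funB => //; apply: measurableT_comp => //; apply: measurableT_comp => //.
  apply: measurable_funM => //; apply: (measurableT_comp (@measurable_powR R _)).
  apply: measurable_funM => //; apply: measurable_funM; first exact: measurable_funM.
  by apply: measurable_funVr; exact: measurable_funD.
have diff w : 0 < w -> exc_integrand lam tau 0 w - exc_integrand lam tau z w =
    (1 + w) / (1 + w + alpha * c * lam `^ alpha * tau) * (1 - decay (tau * w / (1 + w)) z).
  by move=> w0; rewrite /exc_integrand {1}/decay normr0 mul0r oppr0 expR0; ring.
apply: (le_trans (le_normr_Rintegral _ _)) => //.
  apply: (@integrable_Rpos _ 1).
    by apply: measurable_funB; exact: measurable_exc_integrand1.
  move=> w w0; have /andP[? ?] := exc_integrand_bounds lam 0 (ltW tau0) w0.
  have /andP[? ?] := exc_integrand_bounds lam z (ltW tau0) w0.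
  by rewrite ler_norml; apply/andP; split; lra.
apply: le_Rintegral => //.
- apply: (@integrable_Rpos _ 1).
    by apply: measurableT_comp => //; apply: measurable_funB; exact: measurable_exc_integrand1.
  move=> w w0; have /andP[? ?] := exc_integrand_bounds lam 0 (ltW tau0) w0.
  have /andP[? ?] := exc_integrand_bounds lam z (ltW tau0) w0.
  by rewrite normr_id ler_norml; apply/andP; split; lra.
- apply: (@integrable_Rpos _ 1) => // w w0.
  have /andP[? ?] := decay_bounds (eta * w / (1 + w)) eps.
  by rewrite ler_norml; apply/andP; split; lra.
- move=> w /=; rewrite in_itv/= andbT => w0; rewrite diff//.
  have w1 : 0 < 1 + w by rewrite addr_gt0.
  have /andP[r0 r1] := exc_ratio_bounds lam (ltW tau0) w0.
  have /andP[? d1] := decay_bounds (tau * w / (1 + w)) z.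
  rewrite normrM !ger0_norm ?subr_ge0//.
  apply: (@le_trans _ _ (1 - decay (tau * w / (1 + w)) z)).
    by rewrite ler_piMl// subr_ge0.
  rewrite lerD2l lerN2; apply: (@le_trans _ _ (decay (eta * w / (1 + w)) z)).
    exact: decay_le_space.
  apply: decay_le_time; first by rewrite divr_gt0// mulr_gt0.
  apply: ler_wpM2r; first by rewrite invr_ge0 ltW.
  by apply: ler_wpM2r => //; exact: ltW.
Qed.

Lemma killed_modulus_cvg lam eta :
  killed_modulus lam eta n.+1%:R^-1 @[n --> \oo] --> 0.
Proof.
have inv0 : (n.+1%:R^-1 : R) @[n --> \oo] --> 0 by exact: cvg_harmonic.
rewrite -(addr0 0); apply: cvgD.
  rewrite -(subrr 1); apply: cvgB; first exact: cvg_cst.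
  rewrite -[X in _ --> X]expR0; apply: continuous_cvg; first exact: continuous_expR.
  rewrite -(mulr0 (- lam)); apply: cvgM => //; exact: cvg_cst.
rewrite [X in _ --> X](_ : 0 = \int[W]_(w in Rpos) (0 : R)); last first.
  by rewrite Rintegral_cst// mul0r.
apply: (@bounded_cvg_Rintegral _ _ _ _ _ mRpos WRpos_fin _ _ 1).
- move=> n; apply: measurable_funTS.
  apply: measurable_funB => //; apply: measurableT_comp => //; apply: measurableT_comp => //.
  apply: measurable_funM => //; apply: (measurableT_comp (@measurable_powR R _)).
  apply: measurable_funM => //; apply: measurable_funM; first exact: measurable_funM.
  by apply: measurable_funVr; exact: measurable_funD.
- move=> n w _; have /andP[? ?] := decay_bounds (eta * w / (1 + w)) n.+1%:R^-1.
  by rewrite ler_norml; apply/andP; split; lra.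
- move=> w _; rewrite -(subrr 1); apply: cvgB; first exact: cvg_cst.
  rewrite /decay -[X in _ --> X]expR0; apply: continuous_cvg; first exact: continuous_expR.
  rewrite -[X in _ --> X]oppr0; apply: cvgN.
  rewrite -[X in _ --> X](mul0r ((alpha * c * (eta * w / (1 + w))) `^ (- alpha^-1))).
  apply: cvgM; last exact: cvg_cst.
  by rewrite -[X in _ --> X](normr0 R); apply: cvg_norm.
Qed.

(** For x = alpha c sigma <= 1 and alpha <= 1 one has x^(1/alpha) <= x, so [decay] is at most
    e^(-z/x). The bound then follows from e^y >= (y/2)^2, which comes from e^(y/2) >= y/2. Order two
    in sigma is what makes the errors of all the steps of a grid sum to something negligible. *)
Lemma decay_le_sqr sigma z : alpha <= 1 -> 0 < sigma -> alpha * c * sigma <= 1 -> 0 < z ->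
  decay sigma z <= 4 * (alpha * c * sigma) ^+ 2 / z ^+ 2.
Proof.
move=> al1 s0 As1 z0; rewrite /decay ger0_norm ?(ltW z0)//.
set x := alpha * c * sigma; have x0 : 0 < x by rewrite !mulr_gt0.
have h : z / x <= z * x `^ (- alpha^-1).
  rewrite ler_pM2l// powRN lef_pV2 ?posrE ?powR_gt0//.
  by apply: ge1r_powR; rewrite ?x0//= invf_ge1.
have y0 : 0 < z / x by rewrite divr_gt0.
apply: (@le_trans _ _ (expR (- (z / x)))); first by rewrite ler_expR lerN2.
rewrite expRN invf_ple ?posrE ?expR_gt0//; last first.
  by rewrite divr_gt0 ?mulr_gt0 ?exprn_gt0.
have -> : (4 * x ^+ 2 / z ^+ 2)^-1 = (z / x / 2) ^+ 2 by field; rewrite !gt_eqF.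
have -> : expR (z / x) = expR (z / x / 2) ^+ 2.
  by rewrite -expRM_natl; congr expR; field; rewrite gt_eqF.
apply: lerXn2r; [by rewrite nnegrE divr_ge0// ltW|by rewrite nnegrE expR_ge0|].
by apply: le_trans (expR_ge1Dx _); rewrite lerDr.
Qed.

Lemma cvg_decay0 (u : nat -> R) z : alpha <= 1 -> (forall n, 0 < u n) ->
  u n @[n --> \oo] --> 0 -> 0 < z -> decay (u n) z @[n --> \oo] --> 0.
Proof.
move=> al1 u0 ucv z0.
have hc : 4 * (alpha * c * u n) ^+ 2 / z ^+ 2 @[n --> \oo] --> 0.
  rewrite -[X in _ --> X](_ : 4 * (alpha * c * 0) ^+ 2 / z ^+ 2 = 0); last first.
    by rewrite mulr0 expr0n/= mulr0 mul0r.
  apply: cvgMl; apply: cvgMr; rewrite expr2; under eq_fun do rewrite expr2.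
  by apply: cvgM; apply: cvgMr.
apply: (squeeze_cvgr _ (cvg_cst _) hc).
have : \forall n \near \oo, u n < (alpha * c)^-1.
  by apply: cvgr_lt ucv _ _; rewrite invr_gt0.
apply: filterS => n un; have /andP[-> _]/= := decay_bounds (u n) z.
apply: decay_le_sqr => //.
by rewrite mulrC -ler_pdivlMr// mul1r ltW.
Qed.

Lemma killed_cvg lam (u : nat -> R) z : alpha <= 1 -> (forall n, 0 < u n) ->
  u n @[n --> \oo] --> 0 -> 0 < z ->
  killed lam (u n) z @[n --> \oo] --> expR (- lam * z).
Proof.
move=> al1 u0 ucv z0; rewrite -[X in _ --> X]subr0; apply: cvgB; last first.
  apply: (squeeze_cvgr _ (cvg_cst _) (cvg_decay0 al1 u0 ucv z0)).
  apply: nearW => n; rewrite exc_part_le_decay// andbT.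
  by have /andP[] := exc_part_bounds lam z (ltW (u0 n)).
have bcv : 1 + alpha * c * lam `^ alpha * u n @[n --> \oo] --> (1 : R).
  rewrite -[X in _ --> X]addr0; apply: cvgD; first exact: cvg_cst.
  by rewrite -(mulr0 (alpha * c * lam `^ alpha)); apply: cvgMr.
have pcv r : (1 + alpha * c * lam `^ alpha * u n) `^ r @[n --> \oo] --> (1 : R).
  rewrite -[X in _ --> X](_ : 1 `^ r = 1); last by rewrite powR1.
  exact: (continuous_cvg _ (@powR_continuous R r 1 ltr01) bcv).
rewrite -[X in _ --> X]mul1r /psi; apply: cvgM; first exact: pcv.
apply: continuous_cvg; first exact: continuous_expR.
rewrite ger0_norm ?(ltW z0)// -[X in _ --> X]mulr1.
by apply: cvgMr; exact: pcv.
Qed.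

End harmonic_functions.

(** * Optional stopping on a grid *)

Section stopped_sequences.
Context d (T : measurableType d) (R : realType) (P : probability T R).
Variables (A : nat -> set T) (Y : nat -> T -> R) (M : R).
Hypothesis mA : forall k, measurable (A k).
Hypothesis ndA : forall k, A k.+1 `<=` A k.
Hypothesis mY : forall k, measurable_fun setT (Y k).
Hypothesis YM : forall k w, `|Y k w| <= M.

(* [Y] stopped at the first index outside the decreasing events [A], or at
   [n]. *)
Fixpoint stopped n (w : T) : R :=
  if n is m.+1 then (if w \in A m then Y m.+1 w else stopped m w) else Y 0%N w.

Lemma stoppedP n w : exists j, [/\ (j <= n)%N, stopped n w = Y j w,
  forall i, (i < j)%N -> A i w & j = n \/ ~ A j w].
Proof.
elim: n => [|n [j [jn sE Aj jA]]]; first by exists 0%N; split=> //; left.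
rewrite /=; case: ifPn => [/set_mem An|/negP An].
  exists n.+1; split => //; last by left.
  move=> i; rewrite ltnS => i_n.
  have down k : A (i + k)%N w -> A i w.
    by elim: k => [|k IH]; rewrite ?addn0// addnS => /ndA.
  by apply: (down (n - i)%N); rewrite subnKC.
exists j; split => //; first exact: leqW.
right; case: jA => [-> Aw|//]; apply: An; exact/mem_set.
Qed.

Lemma stopped_bound n w : `|stopped n w| <= M.
Proof. by have [j [_ -> _ _]] := stoppedP n w; exact: YM. Qed.

Lemma measurable_stopped n : measurable_fun setT (stopped n).
Proof.
elim: n => [|n IH] /=; first exact: mY.
apply: measurable_fun_ifT; [|exact: mY|exact: IH].
apply: (measurable_fun_bool true); rewrite setTI.
by rewrite (_ : _ @^-1` _ = A n)//; apply/seteqP; split => w /=; [move/set_mem|move/mem_set].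
Qed.

Let Pfin D : measurable D -> (P D < +oo)%E.
Proof. by move=> mD; rewrite (le_lt_trans (probability_le1 P mD)) ?ltry. Qed.

Let int_bounded D (f : T -> R) : measurable D -> measurable_fun setT f -> (forall w, `|f w| <= M) ->
  P.-integrable D (EFin \o f).
Proof.
move=> mD mf fM; apply: (@bounded_integrable _ _ _ _ _ mD (Pfin mD) _ M) => //.
exact: measurable_funTS.
Qed.

Lemma stopped_in n w : A n w -> stopped n w = Y n w.
Proof.
move=> Anw; have [j [jn -> _ [->//|Aj]]] := stoppedP n w.
exfalso; apply: Aj.
have down k : A (j + k)%N w -> A j w.
  by elim: k => [|k IH]; rewrite ?addn0// addnS => /ndA.
by apply: (down (n - j)%N); rewrite subnKC.
Qed.

(** From n to n + 1 the stopped sequence changes only on [A n], by Y (n + 1) - Y n; the increments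
    telescope. *)
Lemma stopped_Rintegral n eta :
  (forall k, (k < n)%N ->
    `| \int[P]_(w in A k) Y k.+1 w - \int[P]_(w in A k) Y k w| <= eta) ->
  `| \int[P]_w stopped n w - \int[P]_w Y 0%N w | <= n%:R * eta.
Proof.
elim: n => [|n IH] He; first by rewrite /= subrr normr0 mul0r.
have iS k D : measurable D -> P.-integrable D (EFin \o stopped k).
  by move=> mD; apply: int_bounded => //; [exact: measurable_stopped|exact: stopped_bound].
have iY k D : measurable D -> P.-integrable D (EFin \o Y k).
  by move=> mD; exact: int_bounded.
have iYA : P.-integrable setT (EFin \o ((fun w => Y n.+1 w - Y n w) \_ (A n))).
  have := integrableB (mA n) (iY n.+1 _ (mA n)) (iY n _ (mA n)).
  move/(integrable_mkcond _ (mA n)); apply: eq_integrable => // w _.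
  by rewrite /= !patchE; case: ifPn.
have -> : \int[P]_w stopped n.+1 w =
    \int[P]_w stopped n w + (\int[P]_(w in A n) Y n.+1 w - \int[P]_(w in A n) Y n w).
  rewrite -RintegralB; [|exact: mA|exact: iY|exact: iY].
  rewrite [X in _ = _ + X]Rintegral_mkcond -RintegralD; [|exact: measurableT|exact: iS|exact: iYA].
  apply: eq_Rintegral => w _; rewrite patchE /=.
  case: ifPn => [/set_mem Anw|_]; last by rewrite addr0.
  by rewrite (stopped_in Anw) addrC subrK.
rewrite addrAC; apply: (le_trans (ler_normD _ _)).
rewrite -natr1 mulrDl mul1r; apply: lerD; last exact: He.
by apply: IH => k kn; apply: He; exact: leqW.
Qed.

End stopped_sequences.

(** * The Markov property for functions *)

Section markov_functions.
Context (dT : measure_display) (T : measurableType dT) (R : realType)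
  (P : probability T R) (Z : R -> T -> R) (Q : R -> R.-pker R ~> R).
Hypothesis mZ : forall t, 0 <= t -> measurable_fun setT (Z t).
Hypothesis HM : markov P Z Q.

Lemma natural_filtration_measurable s A : natural_filtration Z s A -> measurable A.
Proof.
apply: smallest_sub; first exact: sigma_algebra_measurable.
move=> _ [r [B [/andP[r0 _] mB ->]]].
by have := mZ r0 measurableT mB; rewrite setTI.
Qed.

Import HBNNSimple.

(** [markov] is the case of indicators. Both sides are linear on simple functions and pass to
    monotone limits, the right one by monotone convergence twice, under [Q] and then under [P]. *)
Lemma markov_ge0 s t A (f : R -> \bar R) : 0 <= s -> 0 <= t ->
  natural_filtration Z s A -> measurable_fun setT f -> (forall x, 0 <= f x)%E ->
  (\int[P]_(w in A) f (Z (s + t) w) = \int[P]_(w in A) \int[Q t (Z s w)]_y f y)%E.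
Proof.
move=> s0 t0 FA mf f0.
have mA := natural_filtration_measurable FA.
have mZst := mZ (addr_ge0 s0 t0).
have mQ U : measurable U -> measurable_fun setT (fun w => Q t (Z s w) U).
  by move=> mU; exact: (measurableT_comp (measurable_kernel (Q t) U mU) (mZ s0)).
have mint (g : R -> \bar R) : measurable_fun setT g -> (forall x, 0 <= g x)%E ->
    measurable_fun setT (fun w => \int[Q t (Z s w)]_y g y)%E.
  move=> mg g0; exact: (@measurable_fun_integral_kernel _ _ _ _ _ (fun w => Q t (Z s w)) mQ).
pose f_ := nnsfun_approx measurableT mf.
have f_cvg x : EFin \o f_ ^~ x @ \oo --> f x by exact: cvg_nnsfun_approx.
have nd x : {homo (fun n => (f_ n x)%:E) : i j / (i <= j)%N >-> (i <= j)%E}.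
  by move=> i j ij; rewrite lee_fin; exact/lefP/nd_nnsfun_approx.
have mf_ n : measurable_fun setT (EFin \o f_ n) by exact/measurable_EFinP.
have h1 : (\int[P]_(w in A) (f_ n (Z (s + t) w))%:E)%E @[n --> \oo] -->
    (\int[P]_(w in A) f (Z (s + t) w))%E.
  rewrite (_ : (fun w => f (Z (s + t) w)) =
      (fun w => limn (fun n => (f_ n (Z (s + t) w))%:E))); last first.
    by apply/funext => w; apply/esym/cvg_lim => //; exact: f_cvg.
  apply: cvg_monotone_convergence => //.
  - by move=> n; apply: measurable_funTS; exact: (measurableT_comp (mf_ n) mZst).
  - by move=> n w _; rewrite lee_fin.
have h2in w : (\int[Q t (Z s w)]_y (f_ n y)%:E)%E @[n --> \oo] -->
    (\int[Q t (Z s w)]_y f y)%E.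
  rewrite (_ : (fun y => f y) = (fun y => limn (fun n => (f_ n y)%:E))); last first.
    by apply/funext => y; apply/esym/cvg_lim => //; exact: f_cvg.
  apply: cvg_monotone_convergence => //.
  by move=> n w' _; rewrite lee_fin.
have h2 : (\int[P]_(w in A) \int[Q t (Z s w)]_y (f_ n y)%:E)%E @[n --> \oo] -->
    (\int[P]_(w in A) \int[Q t (Z s w)]_y f y)%E.
  rewrite (_ : (fun w => \int[Q t (Z s w)]_y f y)%E =
      (fun w => limn (fun n => \int[Q t (Z s w)]_y (f_ n y)%:E))%E); last first.
    by apply/funext => w; apply/esym/cvg_lim => //; exact: h2in.
  apply: cvg_monotone_convergence => //.
  - by move=> n; apply: measurable_funTS; apply: mint; [exact: mf_|move=> x; rewrite /= lee_fin].
  - by move=> n w _; apply: integral_ge0 => x _; rewrite lee_fin.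
  - move=> w _ i j ij; apply: ge0_le_integral => //.
    + by move=> x _; rewrite lee_fin.
    + exact: mf_.
    + exact: mf_.
    + by move=> x _; exact: nd.
apply: (cvg_unique _ h1) => //.
suff -> : (fun n => \int[P]_(w in A) (f_ n (Z (s + t) w))%:E)%E =
  (fun n => \int[P]_(w in A) \int[Q t (Z s w)]_y (f_ n y)%:E)%E by exact: h2.
apply/funext => n; move: (f_ n) => g.
have ginv r : measurable (g @^-1` [set r]) by exact: measurable_sfunP.
transitivity (\sum_(r \in range g) r%:E * P (A `&` Z (s + t) @^-1` (g @^-1` [set r])))%E.
  under eq_integral do rewrite fimfunE -fsumEFin//.
  rewrite ge0_integral_fsum//; last 2 first.
  - move=> r; apply/measurable_EFinP; apply: measurable_funM => //.
    by apply: measurable_funTS; apply: (measurableT_comp _ mZst).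
  - by move=> r x _; rewrite EFinM nnfun_muleindic_ge0.
  apply: eq_fsbigr => r; rewrite inE => -[x _ rE].
  have r0 : 0 <= r by rewrite -rE.
  under eq_integral do rewrite EFinM.
  rewrite ge0_integralZl//; last first.
    apply/measurable_EFinP; apply: measurable_funTS.
    by apply: (measurableT_comp _ mZst).
  congr (_ * _)%E.
  transitivity (\int[P]_(w in A) (\1_(Z (s + t) @^-1` (g @^-1` [set r])) w)%:E)%E => //.
  rewrite integral_indic//; first by rewrite setIC.
  by have := mZst measurableT _ (ginv r); rewrite setTI.
have inner w : (\int[Q t (Z s w)]_y (g y)%:E =
    \sum_(r \in range g) (r%:E * Q t (Z s w) (g @^-1` [set r])))%E.
  under eq_integral do rewrite fimfunE -fsumEFin//.
  rewrite ge0_integral_fsum//; last 2 first.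
  - by move=> r; apply/measurable_EFinP; apply: measurable_funM.
  - by move=> r x _; rewrite EFinM nnfun_muleindic_ge0.
  apply: eq_fsbigr => r; rewrite inE => -[x _ rE].
  have r0 : 0 <= r by rewrite -rE.
  under eq_integral do rewrite EFinM.
  rewrite ge0_integralZl//; last exact/measurable_EFinP.
  by rewrite integral_indic// setIT.
under eq_integral do rewrite inner.
have nng r w : (0 <= r%:E * Q t (Z s w) (g @^-1` [set r]))%E.
  have [r0|r0] := leP 0 r; first by rewrite mule_ge0.
  by rewrite preimage_nnfun0// measure0 mule0.
rewrite ge0_integral_fsum//; last first.
  by move=> r; apply: measurable_funeM; apply: measurable_funTS; exact: mQ.
apply: eq_fsbigr => r; rewrite inE => -[x _ rE].
have r0 : 0 <= r by rewrite -rE.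
rewrite ge0_integralZl//; last by apply: measurable_funTS; exact: mQ.
by rewrite HM.
Qed.

Lemma markov_Rintegral s t A (f : R -> R) M : 0 <= s -> 0 <= t ->
  natural_filtration Z s A -> measurable_fun setT f -> (forall x, `|f x| <= M) ->
  \int[P]_(w in A) f (Z (s + t) w) =
  \int[P]_(w in A) \int[Q t (Z s w)]_y f y.
Proof.
move=> s0 t0 FA mf fM.
have mA := natural_filtration_measurable FA.
have mZst := mZ (addr_ge0 s0 t0).
have PA : (P A < +oo)%E by rewrite (le_lt_trans (probability_le1 P mA)) ?ltry.
have mQ U : measurable U -> measurable_fun setT (fun w => Q t (Z s w) U).
  by move=> mU; exact: (measurableT_comp (measurable_kernel (Q t) U mU) (mZ s0)).
have Qfin z : (Q t z setT < +oo)%E by rewrite prob_kernel ltry.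
have fi z : (Q t z).-integrable setT (EFin \o f).
  by apply: (@bounded_integrable _ _ _ _ _ _ (Qfin z) _ M) => // x _; exact: fM.
have M0 : 0 <= M by exact: le_trans (normr_ge0 _) (fM 0).
have fM0 x : 0 <= f x + M by have := fM x; rewrite ler_norml => /andP[]; lra.
(* The nonnegative version is applied to f + M, and M is subtracted again; all the measures involved
   are finite. *)
pose g x := f x + M.
have mg : measurable_fun setT g by exact: measurable_funD.
have gi z : (Q t z).-integrable setT (EFin \o g).
  apply: (@bounded_integrable _ _ _ _ _ _ (Qfin z) _ (M + M)) => // x _.
  by apply: (le_trans (ler_normD _ _)); rewrite lerD// ger0_norm.
have inE z : \int[Q t z]_y g y = \int[Q t z]_y f y + M.
  rewrite RintegralD//; last by apply: (@bounded_integrable _ _ _ _ _ _ (Qfin z) _ `|M|).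
  by rewrite Rintegral_cst// prob_kernel mulr1.
have bound z : `|\int[Q t z]_y f y| <= M.
  apply: le_trans (Rintegral_bound _ (Qfin z) mf (fun x _ => fM x)) _ => //.
  by rewrite prob_kernel mulr1.
have mint : measurable_fun setT (fun w => \int[Q t (Z s w)]_y g y).
  apply: (@measurableT_comp _ _ _ _ _ _ (@fine R)); first exact: fine_measurable.
  apply: measurable_fun_integral_kernel => //; last exact/measurable_EFinP.
have mint' : measurable_fun setT (fun w => \int[Q t (Z s w)]_y f y).
  have -> : (fun w => \int[Q t (Z s w)]_y f y) = (fun w => \int[Q t (Z s w)]_y g y - M).
    by apply/funext => w; rewrite inE addrK.
  exact: measurable_funB.
have key : \int[P]_(w in A) g (Z (s + t) w) = \int[P]_(w in A) \int[Q t (Z s w)]_y g y.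
  rewrite [LHS]/Rintegral (@markov_ge0 s t A (EFin \o g))//; last exact/measurable_EFinP.
  congr fine; apply: eq_integral => w _.
  by rewrite fineK//; exact: integrable_fin_num.
have cM : P.-integrable A (EFin \o cst M).
  by apply: (@bounded_integrable _ _ _ _ _ _ PA _ `|M|).
move: key; under [X in _ = X]eq_Rintegral do rewrite inE.
rewrite !RintegralD//.
- by move/addIr.
- apply: (@bounded_integrable _ _ _ _ _ _ PA _ M) => //.
  exact: measurable_funTS.
- apply: (@bounded_integrable _ _ _ _ _ _ PA _ M) => //.
  by apply: measurable_funTS; exact: (measurableT_comp mf mZst).
Qed.

End markov_functions.

Section cadlag_paths.
Context (R : realType).
Implicit Types (x : R -> R) (s t u r eps : R).

Lemma cadlag_cvg_right x (u_ : nat -> R) u : cadlag x -> 0 <= u ->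
  (forall n, u <= u_ n) -> u_ n @[n --> \oo] --> u -> x (u_ n) @[n --> \oo] --> x u.
Proof.
move=> [rc _] u0 uu_ ucv; apply/cvgrPdist_lt => e e0.
have /cvgrPdist_lt/(_ e e0) := rc u u0.
rewrite near_withinE => -[del /= del0 hdel].
move/cvgrPdist_lt : ucv => /(_ del del0); apply: filterS => n hn.
have [<-|un] := eqVneq u (u_ n); first by rewrite subrr normr0.
by apply: hdel => //; rewrite lt_neqAle un uu_.
Qed.

(** The minimum freezes the grid at t from index n + 1 on, so that every index gives a time in
    [s, t]. *)
Definition grid s t (n k : nat) : R := s + (t - s) * ((minn k n.+1)%:R / n.+1%:R).

Lemma grid0 s t n : grid s t n 0 = s.
Proof. by rewrite /grid min0n mul0r mulr0 addr0. Qed.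

Lemma grid_last s t n : grid s t n n.+1 = t.
Proof. by rewrite /grid minnn divff ?pnatr_eq0// mulr1 addrC subrK. Qed.

Lemma grid_itv s t n k : s <= t -> s <= grid s t n k <= t.
Proof.
move=> st; rewrite /grid lerDl mulr_ge0 ?subr_ge0//=.
rewrite -[leRHS](subrKC s) lerD2l ler_piMr ?subr_ge0//.
by rewrite ler_pdivrMr// mul1r ler_nat geq_minr.
Qed.

Lemma gridS s t n k : (k <= n)%N -> grid s t n k.+1 = grid s t n k + (t - s) / n.+1%:R.
Proof.
move=> kn; rewrite /grid (minn_idPl _) ?ltnS// (minn_idPl (leqW kn)).
rewrite -[k.+1%:R]natr1; have : n.+1%:R != 0 :> R by rewrite pnatr_eq0.
by move: n.+1%:R => N N0; field.
Qed.

Lemma grid_nd s t n i j : s <= t -> (i <= j)%N -> grid s t n i <= grid s t n j.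
Proof.
move=> st ij; rewrite /grid lerD2l; apply: ler_wpM2l; first by rewrite subr_ge0.
by apply: ler_wpM2r; rewrite ?invr_ge0// ler_nat leq_min geq_minr andbT (leq_trans (geq_minl _ _)).
Qed.

(** The grid point has to lie strictly to the right of u, because right continuity is a limit over
    times other than u. *)
Lemma grid_next s t u n : s <= u -> u < t ->
  exists k, (k <= n.+1)%N /\ u < grid s t n k <= u + (t - s) / n.+1%:R.
Proof.
move=> su ut.
have st : 0 < t - s by rewrite subr_gt0 (le_lt_trans su).
pose y := (u - s) * n.+1%:R / (t - s).
have y0 : 0 <= y by rewrite divr_ge0 ?(ltW st)// mulr_ge0// subr_ge0.
have yn : y < n.+1%:R by rewrite ltr_pdivrMr// mulrC ltr_pM2l// ltrD2r.
have /andP[k1 k2] := truncn_itv y0.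
set k := Num.truncn y in k1 k2.
have kn : (k <= n)%N by rewrite -ltnS -(ltr_nat R) (le_lt_trans k1).
exists k.+1; split; first by rewrite ltnS.
have n0 : 0 < n.+1%:R :> R by [].
have uE : u = s + (t - s) * (y / n.+1%:R).
  rewrite /y; move: n0; move: n.+1%:R => N N0; field.
  by rewrite !gt_eqF.
rewrite gridS// /grid (minn_idPl (leqW kn)).
apply/andP; split.
  rewrite {1}uE -addrA ltrD2l -mulrDr ltr_pM2l// -[X in _ < _ + X]mul1r -mulrDl.
  by rewrite ltr_pM2r ?invr_gt0// natr1.
rewrite lerD2r {1}uE lerD2l ler_pM2l// ler_pM2r ?invr_gt0//.
Qed.

End cadlag_paths.

(** * Events that the path comes close to 0 *)

Section low_events.
Context (dT : measure_display) (T : measurableType dT) (R : realType)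
  (Z : R -> T -> R).
Hypothesis cadZ : forall w, cadlag (Z ^~ w).
Implicit Types (s t u r eps : R).

Definition below s t eps : set T := [set w | exists2 u, s <= u <= t & Z u w < eps].

(* Z has infimum 0 over [s, t]; by [reach_ae_zero] this infimum is almost
   surely attained. *)
Definition reach s t : set T := [set w | forall m, below s t m.+1%:R^-1 w].

Lemma below_sub s t s' t' eps eps' : s' <= s -> t <= t' -> eps <= eps' ->
  below s t eps `<=` below s' t' eps'.
Proof.
move=> ss tt ee w [u /andP[su ut] Zu]; exists u; last exact: lt_le_trans ee.
by rewrite (le_trans ss)// (le_trans ut).
Qed.

Lemma reach_sub s t s' t' : s' <= s -> t <= t' -> reach s t `<=` reach s' t'.
Proof. by move=> ss tt w h m; exact: below_sub (h m). Qed.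

(** By right continuity a strict inequality at u < t persists on a short interval to the right of u,
    which contains a point of every fine grid; u = t is itself a grid point. *)
Lemma below_grid s t eps w : 0 <= s -> s <= t -> below s t eps w ->
  \forall n \near \oo, exists2 k, (k <= n.+1)%N & Z (grid s t n k) w < eps.
Proof.
move=> s0 st [u /andP[su ut] Zu].
move: ut; rewrite le_eqVlt => /predU1P[ut|ut].
  by apply: nearW => n; exists n.+1 => //; rewrite grid_last -ut.
have [rc _] := cadZ w.
have /cvgrPdist_lt/(_ (eps - Z u w)) := rc u (le_trans s0 su).
rewrite subr_gt0 => /(_ Zu); rewrite near_withinE => -[del /= del0 hdel].
have cv : (t - s) / n.+1%:R @[n --> \oo] --> (0 : R).
  by rewrite -[X in _ --> X](mulr0 (t - s)); apply: cvgMr; exact: cvg_harmonic.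
have : \forall n \near \oo, (t - s) / n.+1%:R < del by apply: cvgr_lt cv _ _.
apply: filterS => n hn.
have [k [kn /andP[uk ku]]] := grid_next n su ut.
exists k => //; have := hdel (grid s t n k).
rewrite /ball/= ltr0_norm ?subr_lt0// opprB => /(_ _ uk).
have -> : grid s t n k - u < del by rewrite (le_lt_trans _ hn)// lerBlDl.
move=> /(_ isT) h; have : Z (grid s t n k) w - Z u w < eps - Z u w.
  by apply: le_lt_trans h; rewrite distrC ler_norm.
by rewrite ltrD2r.
Qed.

Lemma filtration_lt s r eps : 0 <= r <= s ->
  natural_filtration Z s [set w | Z r w < eps].
Proof.
move=> rs; apply: sub_sigma_algebra; by exists r, `]-oo, eps[%classic; split.
Qed.

Lemma filtration_bigcup_le s n (A : nat -> set T) :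
  (forall k, (k <= n)%N -> natural_filtration Z s (A k)) ->
  natural_filtration Z s [set w | exists2 k, (k <= n)%N & A k w].
Proof.
move=> FA.
have -> : [set w | exists2 k, (k <= n)%N & A k w] =
    \bigcup_k (if (k <= n)%N then A k else set0).
  apply/seteqP; split => w.
    by move=> [k kn Ak]; exists k => //; rewrite kn.
  by move=> [k _]; case: ifPn => // kn Ak; exists k.
apply: sigma_algebra_bigcup => k; case: ifPn => [/FA//|_].
exact: sigma_algebra0.
Qed.

(** By [below_grid], the uncountable union over [s, t] equals a countable union over grid times,
    each of which is at most r. *)
Lemma below_filtration s t r eps : 0 <= s -> s <= t -> t <= r ->
  natural_filtration Z r (below s t eps).
Proof.
move=> s0 st tr.
have -> : below s t eps =
    \bigcup_n [set w | exists2 k, (k <= n.+1)%N & Z (grid s t n k) w < eps].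
  apply/seteqP; split => w.
    move=> /(below_grid s0 st) [n _ /(_ n (leqnn n)) h]; by exists n.
  by move=> [n _ [k kn Zk]]; exists (grid s t n k) => //; exact: grid_itv.
apply: sigma_algebra_bigcup => n.
apply: (@filtration_bigcup_le r n.+1 (fun k => [set w | Z (grid s t n k) w < eps])).
move=> k kn; apply: filtration_lt; have /andP[h1 h2] := grid_itv n k st.
by rewrite (le_trans s0 h1) (le_trans h2).
Qed.

Lemma filtrationC s A : natural_filtration Z s A -> natural_filtration Z s (~` A).
Proof. exact: sigma_algebraC. Qed.

Lemma reach_filtration s t r : 0 <= s -> s <= t -> t <= r ->
  natural_filtration Z r (reach s t).
Proof.
move=> s0 st tr.
have -> : reach s t = ~` (\bigcup_m ~` (below s t m.+1%:R^-1)).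
  rewrite setC_bigcup; apply/seteqP; split => w.
    by move=> h m _; rewrite setCK; exact: h.
  by move=> h m; have := h m I; rewrite setCK.
apply: filtrationC; apply: sigma_algebra_bigcup => m.
by apply: filtrationC; exact: below_filtration.
Qed.

End low_events.

Section approximate_martingale.
Context (dT : measure_display) (T : measurableType dT) (R : realType)
  (P : probability T R) (Z : R -> T -> R) (Q : R -> R.-pker R ~> R).
Hypothesis mZ : forall t, 0 <= t -> measurable_fun setT (Z t).
Hypothesis Z_ge0 : forall t w, 0 <= t -> 0 <= Z t w.
Hypothesis cadZ : forall w, cadlag (Z ^~ w).
Hypothesis HM : markov P Z Q.
(** To be instantiated by [killed], [decay] and [killed_modulus]: [dec h z] bounds the drift of K in
    a step of length h from z, and [md] bounds K near 0. *)
Variables K dec md : R -> R -> R.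
Hypothesis mK : forall tau, 0 <= tau -> measurable_fun setT (K tau).
Hypothesis K_bound : forall tau z, 0 <= tau -> `|K tau z| <= 1.
Hypothesis K_step : forall tau h z, 0 < tau -> 0 < h -> 0 <= z ->
  `|\int[Q h z]_y K tau y - K (tau + h) z| <= dec h z.
Hypothesis dec_antitone : forall h eps z, 0 < eps -> eps <= z -> dec h z <= dec h eps.
Hypothesis dec_ge0 : forall h eps, 0 <= dec h eps.
Hypothesis dec_cvg : forall L eps, 0 < L -> 0 < eps ->
  n.+1%:R * dec (L / n.+1%:R) eps @[n --> \oo] --> (0 : R).
Hypothesis K_modulus : forall eta eps tau z, 0 < eta -> eta <= tau ->
  `|z| <= eps -> `|K tau z| <= md eta eps.
Hypothesis md_cvg : forall eta, md eta n.+1%:R^-1 @[n --> \oo] --> (0 : R).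
Variables (s t eta : R).
Hypotheses (s0 : 0 <= s) (st : s < t) (eta0 : 0 < eta).

Let PT : (P setT < +oo)%E. Proof. by rewrite probability_setT ltry. Qed.

Let g_ge0 n k : 0 <= grid s t n k.
Proof. by have /andP[h _] := grid_itv n k (ltW st); exact: le_trans s0 h. Qed.

Let g_le n k : grid s t n k <= t.
Proof. by have /andP[] := grid_itv n k (ltW st). Qed.

(** The horizon t + eta instead of t keeps the remaining time above eta, where the bound [md eta] on
    K near 0 is available. *)
Let rest n k := t + eta - grid s t n k.

Let rest_gt n k : eta <= rest n k.
Proof. by rewrite /rest; have := g_le n k; lra. Qed.

Let rest_ge0 n k : 0 <= rest n k.
Proof. by rewrite (le_trans (ltW eta0)). Qed.

Let above eps n k : set T := [set w | forall j, (j <= k)%N -> eps <= Z (grid s t n j) w].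

Let aboveC eps n k :
  above eps n k = ~` [set w | exists2 j, (j <= k)%N & Z (grid s t n j) w < eps].
Proof.
apply/seteqP; split => w /=.
  by move=> h [j jk]; rewrite ltNge h.
by move=> h j jk; rewrite leNgt; apply/negP => Zj; apply: h; exists j.
Qed.

Let above_filtration eps n k : natural_filtration Z (grid s t n k) (above eps n k).
Proof.
rewrite aboveC; apply: filtrationC.
apply: (@filtration_bigcup_le _ _ _ _ _ k (fun j => [set w | Z (grid s t n j) w < eps])).
move=> j jk; apply: filtration_lt; rewrite g_ge0/=.
exact: (grid_nd n (ltW st) jk).
Qed.

Let m_above eps n k : measurable (above eps n k).
Proof. exact: (natural_filtration_measurable mZ (@above_filtration eps n k)). Qed.

Let Y n k (w : T) : R := K (rest n k) (Z (grid s t n k) w).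

Let mY n k : measurable_fun setT (Y n k).
Proof. exact: (measurableT_comp (mK (rest_ge0 n k)) (mZ (g_ge0 n k))). Qed.

Let Y_bound n k w : `|Y n k w| <= 1. Proof. exact: K_bound. Qed.

Let bounded_int D (f : T -> R) M : measurable D -> measurable_fun setT f ->
  (forall w, `|f w| <= M) -> P.-integrable D (EFin \o f).
Proof.
move=> mD mf fM; apply: (@bounded_integrable _ _ _ _ _ mD _ _ M) => //.
  by rewrite (le_lt_trans (probability_le1 P mD)) ?ltry.
exact: measurable_funTS.
Qed.

(** On [above] the current value is at least eps, so the drift is at most [dec h eps]. The event
    belongs to the filtration at the k-th grid time, which allows the Markov property there. *)
Let step eps n k : 0 < eps -> (k <= n)%N ->
  `|\int[P]_(w in above eps n k) Y n k.+1 w - \int[P]_(w in above eps n k) Y n k w|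
  <= dec ((t - s) / n.+1%:R) eps.
Proof.
move=> eps0 kn; set h := (t - s) / n.+1%:R.
have h0 : 0 < h by rewrite divr_gt0// subr_gt0.
have mA := m_above eps n k.
have PA : (P (above eps n k) < +oo)%E.
  by rewrite (le_lt_trans (probability_le1 P mA)) ?ltry.
have gE : grid s t n k.+1 = grid s t n k + h by exact: gridS.
have restE : rest n k.+1 + h = rest n k by rewrite /rest gE; ring.
have r0 := rest_ge0 n k.+1.
have rp : 0 < rest n k.+1 by exact: lt_le_trans (rest_gt n k.+1).
have -> : \int[P]_(w in above eps n k) Y n k.+1 w =
    \int[P]_(w in above eps n k) \int[Q h (Z (grid s t n k) w)]_y K (rest n k.+1) y.
  rewrite /Y gE; apply: (markov_Rintegral mZ HM (M := 1)) => //.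
  - exact: ltW.
  - exact: mK.
  - by move=> x; exact: K_bound.
have Qfin z : (Q h z setT < +oo)%E by rewrite prob_kernel ltry.
have mint : measurable_fun setT (fun w => \int[Q h (Z (grid s t n k) w)]_y K (rest n k.+1) y).
  (* Integrals against a kernel are measurable for nonnegative integrands, hence the shift by 1. *)
  pose g x := K (rest n k.+1) x + 1.
  have mg : measurable_fun setT g by apply: measurable_funD => //; exact: mK.
  have g0 x : 0 <= g x by have := K_bound x r0; rewrite ler_norml /g => /andP[]; lra.
  have -> : (fun w => \int[Q h (Z (grid s t n k) w)]_y K (rest n k.+1) y) =
     (fun w => \int[Q h (Z (grid s t n k) w)]_y g y - 1).
    apply/funext => w; rewrite RintegralD//.
    - by rewrite Rintegral_cst// prob_kernel mulr1 addrK.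
    - apply: (@bounded_integrable _ _ _ _ _ _ (Qfin _) _ 1) => //; first exact: mK.
      by move=> x _; exact: K_bound.
    - by apply: (@bounded_integrable _ _ _ _ _ _ (Qfin _) _ 1) => // x _; rewrite normr1.
  apply: measurable_funB => //.
  apply: (@measurableT_comp _ _ _ _ _ _ (@fine R)); first exact: fine_measurable.
  apply: measurable_fun_integral_kernel.
  - move=> U mU.
    exact: (measurableT_comp (measurable_kernel (Q h) U mU) (mZ (g_ge0 n k))).
  - by move=> x; rewrite lee_fin.
  - exact/measurable_EFinP.
have bint w : `|\int[Q h (Z (grid s t n k) w)]_y K (rest n k.+1) y| <= 1.
  apply: le_trans (Rintegral_bound _ (Qfin _) (mK r0) (fun x _ => K_bound x r0)) _ => //.
  by rewrite prob_kernel mulr1.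
rewrite -RintegralB//; [|exact: bounded_int bint|exact: bounded_int (Y_bound n k)].
apply: le_trans (Rintegral_bound (M := dec h eps) _ PA _ _) _ => //.
- by apply: measurable_funTS; apply: measurable_funB.
- move=> w Aw; rewrite /Y -restE.
  apply: le_trans (K_step rp h0 (Z_ge0 w (g_ge0 n k))) _.
  by apply: dec_antitone => //; exact: Aw.
- by apply: ler_piMr => //; rewrite -lee_fin fineK ?fin_num_measure// probability_le1.
Qed.

(** The first error is the drift accumulated over n + 1 steps. The second comes from the paths
    stopped at a value below eps, where K is at most [md eta eps]; the other paths reach time t,
    where the remaining time is eta. *)
Let stop_bound eps n : 0 < eps ->
  `|\int[P]_(w in above eps n n.+1) K eta (Z t w) - \int[P]_w K (t + eta - s) (Z s w)|
  <= n.+1%:R * dec ((t - s) / n.+1%:R) eps + md eta eps.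
Proof.
move=> eps0.
have md0 : 0 <= md eta eps.
  apply: le_trans (K_modulus (z := 0) eta0 (lexx eta) _); first exact: normr_ge0.
  by rewrite normr0 ltW.
have ndA k : above eps n k.+1 `<=` above eps n k.
  by move=> w h j jk; apply: h; exact: leqW.
pose S := stopped (above eps n) (Y n) n.+1.
have mS : measurable_fun setT S.
  exact: (measurable_stopped (m_above eps n) (mY n)).
have bS w : `|S w| <= 1 := stopped_bound ndA (Y_bound n) n.+1 w.
have h1 : `|\int[P]_w S w - \int[P]_w Y n 0 w| <= n.+1%:R * dec ((t - s) / n.+1%:R) eps.
  apply: (stopped_Rintegral (m_above eps n) ndA (mY n) (Y_bound n)) => k.
  by rewrite ltnS; exact: step.
have Y0 : Y n 0 = (fun w => K (t + eta - s) (Z s w)) by rewrite /Y /rest grid0.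
rewrite Y0 in h1.
have mKt : measurable_fun setT (fun w => K eta (Z t w)).
  exact: (measurableT_comp (mK (ltW eta0)) (mZ (le_trans s0 (ltW st)))).
have mKr : measurable_fun setT ((fun w => K eta (Z t w)) \_ (above eps n n.+1)).
  by apply/(measurable_restrictT _ _).1 => //; exact: measurable_funTS.
have bKr w : `|((fun w => K eta (Z t w)) \_ (above eps n n.+1)) w| <= 1.
  by rewrite patchE; case: ifPn => _; [apply: K_bound; exact: ltW|rewrite normr0].
have h2 : `|\int[P]_(w in above eps n n.+1) K eta (Z t w) - \int[P]_w S w| <= md eta eps.
  rewrite Rintegral_mkcond -RintegralB//; [|exact: bounded_int bKr|exact: bounded_int bS].
  apply: le_trans (Rintegral_bound (M := md eta eps) _ PT _ _) _ => //.
  - exact: measurable_funB.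
  - move=> w _; rewrite patchE; case: ifPn => [/set_mem Aw|/negP Aw].
      rewrite /S (stopped_in (Y n) ndA Aw) /Y /rest grid_last.
      have -> : t + eta - t = eta by ring.
      by rewrite subrr normr0.
    have [j [jn SE Ai jA]] := stoppedP (Y n) ndA n.+1 w.
    have Aj : ~ above eps n j w by case: jA => // -> h; apply: Aw; exact/mem_set.
    have Zj : Z (grid s t n j) w < eps.
      rewrite ltNge; apply/negP => Zj; apply: Aj => i.
      rewrite leq_eqVlt => /predU1P[->//|ij].
      exact: (Ai i ij).
    rewrite sub0r normrN /S SE; apply: K_modulus => //.
    by rewrite ger0_norm ?Z_ge0// ltW.
  - by rewrite [X in fine X](probability_setT P) mulr1.
by apply: (le_trans (ler_distD (\int[P]_w S w) _ _)); rewrite addrC; exact: lerD.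
Qed.

Let mKt : measurable_fun setT (fun w => K eta (Z t w)).
Proof. exact: (measurableT_comp (mK (ltW eta0)) (mZ (le_trans s0 (ltW st)))). Qed.

Let bKt w : `|K eta (Z t w)| <= 1. Proof. by apply: K_bound; exact: ltW. Qed.

Let measurable_below eps : measurable (below Z s t eps).
Proof.
apply: (natural_filtration_measurable mZ (s := t)).
by apply: below_filtration => //; exact: ltW.
Qed.

(** As the mesh tends to 0, [dec_cvg] removes the drift, and [below_grid] shows that the events
    [above] converge pointwise to the complement of [below]. *)
Let below_limit eps : 0 < eps ->
  `|\int[P]_(w in ~` below Z s t eps) K eta (Z t w) -
    \int[P]_w K (t + eta - s) (Z s w)| <= md eta eps.
Proof.
move=> eps0.
have cv1 : \int[P]_(w in above eps n n.+1) K eta (Z t w) @[n --> \oo] -->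
    \int[P]_(w in ~` below Z s t eps) K eta (Z t w).
  rewrite Rintegral_mkcond; under eq_fun do rewrite Rintegral_mkcond.
  apply: (@bounded_cvg_Rintegral _ _ _ P setT measurableT PT _ _ 1).
  - by move=> n; apply/(measurable_restrictT _ _).1 => //; exact: measurable_funTS.
  - by move=> n w _; rewrite patchE; case: ifPn => _ //; rewrite normr0.
  - move=> w _; rewrite patchE; case: ifPn => [/set_mem nb|/negP nb].
      apply: cvg_near_cst; apply: nearW => n; rewrite patchE mem_set//.
      rewrite aboveC => -[j jn Zj]; apply: nb.
      by exists (grid s t n j) => //; exact: grid_itv (ltW st).
    have bw : below Z s t eps w by apply: contrapT => h; apply: nb; exact/mem_set.
    apply: cvg_near_cst; have := below_grid cadZ s0 (ltW st) bw.
    apply: filterS => n [k kn Zk]; rewrite patchE memNset//.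
    by rewrite aboveC; apply; exists k.
have cv2 : n.+1%:R * dec ((t - s) / n.+1%:R) eps + md eta eps @[n --> \oo] --> md eta eps.
  rewrite -[X in _ --> X]add0r; apply: cvgD; last exact: cvg_cst.
  by apply: dec_cvg => //; rewrite subr_gt0.
have cv3 : `|\int[P]_(w in above eps n n.+1) K eta (Z t w) - \int[P]_w K (t + eta - s) (Z s w)|
    @[n --> \oo] --> `|\int[P]_(w in ~` below Z s t eps) K eta (Z t w) -
      \int[P]_w K (t + eta - s) (Z s w)|.
  by apply: cvg_norm; apply: cvgB => //; exact: cvg_cst.
have hn n := stop_bound n eps0.
by refine (ler_cvg_to cv3 cv2 _); apply: nearW.
Qed.

(* [K (t + eta - r) (Z r)] is nearly a martingale away from 0 ([K_step]) and
   small near 0 ([K_modulus]): stop it on a fine grid at the first value below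
   [eps], and let [eps] tend to 0. *)
Lemma stopped_at_zero : \int[P]_w K (t + eta - s) (Z s w) =
  \int[P]_(w in ~` reach Z s t) K eta (Z t w).
Proof.
have cv1 : \int[P]_(w in ~` below Z s t n.+1%:R^-1) K eta (Z t w) @[n --> \oo] -->
    \int[P]_(w in ~` reach Z s t) K eta (Z t w).
  rewrite Rintegral_mkcond; under eq_fun do rewrite Rintegral_mkcond.
  apply: (@bounded_cvg_Rintegral _ _ _ P setT measurableT PT _ _ 1).
  - move=> n; apply/(measurable_restrictT _ _).1; last exact: measurable_funTS.
    exact/measurableC/measurable_below.
  - by move=> n w _; rewrite patchE; case: ifPn => _ //; rewrite normr0.
  - move=> w _; rewrite patchE; case: ifPn => [/set_mem nr|/negP nr].
      have [m hm] : exists m, ~ below Z s t m.+1%:R^-1 w.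
        by apply: contrapT => h; apply: nr => m; apply: contrapT => hm; apply: h; exists m.
      apply: cvg_near_cst; exists m => // n /= mn; rewrite patchE mem_set// => hn.
      by apply: hm; apply: below_sub hn; rewrite // lef_pV2 ?posrE// ler_nat.
    have rw : reach Z s t w by apply: contrapT => h; apply: nr; exact/mem_set.
    by apply: cvg_near_cst; apply: nearW => n; rewrite patchE memNset// => h; apply: h; exact: rw.
have cv3 : `|\int[P]_(w in ~` below Z s t n.+1%:R^-1) K eta (Z t w) - \int[P]_w K (t + eta - s) (Z s w)|
    @[n --> \oo] --> `|\int[P]_(w in ~` reach Z s t) K eta (Z t w) -
      \int[P]_w K (t + eta - s) (Z s w)|.
  by apply: cvg_norm; apply: cvgB => //; exact: cvg_cst.
have h : `|\int[P]_(w in ~` reach Z s t) K eta (Z t w) -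
    \int[P]_w K (t + eta - s) (Z s w)| <= 0.
  refine (ler_cvg_to cv3 (md_cvg eta) _); apply: nearW => n.
  by apply: below_limit; rewrite invr_gt0.
by move: h; rewrite normr_le0 subr_eq0 => /eqP.
Qed.

End approximate_martingale.

(** * The Laplace transform on the event without zeros in [s, t] *)

Section laws_without_zeros.
Context (dT : measure_display) (T : measurableType dT) (R : realType)
  (P : probability T R) (Z : R -> T -> R) (Q : R -> R.-pker R ~> R)
  (alpha c del : R) (W : probability R R).
Hypothesis mZ : forall t, 0 <= t -> measurable_fun setT (Z t).
Hypothesis Z_ge0 : forall t w, 0 <= t -> 0 <= Z t w.
Hypothesis cadZ : forall w, cadlag (Z ^~ w).
Hypothesis Z_start : {ae P, forall w, Z 0 w = 0}.
Hypothesis HM : markov P Z Q.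
Hypothesis alpha0 : 0 < alpha.
Hypothesis alpha1 : alpha <= 1.
Hypothesis c0 : 0 < c.
Hypothesis del01 : 0 < del < 1.
Local Notation Rpos := (`]0, +oo[%classic : set R).
Hypothesis WRpos : W Rpos = 1%E.
Hypothesis Wtot : forall b, 0 <= b ->
  (\int[W]_(w in Rpos) ((1 + w) / (1 + w + b))%:E)%E = ((1 + b) `^ (- del))%:E.
Hypothesis Wshift : forall tau h (F : R -> R), 0 < tau -> 0 <= h ->
     measurable_fun setT F -> (forall x, 0 <= F x) ->
     (\int[W]_(w in Rpos)
        (F (tau / (1 + w)) * (1 + h * (1 + w) / (tau * w)) `^ (- del))%:E)%E =
     (\int[W]_(w in Rpos)
        (if h < (tau + h) * w / (1 + w)
         then F ((tau + h) / (1 + w)) else 0)%:E)%E.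
Hypothesis Q_half_line : forall t z, 0 <= t -> 0 <= z ->
  Q t z `[0, +oo[%classic = 1%E.
Hypothesis Q_laplace : forall t z lam, 0 <= t -> 0 <= z -> 0 <= lam ->
  laplace (Q t z) lam =
    ((1 + alpha * c * lam `^ alpha * t) `^ (- del) *
     expR (- lam * z * (1 + alpha * c * lam `^ alpha * t) `^ (- alpha^-1)))%:E.

Lemma decay_grid_cvg L eps : 0 < L -> 0 < eps ->
  n.+1%:R * decay alpha c (L / n.+1%:R) eps @[n --> \oo] --> (0 : R).
Proof.
move=> L0 eps0.
have inv0 : (n.+1%:R^-1 : R) @[n --> \oo] --> (0 : R) by exact: cvg_harmonic.
pose M := 4 * (alpha * c * L) ^+ 2 / eps ^+ 2.
have hM : M * n.+1%:R^-1 @[n --> \oo] --> (0 : R).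
  by rewrite -[X in _ --> X](mulr0 M); apply: cvgMr.
apply: (squeeze_cvgr _ (cvg_cst 0) hM).
have hs : alpha * c * L * n.+1%:R^-1 @[n --> \oo] --> (0 : R).
  by rewrite -[X in _ --> X](mulr0 (alpha * c * L)); apply: cvgMr.
have : \forall n \near \oo, alpha * c * L * n.+1%:R^-1 < 1 by apply: cvgr_lt hs _ _.
apply: filterS => n hn.
have n0 : 0 < n.+1%:R :> R by [].
have /andP[d0 d1] := decay_bounds alpha c (L / n.+1%:R) eps.
apply/andP; split; first exact: mulr_ge0 (ltW n0) d0.
apply: (@le_trans _ _ (n.+1%:R * (4 * (alpha * c * (L / n.+1%:R)) ^+ 2 / eps ^+ 2))).
  apply: ler_wpM2l; first exact: ltW.
  apply: decay_le_sqr => //; first exact: divr_gt0.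
  by rewrite mulrA ltW.
rewrite /M le_eqVlt; apply/orP; left; apply/eqP.
move: n0 eps0; move: n.+1%:R => N /lt0r_neq0 N0 /lt0r_neq0 e0; field.
by rewrite e0 N0.
Qed.

Lemma killed_stopped lam s t eta : 0 <= lam -> 0 <= s -> s < t -> 0 < eta ->
  \int[P]_w killed alpha c del W lam (t + eta - s) (Z s w) =
  \int[P]_(w in ~` reach Z s t) killed alpha c del W lam eta (Z t w).
Proof.
move=> l0 s0 st eta0.
apply: (@stopped_at_zero _ _ _ P Z Q mZ Z_ge0 cadZ HM (killed alpha c del W lam)
  (decay alpha c) (killed_modulus alpha c W lam)).
- by move=> tau tau0; exact: measurable_killed.
- by move=> tau z tau0; exact: killed_bound.
- move=> tau h z tau0 h0 z0; rewrite (Q_killed _ _ _ WRpos Wshift)// ?(ltW h0)//.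
  rewrite addrC addKr.
  have /andP[e0 e1] := exc_error_le alpha0 c0 WRpos lam z tau0 h0.
  by rewrite ger0_norm.
- move=> h eps z eps0 ez; apply: decay_le_space.
  by rewrite ger0_norm// ltW.
- by move=> h eps; have /andP[] := decay_bounds alpha c h eps.
- exact: decay_grid_cvg.
- move=> eta1 eps tau z eta10 etatau zeps.
  exact: (killed_le_modulus alpha0 c0 del01 WRpos Wtot).
- by move=> eta1; exact: killed_modulus_cvg.
- exact: s0.
- exact: st.
- exact: eta0.
Qed.

(** The Markov property at time 0 on the full event, with the random starting point replaced by its
    almost sure value 0. *)
Lemma Rintegral_from0 s (f : R -> R) M : 0 <= s -> measurable_fun setT f ->
  (forall x, `|f x| <= M) -> \int[P]_w f (Z s w) = \int[Q s 0]_y f y.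
Proof.
move=> s0 mf fM.
have F0 : natural_filtration Z 0 setT.
  by rewrite -setC0; apply: filtrationC; exact: sigma_algebra0.
have := markov_Rintegral mZ HM (lexx 0) s0 F0 mf fM.
rewrite add0r => ->.
rewrite /Rintegral; set I := fine (\int[Q s 0%R]_y (f y)%:E)%E.
transitivity (fine (\int[P]_w (I%:E))%E); last first.
  by rewrite integral_cst// [X in (_ * X)%E](probability_setT P) mule1.
congr fine; apply: ae_eq_integral => //.
- apply/measurable_EFinP.
  apply: (@measurableT_comp _ _ _ _ _ _ (fun z => \int[Q s z]_y f y)); last exact: mZ.
  pose g x := f x + M.
  have g0 x : 0 <= g x by have := fM x; rewrite ler_norml /g => /andP[]; lra.
  have mg : measurable_fun setT g by exact: measurable_funD.
  have Qfin z : (Q s z setT < +oo)%E by rewrite prob_kernel ltry.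
  have -> : (fun z => \int[Q s z]_y f y) = (fun z => \int[Q s z]_y g y - M).
    apply/funext => z; rewrite RintegralD//.
    + by rewrite Rintegral_cst// prob_kernel mulr1 addrK.
    + exact: (@bounded_integrable _ _ _ _ _ _ (Qfin _) _ M).
    + by apply: (@bounded_integrable _ _ _ _ _ _ (Qfin _) _ `|M|).
  apply: measurable_funB => //.
  apply: (@measurableT_comp _ _ _ _ _ _ (@fine R)); first exact: fine_measurable.
  apply: measurable_fun_integral_kernel.
  + by move=> U mU; exact: measurable_kernel.
  + by move=> x; rewrite lee_fin.
  + exact/measurable_EFinP.
- by apply: filterS Z_start => w Zw _; rewrite /= Zw.
Qed.

Lemma measurable_reach s t : 0 <= s -> s <= t -> measurable (reach Z s t).
Proof.
by move=> s0 st; apply: (natural_filtration_measurable mZ (s := t)); exact: reach_filtration.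
Qed.

Lemma reach_zero s t w : 0 <= s -> s <= t -> Z t w = 0 -> reach Z s t w.
Proof. by move=> s0 st Zt m; exists t; rewrite ?st ?lexx// Zt invr_gt0. Qed.

(** [killed_stopped] is used with eta = u n tending to 0. Its right side tends to the integral
    sought, as [killed] tends to e^(-lam z). Its left side is computed from 0 at time s: there
    [killed] vanishes, so that [Q_killed] leaves only [exc_error], the contribution of last zeros up
    to s. *)
Lemma zero_free_laplace lam s t : 0 <= lam -> 0 < s -> s < t ->
  \int[P]_(w in ~` reach Z s t) expR (- lam * Z t w) =
  \int[W]_(w in Rpos) (if s <= t * w / (1 + w) then 0
     else (1 + w) / (1 + w + alpha * c * lam `^ alpha * t)).
Proof.
move=> l0 s0 st; have t0 := lt_trans s0 st.
have PT : (P setT < +oo)%E by rewrite probability_setT ltry.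
have WRpos_fin : (W Rpos < +oo)%E by rewrite [X in (X < _)%E]WRpos ltry.
have mRpos : measurable Rpos by exact: measurable_itv.
have mr := measurable_reach (ltW s0) (ltW st).
pose u n : R := n.+1%:R^-1.
have u0 n : 0 < u n by rewrite invr_gt0.
have ucv : u n @[n --> \oo] --> (0 : R) by exact: cvg_harmonic.
pose lhs n := \int[P]_(w in ~` reach Z s t) killed alpha c del W lam (u n) (Z t w).
have cv1 : lhs n @[n --> \oo] --> \int[P]_(w in ~` reach Z s t) expR (- lam * Z t w).
  have mC := measurableC mr.
  have PC : (P (~` reach Z s t) < +oo)%E by rewrite (le_lt_trans (probability_le1 P mC)) ?ltry.
  apply: (@bounded_cvg_Rintegral _ _ _ P _ mC PC _ _ 1).
  - move=> n; apply: measurable_funTS.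
    apply: (measurableT_comp _ (mZ (ltW t0))).
    by apply: measurable_killed => //; exact: ltW.
  - by move=> n w _; apply: killed_bound => //; exact: ltW.
  (* The limit of [killed] is e^(-lam z) only for z > 0; off [reach] the value at t is indeed
     positive. *)
  - move=> w nr; apply: killed_cvg => //.
    rewrite lt_neqAle Z_ge0 ?(ltW t0)// andbT eq_sym; apply/eqP => Zt.
    by apply: nr; apply: reach_zero => //; exact: ltW.
have lhsE n : lhs n = \int[W]_(w in Rpos) (if s < (t + u n) * w / (1 + w) then 0
    else exc_integrand alpha c lam (t + u n) 0 w).
  have tau0 : 0 < t + u n - s by have := u0 n; lra.
  have TE : t + u n = t + u n - s + s by rewrite subrK.
  rewrite [in RHS]TE.
  rewrite /lhs -killed_stopped//; last exact: ltW.
  rewrite (@Rintegral_from0 s _ 1) ?(ltW s0)//; last 2 first.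
  - by apply: measurable_killed => //; exact: ltW.
  - by move=> x; apply: killed_bound => //; exact: ltW.
  rewrite (Q_killed _ _ _ WRpos Wshift)// ?(ltW s0)//.
  by rewrite (killed0 _ _ WRpos Wtot) ?add0r//; apply: addr_ge0; exact: ltW.
apply: (cvg_unique _ cv1) => //.
rewrite (funext lhsE).
apply: (@bounded_cvg_Rintegral _ _ _ W Rpos mRpos WRpos_fin _ _ 1).
- move=> n; apply: measurable_funTS; apply: measurable_fun_ifT.
    exact: measurable_after_last_zero.
    exact: measurable_cst.
  exact: measurable_exc_integrand1.
- move=> n w /=; rewrite in_itv/= andbT => w0.
  case: ifPn => _; first by rewrite normr0.
  have T0 : 0 <= t + u n by apply: addr_ge0; exact: ltW.
  have /andP[e0 e1] := exc_integrand_bounds alpha0 c0 lam 0 T0 w0.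
  by rewrite ger0_norm.
- move=> w /=; rewrite in_itv/= andbT => w0.
  have w1 : 0 < 1 + w by rewrite addr_gt0.
  have r0 : 0 < w / (1 + w) by rewrite divr_gt0.
  (* The points (t + u n) w / (1 + w) decrease strictly to t w / (1 + w), which turns the strict
     test into a weak one in the limit. *)
  case: ifPn => [st'|]; last rewrite -ltNge => st'.
    apply: cvg_near_cst; apply: nearW => n.
    suff -> : s < (t + u n) * w / (1 + w) by [].
    apply: (le_lt_trans st'); rewrite -!mulrA ltr_pM2r//.
    by rewrite ltrDl.
  have tu : t + u n @[n --> \oo] --> t.
    by rewrite -[X in _ --> X]addr0; apply: cvgD => //; exact: cvg_cst.
  have cv2 : (1 + w) / (1 + w + alpha * c * lam `^ alpha * (t + u n)) @[n --> \oo] -->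
      (1 + w) / (1 + w + alpha * c * lam `^ alpha * t).
    apply: cvgMr; apply: cvgV.
      by rewrite gt_eqF// ltr_wpDr// !mulr_ge0 ?powR_ge0 ?ltW.
    apply: cvgD; first exact: cvg_cst.
    exact: cvgMr.
  apply: cvg_trans cv2; apply: near_eq_cvg.
  have cv3 : (t + u n) * (w / (1 + w)) @[n --> \oo] --> t * (w / (1 + w)) by exact: cvgMl.
  have : \forall n \near \oo, (t + u n) * (w / (1 + w)) < s.
    by apply: cvgr_lt cv3 _ _; rewrite mulrA.
  apply: filterS => n hn.
  rewrite mulrA in hn; rewrite ltNge (ltW hn)/=.
  rewrite /exc_integrand.
  suff -> : decay alpha c ((t + u n) * w / (1 + w)) 0 = 1 by rewrite mulr1.
  by rewrite /decay normr0 mul0r oppr0 expR0.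
Qed.

End laws_without_zeros.

(** * The infimum 0 is attained *)

Section first_hitting_times.
Context (R : realType) (T : Type) (s t : R).
Hypothesis st : s <= t.
Implicit Types (E : R -> set T).

(** The alternative r = t makes the set nonempty; the time is t if E never occurs. *)
Definition hit E (w : T) : R := inf [set r | s <= r <= t /\ (r = t \/ E r w)].

Let hit_has_inf E w : has_inf [set r | s <= r <= t /\ (r = t \/ E r w)].
Proof.
by split; [exists t; split; [rewrite lexx andbT|left]|exists s => r /= [/andP[]]].
Qed.

Lemma hit_le E r w : s <= r <= t -> E r w -> hit E w <= r.
Proof. by move=> rst Er; apply: ge_inf; [case: (hit_has_inf E w)|split => //; right]. Qed.

Lemma hit_ge E x w : x <= t -> (forall r, s <= r <= t -> E r w -> x <= r) -> x <= hit E w.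
Proof.
move=> xt h; apply: lb_le_inf; first by case: (hit_has_inf E w).
by move=> r /= [rst [->//|Er]]; exact: h.
Qed.

Lemma hit_itv E w : s <= hit E w <= t.
Proof.
apply/andP; split; first by apply: hit_ge => // r /andP[].
by apply: ge_inf; [case: (hit_has_inf E w)|split; [rewrite st lexx|left]].
Qed.

Lemma hit_adherent E w e : 0 < e ->
  exists r, [/\ s <= r <= t, r = t \/ E r w & r < hit E w + e].
Proof. by move=> e0; have [r [rst Er] rlt] := inf_adherent e0 (hit_has_inf E w); exists r. Qed.

Lemma hit_sub E E' w : (forall r, s <= r <= t -> E' r w -> E r w) -> hit E w <= hit E' w.
Proof.
move=> EE'; apply: hit_ge; first by have /andP[] := hit_itv E w.
by move=> r rst Er; apply: hit_le => //; exact: EE'.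
Qed.

End first_hitting_times.

Section zeros_are_reached.
Context (dT : measure_display) (T : measurableType dT) (R : realType)
  (P : probability T R) (Z : R -> T -> R) (Q : R -> R.-pker R ~> R)
  (alpha c del : R).
Hypothesis mZ : forall t, 0 <= t -> measurable_fun setT (Z t).
Hypothesis Z_ge0 : forall t w, 0 <= t -> 0 <= Z t w.
Hypothesis cadZ : forall w, cadlag (Z ^~ w).
Hypothesis HM : markov P Z Q.
Hypothesis alpha0 : 0 < alpha.
Hypothesis c0 : 0 < c.
Hypothesis del01 : 0 < del < 1.
Hypothesis Q_half_line : forall t z, 0 <= t -> 0 <= z ->
  Q t z `[0, +oo[%classic = 1%E.
Hypothesis Q_laplace : forall t z lam, 0 <= t -> 0 <= z -> 0 <= lam ->
  laplace (Q t z) lam =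
    ((1 + alpha * c * lam `^ alpha * t) `^ (- del) *
     expR (- lam * z * (1 + alpha * c * lam `^ alpha * t) `^ (- alpha^-1)))%:E.
Variables s t : R.
Hypotheses (s0 : 0 <= s) (st : s < t).

Let N (r : R) (w : T) : R := psi alpha c del 1 (t - r) (Z r w).

Let PT : (P setT < +oo)%E. Proof. by rewrite probability_setT ltry. Qed.

Let N_bounds r w : r <= t -> 0 <= N r w <= 1.
Proof. by move=> rt; apply: psi_bounds => //; rewrite subr_ge0. Qed.

Let N_bound r w : r <= t -> `|N r w| <= 1.
Proof. by move=> /(@N_bounds _ w)/andP[? ?]; rewrite ger0_norm. Qed.

Let mN r : 0 <= r -> measurable_fun setT (N r).
Proof.
move=> r0; apply: (@measurableT_comp _ _ _ _ _ _ (psi alpha c del 1 (t - r)) _ (Z r)).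
  exact: measurable_psi.
exact: mZ.
Qed.

Lemma psi_cvg (r_ z_ : nat -> R) (r z : R) : (forall n, 0 <= r_ n) -> 0 <= r ->
  r_ n @[n --> \oo] --> r -> z_ n @[n --> \oo] --> z ->
  psi alpha c del 1 (r_ n) (z_ n) @[n --> \oo] --> psi alpha c del 1 r z.
Proof.
move=> r_0 r0 rcv zcv; rewrite /psi.
have b0 x : 0 <= x -> 0 < 1 + alpha * c * 1 `^ alpha * x.
  by move=> x0; rewrite ltr_wpDr// !mulr_ge0 ?powR_ge0// ltW.
have bcv : 1 + alpha * c * 1 `^ alpha * r_ n @[n --> \oo] --> 1 + alpha * c * 1 `^ alpha * r.
  by apply: cvgD; [exact: cvg_cst|exact: cvgMr].
have pcv q : (1 + alpha * c * 1 `^ alpha * r_ n) `^ q @[n --> \oo] -->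
    (1 + alpha * c * 1 `^ alpha * r) `^ q.
  exact: (continuous_cvg _ (@powR_continuous R q _ (b0 _ r0)) bcv).
apply: cvgM; first exact: pcv.
apply: continuous_cvg; first exact: continuous_expR.
apply: cvgM; last exact: pcv.
by apply: cvgMr; apply: cvg_norm.
Qed.

Lemma psi_step A r r' : natural_filtration Z r A -> 0 <= r -> r <= r' -> r' <= t ->
  \int[P]_(w in A) N r' w = \int[P]_(w in A) N r w.
Proof.
move=> FA r0 rr' r't.
have h0 : 0 <= r' - r by rewrite subr_ge0.
rewrite /N -[in X in \int[P]_(_ in _) (psi _ _ _ _ (t - X) (Z X _)) = _](subrKC r r').
have e x : `|psi alpha c del 1 (t - (r + (r' - r))) x| <= 1.
  have -> : r + (r' - r) = r' by rewrite subrKC.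
  have tr : 0 <= t - r' by rewrite subr_ge0.
  by have /andP[? ?] := psi_bounds alpha0 c0 del01 x ler01 tr; rewrite ger0_norm.
have mpsi : measurable_fun setT (psi alpha c del 1 (t - (r + (r' - r)))).
  exact: measurable_psi.
rewrite (markov_Rintegral mZ HM r0 h0 FA mpsi e).
apply: eq_Rintegral => w _.
have := Q_psi alpha0 c0 Q_half_line Q_laplace ler01 _ h0 (Z_ge0 w r0).
have tr : 0 <= t - (r + (r' - r)) by rewrite subrKC subr_ge0.
move=> /(_ _ tr) h; rewrite /Rintegral h /=; congr psi; ring.
Qed.

Section filtration_events.
Variable E : R -> set T.
Hypothesis FE : forall r, s <= r <= t -> natural_filtration Z r (E r).
Hypothesis ndE : forall r r', r <= r' -> E r `<=` E r'.

(** [hit] is an infimum that need not be attained, so it is approached from the right by the first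
    grid time at which E has occurred. There the stopped mean is exact, because the drift of [N] is
    0, and right continuity of the path together with boundedness carries it to the limit. *)
Lemma hit_Rintegral : measurable_fun setT (fun w => N (hit s t E w) w) /\
  \int[P]_w N (hit s t E w) w = \int[P]_w N s w.
Proof.
pose A n k : set T := ~` E (grid s t n k).
pose Y n k := N (grid s t n k).
have g0 n k : 0 <= grid s t n k.
  by have /andP[h _] := grid_itv n k (ltW st); exact: le_trans s0 h.
have gt n k : grid s t n k <= t by have /andP[] := grid_itv n k (ltW st).
have FA n k : natural_filtration Z (grid s t n k) (A n k).
  by apply: filtrationC; apply: FE; exact: grid_itv (ltW st).
have mA n k : measurable (A n k) by exact: (natural_filtration_measurable mZ (FA n k)).
have ndA n k : A n k.+1 `<=` A n k.
  by move=> w nE Ek; apply: nE; apply: ndE Ek; exact: grid_nd (ltW st) _.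
have mY n k : measurable_fun setT (Y n k) by exact: mN.
have YM n k w : `|Y n k w| <= 1 by exact: N_bound.
have S_int n : \int[P]_w stopped (A n) (Y n) n.+1 w = \int[P]_w N s w.
  have h : `|\int[P]_w stopped (A n) (Y n) n.+1 w - \int[P]_w Y n 0 w| <= n.+1%:R * 0.
    apply: (stopped_Rintegral (mA n) (ndA n) (mY n) (YM n)) => k kn.
    have -> : \int[P]_(w in A n k) Y n k.+1 w = \int[P]_(w in A n k) Y n k w.
      exact: (psi_step (FA n k) (g0 n k) (grid_nd n (ltW st) (leqnSn k)) (gt n k.+1)).
    by rewrite subrr normr0.
  have -> : N s = Y n 0 by rewrite /Y grid0.
  by apply/eqP; rewrite -subr_eq0 -normr_le0 -[leRHS](mulr0 n.+1%:R).
have mS n : measurable_fun setT (stopped (A n) (Y n) n.+1).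
  exact: (measurable_stopped (mA n) (mY n)).
have cvw w : stopped (A n) (Y n) n.+1 w @[n --> \oo] --> N (hit s t E w) w.
  set D := hit s t E w.
    have [DS DT] : s <= D /\ D <= t by have /andP[] := hit_itv (ltW st) E w.
    (* The grid stops once E has occurred, hence not before D, and E had not occurred one mesh
       earlier, hence at most one mesh after D. *)
    have ex n : exists r, [/\ D <= r, r <= D + (t - s) * n.+1%:R^-1, r <= t &
        stopped (A n) (Y n) n.+1 w = N r w].
      have [j [jn SE Aj jA]] := stoppedP (Y n) (ndA n) n.+1 w.
      exists (grid s t n j); split => //.
        case: jA => [->|]; first by rewrite grid_last.
        by move/contrapT => Ej; apply: (hit_le (ltW st)) => //; exact: grid_itv (ltW st).
      case: j jn Aj {SE jA} => [|j] jn Aj.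
        by rewrite grid0 (le_trans DS)// lerDl mulr_ge0 ?subr_ge0 ?(ltW st).
      rewrite gridS// lerD2r; apply: (hit_ge (ltW st)); first exact: gt.
      move=> r rst Er; rewrite leNgt; apply/negP => rlt.
      by apply: (Aj j (ltnSn j)); apply: ndE Er; exact: ltW.
    have [r_ Hr] := choice ex.
    rewrite (_ : (fun n => _) = (fun n => N (r_ n) w)); last first.
      by apply/funext => n; have [] := Hr n.
    have rcv : r_ n @[n --> \oo] --> D.
      have up : D + (t - s) * n.+1%:R^-1 @[n --> \oo] --> D.
        rewrite -[X in _ --> X]addr0; apply: cvgD; first exact: cvg_cst.
        rewrite -[X in _ --> X](mulr0 (t - s)); apply: cvgMr; exact: cvg_harmonic.
      apply: (squeeze_cvgr _ (cvg_cst D) up); apply: nearW => n.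
      by have [h1 h2 _ _] := Hr n; rewrite h1 h2.
    apply: psi_cvg.
    + by move=> n; have [] := Hr n; rewrite subr_ge0.
    + by rewrite subr_ge0.
    + by apply: cvgB => //; exact: cvg_cst.
    + apply: (cadlag_cvg_right (x := Z ^~ w)) => //; first exact: le_trans DS.
      by move=> n; have [] := Hr n.
split; first exact: (measurable_fun_cvg mS (fun w _ => cvw w)).
have cv : \int[P]_w stopped (A n) (Y n) n.+1 w @[n --> \oo] --> \int[P]_w N (hit s t E w) w.
  apply: (@bounded_cvg_Rintegral _ _ _ P setT measurableT PT _ _ 1) => //.
  by move=> n w _; exact: (stopped_bound (ndA n) (YM n)).
have cv' : \int[P]_w stopped (A n) (Y n) n.+1 w @[n --> \oo] --> \int[P]_w N s w.
  by apply: cvg_near_cst; apply: nearW => n; exact: S_int.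
exact: (cvg_unique (@norm_hausdorff _ R) cv cv').
Qed.

End filtration_events.

Let Em (m : nat) (r : R) : set T := below Z s r m.+1%:R^-1.

Let Dm (m : nat) := hit s t (Em m).

Let D := hit s t (fun r => reach Z s r).

Let Dm_itv m w : s <= Dm m w <= t. Proof. exact: hit_itv (ltW st) _ _. Qed.

Let D_itv w : s <= D w <= t. Proof. exact: hit_itv (ltW st) _ _. Qed.

Let Dm_le m w : Dm m w <= D w.
Proof. by apply: hit_sub; [exact: ltW|move=> r rst; exact]. Qed.

Let Dm_nd m n w : (m <= n)%N -> Dm m w <= Dm n w.
Proof.
move=> mn; apply: hit_sub; first exact: ltW.
by move=> r rst; apply: below_sub; rewrite // lef_pV2 ?posrE// ler_nat.
Qed.

(** If every D_m stayed below D - e, then by time D - e/2 the path would have passed below every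
    level, so that [reach] would have occurred before D. *)
Let Dm_cvg w : Dm m w @[m --> \oo] --> D w.
Proof.
apply/cvgrPdist_lt => e e0.
suff [m hm] : exists m, D w - e < Dm m w.
  exists m => // n /= mn; have := Dm_nd w mn; have := Dm_le n w.
  by move=> h1 h2; rewrite ger0_norm; lra.
apply: contrapT => hn.
have le m : Dm m w <= D w - e by rewrite leNgt; apply/negP => h; apply: hn; exists m.
have /andP[DS DT] := D_itv w.
have /andP[sD0 _] := Dm_itv 0 w.
have := le 0%N => le0.
pose r := D w - e / 2.
have rst : s <= r <= t by rewrite /r; apply/andP; split; lra.
suff : D w <= r by rewrite /r; lra.
apply: (hit_le (ltW st)) => // m.
have e2 : 0 < e / 2 by exact: divr_gt0.
have [r' [/andP[sr' r't] r'E r'lt]] := @hit_adherent _ _ s t (ltW st) (Em m) w (e / 2) e2.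
have r'r : r' <= r by have := le m; move: r'lt; rewrite -/(Dm m w) /r; lra.
case: r'E => [r'E|]; first by move: r'r; rewrite /r; lra.
exact: below_sub.
Qed.

(** D_m is a limit from the right of times at which Z is below the level; right continuity keeps the
    inequality in its weak form. On [reach] such times exist even if D_m = t. *)
Let Z_Dm m w : reach Z s t w -> Z (Dm m w) w <= m.+1%:R^-1.
Proof.
move=> rw; have /andP[sD Dt] := Dm_itv m w.
have ex n : exists u, [/\ Dm m w <= u, u <= Dm m w + n.+1%:R^-1 & Z u w <= m.+1%:R^-1].
  have n0 : 0 < n.+1%:R^-1 :> R by rewrite invr_gt0.
  have [r [/andP[sr rt] rE rlt]] := @hit_adherent _ _ s t (ltW st) (Em m) w _ n0.
  have [u /andP[su ur] Zu] : Em m r w by case: rE => [->|//]; exact: rw.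
  exists u; split; [|exact: le_trans ur (ltW rlt)|exact: ltW].
  apply: (hit_le (ltW st)); first by rewrite su (le_trans ur).
  by exists u => //; rewrite su lexx.
have [u_ Hu] := choice ex.
have ucv : u_ n @[n --> \oo] --> Dm m w.
  have up : Dm m w + n.+1%:R^-1 @[n --> \oo] --> Dm m w.
    rewrite -[X in _ --> X]addr0; apply: cvgD; first exact: cvg_cst.
    exact: cvg_harmonic.
  apply: (squeeze_cvgr _ (cvg_cst _) up); apply: nearW => n.
  by have [h1 h2 _] := Hu n; rewrite h1 h2.
have Zcv : Z (u_ n) w @[n --> \oo] --> Z (Dm m w) w.
  apply: (cadlag_cvg_right (x := Z ^~ w)) => //; first exact: le_trans sD.
  by move=> n; have [] := Hu n.
refine (ler_cvg_to Zcv (cvg_cst _) _); apply: nearW => n.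
by have [] := Hu n.
Qed.

Let L (w : T) : R :=
  if w \in reach Z s t then psi alpha c del 1 (t - D w) 0 else N (D w) w.

Let N_Dm_cvg w : N (Dm m w) w @[m --> \oo] --> L w.
Proof.
rewrite /L; case: ifPn => [/set_mem rw|/negP nr].
  apply: psi_cvg.
  - by move=> m; rewrite subr_ge0; have /andP[] := Dm_itv m w.
  - by rewrite subr_ge0; have /andP[] := D_itv w.
  - by apply: cvgB; [exact: cvg_cst|exact: Dm_cvg].
  - have inv0 : (n.+1%:R^-1 : R) @[n --> \oo] --> (0 : R) by exact: cvg_harmonic.
    apply: (squeeze_cvgr _ (cvg_cst 0) inv0); apply: nearW => m.
    rewrite Z_Dm// Z_ge0//; have /andP[h _] := Dm_itv m w; exact: le_trans h.
(* Off [reach] some level is never passed, so that D_n = D = t from that index on. *)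
have [m hm] : exists m, ~ below Z s t m.+1%:R^-1 w.
  apply: contrapT => h; apply: nr; apply/mem_set => m.
  by apply: contrapT => hm; apply: h; exists m.
have Dmt : Dm m w = t.
  apply/eqP; rewrite eq_le; have /andP[_ ->] := Dm_itv m w; rewrite /=.
  apply: (hit_ge (ltW st)) => //.
  move=> r /andP[sr rt] Er; exfalso; apply: hm.
  exact: below_sub Er.
apply: cvg_near_cst; exists m; first by [].
move=> n; rewrite /= => mn.
suff e : Dm n w = D w by rewrite e.
apply/eqP; rewrite eq_le Dm_le/=; have /andP[_ h] := D_itv w.
by rewrite (le_trans h)// -Dmt Dm_nd.
Qed.

Let L_Rintegral : \int[P]_w L w = \int[P]_w N (D w) w.
Proof.
have FEm m r : s <= r <= t -> natural_filtration Z r (Em m r).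
  by move=> /andP[sr rt]; exact: below_filtration.
have ndEm m r r' : r <= r' -> Em m r `<=` Em m r' by move=> rr'; exact: below_sub.
have FD r : s <= r <= t -> natural_filtration Z r (reach Z s r).
  by move=> /andP[sr rt]; exact: reach_filtration.
have ndD r r' : r <= r' -> reach Z s r `<=` reach Z s r' by move=> rr'; exact: reach_sub.
have [mND ->] := hit_Rintegral FD ndD.
have cv : \int[P]_w N (Dm m w) w @[m --> \oo] --> \int[P]_w L w.
  apply: (@bounded_cvg_Rintegral _ _ _ P setT measurableT PT _ _ 1).
  - by move=> m; exact: (hit_Rintegral (FEm m) (ndEm m)).1.
  - by move=> m w _; apply: N_bound; have /andP[] := Dm_itv m w.
  - by move=> w _; exact: N_Dm_cvg.
have cv' : \int[P]_w N (Dm m w) w @[m --> \oo] --> \int[P]_w N s w.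
  by apply: cvg_near_cst; apply: nearW => m; exact: (hit_Rintegral (FEm m) (ndEm m)).2.
exact: (cvg_unique (@norm_hausdorff _ R) cv cv').
Qed.

Let N_le_L w : N (D w) w <= L w.
Proof.
rewrite /L; case: ifPn => // _; rewrite /N /psi.
rewrite ler_wpM2l ?powR_ge0// ler_expR normr0 mulr0 mul0r.
by rewrite mulN1r mulNr oppr_le0 mulr_ge0// powR_ge0.
Qed.

(* [N] is a martingale. Let D be the first time at which the infimum of Z from
   time s on vanishes and D_m the first passage below 1/(m+1). Then N(D_m) tends
   to [L], which is N(D) with Z(D) replaced by 0, whereas N(D_m) and N(D) have
   the same mean. As N is strictly decreasing in Z, it follows that Z(D) = 0. *)
Lemma reach_ae_zero : {ae P, forall w, reach Z s t w -> exists2 u, s <= u <= t & Z u w = 0}.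
Proof.
have FD r : s <= r <= t -> natural_filtration Z r (reach Z s r).
  by move=> /andP[sr rt]; exact: reach_filtration.
have ndD r r' : r <= r' -> reach Z s r `<=` reach Z s r' by move=> rr'; exact: reach_sub.
have [mND _] := hit_Rintegral FD ndD.
have mL : measurable_fun setT L.
  apply: (measurable_fun_cvg _ (fun w _ => @N_Dm_cvg w)) => m.
  have FEm r : s <= r <= t -> natural_filtration Z r (Em m r).
    by move=> /andP[sr rt]; exact: below_filtration.
  have ndEm r r' : r <= r' -> Em m r `<=` Em m r' by move=> rr'; exact: below_sub.
  exact: (hit_Rintegral FEm ndEm).1.
have L_bound w : `|L w| <= 1.
  have /andP[_ Dt] := D_itv w; rewrite /L; case: ifPn => _; last exact: N_bound.
  have tr : 0 <= t - D w by rewrite subr_ge0.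
  by have /andP[? ?] := psi_bounds alpha0 c0 del01 0 ler01 tr; rewrite ger0_norm.
have iL : P.-integrable setT (EFin \o L).
  exact: (@bounded_integrable _ _ _ _ _ measurableT PT _ 1 mL (fun w _ => L_bound w)).
have iN : P.-integrable setT (EFin \o (fun w => N (D w) w)).
  apply: (@bounded_integrable _ _ _ _ _ measurableT PT _ 1 mND) => w _.
  by apply: N_bound; have /andP[] := D_itv w.
pose diff w := L w - N (D w) w.
have mdiff : measurable_fun setT (EFin \o diff).
  by apply/measurable_EFinP; exact: (measurable_funB mL mND).
have diff0 : (\int[P]_w `|(EFin \o diff) w| = 0)%E.
  transitivity (\int[P]_w (diff w)%:E)%E.
    by apply: eq_integral => w _; rewrite /= ger0_norm// subr_ge0 N_le_L.
  have := RintegralB measurableT iL iN; rewrite L_Rintegral subrr /Rintegral.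
  have fin : (\int[P]_w (diff w)%:E \is a fin_num)%E.
    exact: (integrable_fin_num measurableT (integrableB measurableT iL iN)).
  by move=> h; rewrite -[LHS]fineK//; congr EFin.
have := (ae_eq_integral_abs P measurableT mdiff).1 diff0.
apply: filterS => w /(_ I) /= [] /eqP; rewrite subr_eq0 => /eqP LN rw.
have /andP[sD Dt] := D_itv w.
exists (D w); first by rewrite sD Dt.
move: LN; rewrite /L mem_set// /N /psi.
set b := _ `^ _; set b' := _ `^ _.
have tr : 0 <= t - D w by rewrite subr_ge0.
have base0 : 0 < 1 + alpha * c * 1 `^ alpha * (t - D w).
  by rewrite ltr_wpDr// !mulr_ge0 ?powR_ge0// ltW.
have b0 : 0 < b by exact: powR_gt0.
have b'0 : 0 < b' by exact: powR_gt0.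
move/(mulfI (lt0r_neq0 b0)) => /expR_inj /eqP.
rewrite normr0 mulr0 mul0r eq_sym mulf_eq0 (gt_eqF b'0) orbF mulf_eq0 oppr_eq0 oner_eq0/=.
by rewrite normr_eq0 => /eqP.
Qed.

End zeros_are_reached.

(** * The joint law of the last zero and the process *)

Section last_approach.
Context (dT : measure_display) (T : measurableType dT) (R : realType)
  (P : probability T R) (Z : R -> T -> R).
Hypothesis mZ : forall t, 0 <= t -> measurable_fun setT (Z t).
Hypothesis Z_ge0 : forall t w, 0 <= t -> 0 <= Z t w.
Hypothesis cadZ : forall w, cadlag (Z ^~ w).
Hypothesis Z_start : {ae P, forall w, Z 0 w = 0}.
Variable t : R.
Hypothesis t0 : 0 < t.
Hypothesis reach_zero_ae : forall s, 0 <= s < t ->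
  {ae P, forall w, reach Z s t w -> exists2 u, s <= u <= t & Z u w = 0}.

(** Rationals outside [0, t] and invalid codes give 0, so that every index yields a time in [0, t].
    Countability is what makes the supremum in [last_approach] measurable. *)
Definition rational_time (n : nat) : R :=
  if unpickle n is Some q then (if 0 <= (ratr q : R) <= t then ratr q else 0) else 0.

Lemma rational_time_itv n : 0 <= rational_time n <= t.
Proof.
rewrite /rational_time; case: (unpickle n) => [q|]; last by rewrite lexx ltW.
by case: ifPn => // _; rewrite lexx ltW.
Qed.

Lemma rational_time_dense x y : 0 <= x -> x < y -> y <= t ->
  exists n, x < rational_time n < y.
Proof.
move=> x0 xy yt; have [q] := rat_in_itvoo xy; rewrite in_itv/= => /andP[xq qy].
exists (pickle q); rewrite /rational_time pickleK.
by rewrite (le_trans x0 (ltW xq)) (le_trans (ltW qy) yt)/= xq.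
Qed.

Definition reached_time (n : nat) (w : T) : R :=
  rational_time n * \1_(reach Z (rational_time n) t) w.

(* A measurable version of [last_zero Z t]. *)
Definition last_approach (w : T) : R := sups (fun n => reached_time n w) 0.

Let reached_ub w : has_ubound (range (fun n => reached_time n w)).
Proof.
exists t => _ [n _ <-]; have /andP[q0 qt] := rational_time_itv n.
by apply: le_trans qt; rewrite /reached_time ler_piMr// indicE; case: (_ \in _).
Qed.

Let last_approachE w : last_approach w = sup (range (fun n => reached_time n w)).
Proof.
congr sup; apply/seteqP; split => x /= [n _ <-]; exists n => //.
Qed.

Lemma measurable_last_approach : measurable_fun setT last_approach.
Proof.
apply: measurable_fun_sups; first by move=> w _; exact: reached_ub.
move=> n; apply: measurable_funM => //.
have /andP[q0 qt] := rational_time_itv n.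
apply: measurable_indic.
by apply: (natural_filtration_measurable mZ (s := t)); exact: reach_filtration.
Qed.

Let reached_le n w : reached_time n w <= last_approach w.
Proof. by rewrite last_approachE; apply: sup_ubound; [exact: reached_ub|exists n]. Qed.

Lemma last_approach_ge0 w : 0 <= last_approach w.
Proof.
apply: le_trans (reached_le 0 w); have /andP[q0 _] := rational_time_itv 0.
by rewrite mulr_ge0// indicE; case: (_ \in _).
Qed.

Lemma reach_le_last_approach s w : 0 <= s -> s < t -> reach Z s t w -> s <= last_approach w.
Proof.
move=> s0 st rs; rewrite leNgt; apply/negP => Gs.
have G0 := last_approach_ge0 w.
have [n /andP[Gq qs]] := rational_time_dense G0 Gs (ltW st).
have := reached_le n w; rewrite /reached_time indicE mem_set.
  by rewrite mulr1 leNgt Gq.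
by apply: reach_sub rs => //; exact: ltW.
Qed.

Lemma lt_last_approach_reach s w : 0 <= s -> s < last_approach w -> reach Z s t w.
Proof.
move=> s0; rewrite last_approachE => sG.
have hs : has_sup (range (fun n => reached_time n w)).
  by split; [exists (reached_time 0 w), 0%N|exact: reached_ub].
have [_ [n _ <-]] := sup_adherent (etrans (subr_gt0 _ _) sG) hs.
rewrite subKr /reached_time indicE; case: (boolP (_ \in _)) => [/set_mem rn|_].
  by rewrite mulr1 => sq; apply: reach_sub rn => //; exact: ltW.
by rewrite mulr0 ltNge s0.
Qed.

(** Outside one null set, reaching 0 on [q, t] gives a zero there for all rational q at once, so
    [last_approach] is at most the last zero. Conversely, a zero u beyond [last_approach] would
    leave a rational q between them with [reach] on [q, t]. *)
Lemma last_approach_last_zero : {ae P, forall w, last_approach w = last_zero Z t w}.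
Proof.
have key n : {ae P, forall w, reach Z (rational_time n) t w ->
    exists2 u, rational_time n <= u <= t & Z u w = 0}.
  have /andP[q0 qt] := rational_time_itv n.
  (* At q = t, [reach] says that Z t is below every level, hence 0, for every path. *)
  move: qt; rewrite le_eqVlt => /predU1P[->|qt]; last by apply: reach_zero_ae; rewrite q0.
  apply: aeW => w rw; exists t; first by rewrite lexx.
  apply/eqP; rewrite eq_le Z_ge0 ?(ltW t0)// andbT leNgt; apply/negP => Zt.
  have [m _ /(_ m (leqnn m)) hm] : \forall m \near \oo, m.+1%:R^-1 < Z t w.
    by apply: cvgr_lt Zt; exact: cvg_harmonic.
  have [u /andP[tu ut] Zu] := rw m.
  have ute : u = t by apply/eqP; rewrite eq_le ut.
  by move: (lt_trans Zu hm); rewrite ute ltxx.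
apply: filterS2 Z_start (ae_foralln key) => w Z0 hw.
pose S := [set s | 0 <= s <= t /\ Z s w = 0].
have ubS : has_ubound S by exists t => x /= [/andP[]].
have S0 : S 0 by split => //; rewrite lexx ltW.
have le_sup x : S x -> x <= last_zero Z t w by move=> Sx; exact: sup_ubound.
apply/eqP; rewrite eq_le; apply/andP; split.
  rewrite last_approachE; apply: sup_le_ub; first by exists (reached_time 0 w), 0%N.
  move=> _ [n _ <-]; rewrite /reached_time indicE; case: (boolP (_ \in _)) => [/set_mem rn|_].
    have [u /andP[qu ut] Zu] := hw n rn; rewrite mulr1; apply: (le_trans qu); apply: le_sup.
    by split => //; rewrite ut andbT; apply: le_trans qu; have /andP[] := rational_time_itv n.
  by rewrite mulr0; exact: le_sup.
apply: sup_le_ub; first by exists 0.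
move=> u [/andP[u0 ut] Zu].
rewrite leNgt; apply/negP => Gu.
have G0 := last_approach_ge0 w.
have [n /andP[Gq qu]] := rational_time_dense G0 Gu ut.
have := reached_le n w; rewrite /reached_time indicE mem_set.
  by rewrite mulr1 leNgt Gq.
by move=> m; exists u; rewrite ?(ltW qu) ?ut// Zu invr_gt0.
Qed.

End last_approach.

Lemma measurable_preimage d d' (T : measurableType d) (T' : measurableType d')
    (f : T -> T') (C : set T') :
  measurable_fun setT f -> measurable C -> measurable (f @^-1` C).
Proof. by move=> mf mC; rewrite -[X in measurable X]setTI; exact: mf. Qed.

(** The restriction to E is realised as the measure with density the indicator of E, so that the
    integral formula comes with it. *)
Lemma exists_image_restr d d' (T : measurableType d) (T' : measurableType d')
    (R : realType) (mu : {measure set T -> \bar R}) (E : set T) (f : T -> T') :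
  measurable E -> measurable_fun setT f ->
  exists m : {measure set T' -> \bar R},
    (forall A, measurable A -> m A = mu (E `&` f @^-1` A)) /\
    (forall g : T' -> \bar R, measurable_fun setT g -> (forall x, 0 <= g x)%E ->
      (\int[m]_x g x = \int[mu]_(x in E) g (f x))%E).
Proof.
move=> mE mf.
have m1 : measurable_fun setT (\1_E : T -> R) by exact: measurable_indic.
have i0 (x : T) : 0 <= (\1_E x : R) by [].
have [m0 m0E] := exists_density_measure mu m1 i0.
exists (image_measure m0 mf).
have intE (g : T' -> \bar R) : measurable_fun setT g -> (forall x, 0 <= g x)%E ->
    (\int[image_measure m0 mf]_x g x = \int[mu]_(x in E) g (f x))%E.
  move=> mg g0; rewrite ge0_integral_image_measure// m0E//; last exact: measurableT_comp.
  rewrite [RHS]integral_mkcond; apply: eq_integral => x _.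
  by rewrite patchE indicE; case: (x \in E); rewrite ?mule1 ?mule0.
split => // A mA.
have mfA := measurable_preimage mf mA.
have -> : image_measure m0 mf A = (\int[image_measure m0 mf]_x (\1_A x)%:E)%E.
  by rewrite integral_indic// setIT.
rewrite intE//; last by apply/measurable_EFinP; exact: measurable_indic.
transitivity (\int[mu]_(x in E) (\1_(f @^-1` A) x)%:E)%E => //.
by rewrite integral_indic// setIC.
Qed.

Section joint_law.
Context (dT : measure_display) (T : measurableType dT) (R : realType)
  (P : probability T R) (Z : R -> T -> R) (alpha c t : R) (W N : probability R R).
Hypothesis mZ : forall t, 0 <= t -> measurable_fun setT (Z t).
Hypothesis Z_ge0 : forall t w, 0 <= t -> 0 <= Z t w.
Hypothesis cadZ : forall w, cadlag (Z ^~ w).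
Hypothesis alpha0 : 0 < alpha.
Hypothesis c0 : 0 < c.
Hypothesis t0 : 0 < t.
Local Notation Rpos := (`]0, +oo[%classic : set R).
Hypothesis WRpos : W Rpos = 1%E.
Hypothesis NRp : N `[0, +oo[%classic = 1%E.
Hypothesis Nlap : forall lam, 0 <= lam ->
  laplace N lam = ((1 + alpha * c * lam `^ alpha)^-1)%:E.
Hypothesis zero_free : forall lam s, 0 <= lam -> 0 < s -> s < t ->
  \int[P]_(w in ~` reach Z s t) expR (- lam * Z t w) =
  \int[W]_(w in Rpos) (if s <= t * w / (1 + w) then 0
     else (1 + w) / (1 + w + alpha * c * lam `^ alpha * t)).

Let sig (w : R) : R := t * w / (1 + w).
Let root (s : R) : R := (t - s) `^ alpha^-1.

(* The event that (sigma, (t - sigma)^(1/alpha) x) is in A * B, where the last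
   zero is sigma = t w / (1 + w); under [W \x N], w > 0 almost surely. *)
Definition joint (A B : set R) : set (R * R) :=
  [set p | [/\ 0 < p.1, A (sig p.1) & B (root (sig p.1) * p.2)]].

Let msig : measurable_fun setT sig.
Proof.
apply: measurable_funM; first exact: measurable_funM.
by apply: measurable_funVr; exact: measurable_funD.
Qed.

Let mroot : measurable_fun setT root.
Proof.
apply: (@measurableT_comp _ _ _ _ _ _ (fun x : R => x `^ alpha^-1)).
  exact: measurable_powR.
exact: measurable_funB.
Qed.

Let mscale : measurable_fun setT (fun p : R * R => root (sig p.1) * p.2).
Proof.
apply: measurable_funM => //.
exact: (measurableT_comp mroot (measurableT_comp msig measurable_fst)).
Qed.

Lemma measurable_joint A B : measurable A -> measurable B -> measurable (joint A B).
Proof.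
move=> mA mB.
have -> : joint A B = (fst @^-1` Rpos `&` (sig \o fst) @^-1` A) `&`
    (fun p : R * R => root (sig p.1) * p.2) @^-1` B.
  apply/seteqP; split => p /=; rewrite in_itv/= andbT; first by move=> [].
  by move=> [[]].
apply: measurableI; first apply: measurableI.
- by apply: measurable_preimage; [exact: measurable_fst|exact: measurable_itv].
- by apply: measurable_preimage => //; exact: (measurableT_comp msig measurable_fst).
- exact: measurable_preimage.
Qed.

Let N_neg : N `]-oo, 0[%classic = 0%E.
Proof. exact: half_line_null (probability_setT N) NRp. Qed.

(** The time t - sigma since the last zero is t / (1 + w), and [root] dilates [N] to the Linnik law
    of that parameter. *)
Let root_lap lam w : 0 <= lam -> 0 < w ->
  laplace N (lam * root (sig w)) =
  ((1 + w) / (1 + w + alpha * c * lam `^ alpha * t))%:E.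
Proof.
move=> l0 w0; have w1 : 0 < 1 + w by rewrite addr_gt0.
have tsE : t - sig w = t / (1 + w) by rewrite /sig; field; rewrite gt_eqF.
rewrite Nlap ?mulr_ge0 ?powR_ge0//; congr EFin.
rewrite (powRM alpha l0 (powR_ge0 _ _)) -powRrM mulVf ?gt_eqF// powRr1; last first.
  by rewrite tsE divr_ge0// ltW.
have b0 : 0 < 1 + w + alpha * c * lam `^ alpha * t.
  by rewrite ltr_wpDr// !mulr_ge0 ?powR_ge0 ?ltW.
rewrite tsE -[RHS]invf_div; congr (_^-1); field.
by rewrite gt_eqF.
Qed.

Let joint_laplace lam s : 0 <= lam ->
  (\int[(W \x N)%E]_(p in joint `]-oo, s[%classic setT)
     (expR (- lam * (root (sig p.1) * p.2)%R))%:E =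
   \int[W]_(w in Rpos) (if (s <= t * w / (1 + w))%R then 0%R
     else ((1 + w) / (1 + w + alpha * c * lam `^ alpha * t))%R)%:E)%E.
Proof.
move=> l0.
have mJ : measurable (joint `]-oo, s[%classic setT) by exact: measurable_joint.
have me : measurable_fun setT
    (fun p : R * R => (expR (- lam * (root (sig p.1) * p.2)%R))%:E : \bar R).
  apply/measurable_EFinP; apply: measurableT_comp => //.
  exact: measurable_funM.
rewrite integral_mkcond fubini_tonelli1; last 2 first.
- exact: (measurable_restrictT _ mJ).1 (measurable_funTS me).
- by move=> p; rewrite patchE; case: ifPn => _; rewrite ?lee_fin ?expR_ge0.
rewrite [RHS]integral_mkcond; apply: eq_integral => w _.
rewrite /fubini_F patchE; case: ifPn => [/set_mem/=|/negP wn]; last first.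
  under eq_integral => x _.
    rewrite patchE memNset; last first.
      by move=> [/= w0 _ _]; apply: wn; rewrite inE/= in_itv/= andbT.
    over.
  by rewrite integral0.
rewrite in_itv/= andbT => w0.
case: ifPn => sw.
  under eq_integral => x _.
    rewrite patchE memNset; last by move=> [/= _]; rewrite in_itv/= ltNge sw.
    over.
  by rewrite integral0.
rewrite -root_lap// /laplace; apply: eq_integral => x _.
rewrite patchE mem_set; last by split => //=; rewrite in_itv/= ltNge.
by rewrite mulNr mulrA mulNr.
Qed.

(** As functions of B both sides are finite measures on the half line. Their Laplace transforms
    agree by [zero_free] and [joint_laplace], so [laplace_inj] applies. *)
Lemma joint_law_reach s B : 0 < s -> s < t -> measurable B ->
  P (~` reach Z s t `&` Z t @^-1` B) = (W \x N)%E (joint `]-oo, s[%classic B).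
Proof.
move=> s0 st mB.
have mr : measurable (reach Z s t).
  by apply: (natural_filtration_measurable mZ (s := t)); apply: reach_filtration => //; exact: ltW.
have mC := measurableC mr.
have mJ : measurable (joint `]-oo, s[%classic setT) by exact: measurable_joint.
have mZt := mZ (ltW t0).
have [m1 [m1E m1I]] := exists_image_restr P mC mZt.
have [m2 [m2E m2I]] := exists_image_restr (W \x N)%E mJ mscale.
have m12 : forall B, measurable B -> m1 B = m2 B.
  apply: laplace_inj.
  - by rewrite m1E// (le_lt_trans (probability_le1 P _)) ?ltry// setIT.
  - rewrite m1E// (_ : _ `&` _ = set0) ?measure0//.
    by apply/seteqP; split => // w [_ /=]; rewrite in_itv/= ltNge Z_ge0 ?ltW.
  - rewrite m2E//; apply/eqP; rewrite eq_le measure_ge0 andbT.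
    have <- : (W \x N)%E (setT `*` `]-oo, 0[%classic) = 0%E.
      by rewrite product_measure1E// [X in (_ * X)%E]N_neg mule0.
    apply: le_measure; rewrite ?inE.
    + apply: measurableI => //.
      by apply: measurable_preimage => //; exact: measurable_itv.
    + exact: measurableX.
    + move=> [w x] [_ /=]; rewrite !in_itv/= => h; split => //.
      rewrite ltNge; apply/negP => x0; move: h; rewrite ltNge mulr_ge0//.
      exact: powR_ge0.
  - move=> lam l0; rewrite /laplace.
    have me : measurable_fun setT (fun x : R => (expR (- lam * x))%:E).
      by apply/measurable_EFinP; exact: measurable_expRM.
    rewrite m1I// ?m2I//; [|by move=> x; rewrite lee_fin expR_ge0..].
    rewrite joint_laplace//.
    have PC : (P (~` reach Z s t) < +oo)%E.
      by rewrite (le_lt_trans (probability_le1 P mC)) ?ltry.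
    (* [zero_free] is an equality of real numbers; finiteness of the integrals lifts it to the
       extended ones. *)
    have iP : P.-integrable (~` reach Z s t) (EFin \o (fun w => expR (- lam * Z t w))).
      apply: (@bounded_integrable _ _ _ _ _ mC PC _ 1).
        apply: measurable_funTS; apply: measurableT_comp => //.
        exact: measurable_funM.
      move=> w _; rewrite ger0_norm ?expR_ge0// -[leRHS]expR0 ler_expR mulNr oppr_le0.
      by rewrite mulr_ge0// Z_ge0 ?ltW.
    have mRpos : measurable Rpos by exact: measurable_itv.
    have WF : (W Rpos < +oo)%E by rewrite [X in (X < _)%E]WRpos ltry.
    have iW : W.-integrable Rpos (EFin \o (fun w => if s <= t * w / (1 + w) then 0
        else (1 + w) / (1 + w + alpha * c * lam `^ alpha * t))).
      apply: (@bounded_integrable _ _ _ _ _ mRpos WF _ 1).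
        apply: measurable_funTS; apply: measurable_fun_ifT => //.
          exact: (measurable_fun_ler (measurable_cst s) msig).
        apply: measurable_funM; first exact: measurable_funD.
        apply: measurable_funVr; apply: measurable_funD; [exact: measurable_funD|exact: measurable_cst].
      move=> w /=; rewrite in_itv/= andbT => w0; case: ifPn => _; first by rewrite normr0.
      have w1 : 0 < 1 + w by rewrite addr_gt0.
      have al : 0 <= alpha * c * lam `^ alpha * t by rewrite !mulr_ge0 ?powR_ge0 ?ltW.
      have b0 : 0 < 1 + w + alpha * c * lam `^ alpha * t by rewrite ltr_wpDr.
      rewrite ger0_norm ?divr_ge0 ?(ltW w1) ?(ltW b0)//.
      by rewrite ler_pdivrMr// mul1r lerDl.
    rewrite -[LHS](fineK (integrable_fin_num mC iP)).
    rewrite -[RHS](fineK (integrable_fin_num mRpos iW)).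
    by congr EFin; exact: zero_free.
have -> : P (~` reach Z s t `&` Z t @^-1` B) = m1 B by rewrite m1E.
rewrite m12// m2E//; congr ((W \x N)%E _); apply/seteqP; split => p /=.
  by move=> [[h1 h2 _] h3].
by move=> [h1 h2 h3].
Qed.

Variable G : {RV P >-> R}.
Hypothesis G_ge0 : forall w, 0 <= G w.
Hypothesis reach_le_G : forall s w, 0 <= s -> s < t -> reach Z s t w -> s <= G w.
Hypothesis lt_G_reach : forall s w, 0 <= s -> s < G w -> reach Z s t w.

Let sig_gt0 w : 0 < w -> 0 < sig w.
Proof. by move=> w0; rewrite divr_gt0 ?mulr_gt0 ?addr_gt0. Qed.

Let sig_lt w : 0 < w -> sig w < t.
Proof.
move=> w0; have w1 : 0 < 1 + w by rewrite addr_gt0.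
by rewrite /sig ltr_pdivrMr// ltr_pM2l// ltrDr.
Qed.

Let mG : measurable_fun setT G. Proof. exact: measurable_funPT. Qed.

Let mZB B : measurable B -> measurable (Z t @^-1` B).
Proof. by move=> mB; apply: measurable_preimage => //; exact: mZ (ltW t0). Qed.

(** The two hypotheses relating G to [reach] leave G = s undecided. Approaching s strictly from
    below by u n exhausts the event G < s by events without [reach] on [u n, t]. *)
Let joint_law_lt s B : s <= t -> measurable B ->
  P (G @^-1` `]-oo, s[ `&` Z t @^-1` B) = (W \x N)%E (joint `]-oo, s[%classic B).
Proof.
move=> st mB.
have [s0|s0] := leP s 0.
  rewrite (_ : G @^-1` _ `&` _ = set0); last first.
    apply/seteqP; split => // w [/=]; rewrite in_itv/= => Gs _.
    by move: (lt_le_trans Gs s0); rewrite ltNge G_ge0.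
  rewrite (_ : joint _ _ = set0) ?measure0//.
  apply/seteqP; split => // p [/= p0]; rewrite in_itv/= => ps _.
  by move: (lt_trans (sig_gt0 p0) (lt_le_trans ps s0)); rewrite ltxx.
(* The index n + 2 keeps u n positive, as [joint_law_reach] requires. *)
pose u n : R := s * (1 - n.+2%:R^-1).
have inv n : 0 < (n.+2%:R^-1 : R) < 1.
  by rewrite invr_gt0 ltr0n/= invf_lt1 ?ltr1n.
have u0 n : 0 < u n by have /andP[h1 h2] := inv n; rewrite mulr_gt0 ?subr_gt0.
have us n : u n < s.
  by have /andP[h1 h2] := inv n; rewrite /u gtr_pMr// gtrBl.
have ut n : u n < t by exact: lt_le_trans (us n) st.
have u_nd m n : (m <= n)%N -> u m <= u n.
  by move=> mn; rewrite /u ler_pM2l// lerD2l lerN2 lef_pV2 ?posrE// ler_nat !ltnS.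
have ucv x : x < s -> exists n, x < u n.
  move=> xs.
  have cv : u n @[n --> \oo] --> s.
    rewrite -[X in _ --> X]mulr1 -[X in _ --> s * X]subr0.
    apply: cvgMr; apply: cvgB; first exact: cvg_cst.
    have := @cvg_harmonic R; rewrite -(cvg_shiftn 1) => h.
    by apply: cvg_trans h; apply: near_eq_cvg; apply: nearW => n /=; rewrite addn1.
  have [n _ hn] : \forall n \near \oo, x < u n by apply: cvgr_gt cv _ _.
  by exists n; exact: (hn n (leqnn n)).
pose A n := ~` reach Z (u n) t `&` Z t @^-1` B.
pose J n := joint `]-oo, u n[%classic B.
have AE : G @^-1` `]-oo, s[ `&` Z t @^-1` B = \bigcup_n A n.
  apply/seteqP; split => w.
    move=> [/=]; rewrite in_itv/= => Gs ZB.
    have [n hn] := ucv _ Gs; exists n => //; split => // rn.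
    by move: hn; rewrite ltNge reach_le_G// ltW.
  move=> [n _ [nr ZB]]; split => //=; rewrite in_itv/=.
  apply: le_lt_trans (us n); rewrite leNgt; apply/negP => h; apply: nr.
  by apply: lt_G_reach => //; exact: ltW.
have JE : joint `]-oo, s[%classic B = \bigcup_n J n.
  apply/seteqP; split => p.
    move=> [p0 /=]; rewrite in_itv/= => ps pB.
    have [n hn] := ucv _ ps; exists n => //; split => //=; by rewrite in_itv.
  move=> [n _ [p0 /=]]; rewrite in_itv/= => ps pB; split => //=.
  by rewrite in_itv/=; exact: lt_trans (us n).
have mA n : measurable (A n).
  apply: measurableI; last exact: mZB.
  apply: measurableC; apply: (natural_filtration_measurable mZ (s := t)).
  by apply: reach_filtration => //; exact: ltW.
have mJ n : measurable (J n) by apply: measurable_joint.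
have cv1 : P (A n) @[n --> \oo] --> P (\bigcup_n A n).
  apply: nondecreasing_cvg_mu => //; first exact: bigcup_measurable.
  move=> m n mn; apply/subsetPset => w [nr ZB]; split => // rn; apply: nr.
  by apply: reach_sub rn => //; exact: u_nd.
have cv2 : (W \x N)%E (J n) @[n --> \oo] --> (W \x N)%E (\bigcup_n J n).
  apply: nondecreasing_cvg_mu => //; first exact: bigcup_measurable.
  move=> m n mn; apply/subsetPset => p [p0 /=]; rewrite in_itv/= => ps pB.
  by split => //=; rewrite in_itv/=; exact: lt_le_trans (u_nd _ _ mn).
rewrite AE JE; apply: (cvg_unique _ cv1) => //.
suff -> : (fun n => P (A n)) = (fun n => (W \x N)%E (J n)) by exact: cv2.
by apply/funext => n; exact: joint_law_reach.
Qed.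

Let joint_gt s B : t <= s -> joint `]-oo, s[%classic B = joint `]-oo, t[%classic B.
Proof.
move=> ts; apply/seteqP; split => p [p0 _ pB]; split => //=; rewrite in_itv/=.
  exact: sig_lt.
exact: lt_le_trans (sig_lt p0) ts.
Qed.

Let joint_total : (W \x N)%E (joint `]-oo, t[%classic setT) = 1%E.
Proof.
rewrite (_ : joint _ _ = Rpos `*` setT); last first.
  apply/seteqP; split => p /=; rewrite in_itv/= andbT; first by move=> [].
  by move=> [p0 _]; split => //=; rewrite in_itv/=; exact: sig_lt.
by rewrite product_measure1E// [X in (X * _)%E]WRpos [X in (_ * X)%E](probability_setT N) mule1.
Qed.

(** For s > t: taking B full and s = t in [joint_law_lt] shows that G < t almost surely, just as
    sigma < t on the other side, so that s may be replaced by t. *)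
Let joint_law_half_line s B : measurable B ->
  P (G @^-1` `]-oo, s[ `&` Z t @^-1` B) = (W \x N)%E (joint `]-oo, s[%classic B).
Proof.
move=> mB; have [|/ltW ts] := leP s t; first by move=> st; exact: joint_law_lt.
rewrite joint_gt// -joint_law_lt//.
have mGs x : measurable (G @^-1` `]-oo, x[) by apply: measurable_preimage.
have PGt : P (G @^-1` `]-oo, t[) = 1%E.
  by have := joint_law_lt (lexx t) measurableT; rewrite preimage_setT setIT joint_total.
have Pn : P (~` (G @^-1` `]-oo, t[)) = 0%E.
  by rewrite probability_setC// PGt subee.
have -> : G @^-1` `]-oo, s[ `&` Z t @^-1` B =
    (G @^-1` `]-oo, t[ `&` Z t @^-1` B) `|`
    (G @^-1` `]-oo, s[ `&` Z t @^-1` B `&` ~` (G @^-1` `]-oo, t[)).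
  apply/seteqP; split => w.
    move=> [Gs ZB]; have [Gt|Gt] := pselect ((G @^-1` `]-oo, t[) w); [by left|by right].
  move=> [[/= Gt ZB]|[]//]; split => //=; move: Gt; rewrite !in_itv/= => Gt.
  exact: lt_le_trans ts.
have mE : measurable (G @^-1` `]-oo, s[ `&` Z t @^-1` B `&` ~` (G @^-1` `]-oo, t[)).
  apply: measurableI; last exact/measurableC/mGs.
  by apply: measurableI; [exact: mGs|exact: mZB].
apply: measureU0 => //.
- by apply: measurableI; [exact: mGs|exact: mZB].
- by apply: (subset_measure0 mE (measurableC (mGs t)) _ Pn) => w [].
Qed.

(** For fixed B both sides are finite measures in A that agree on the half lines, a generating class
    stable under intersection. *)
Lemma joint_law A B : measurable A -> measurable B ->
  P (G @^-1` A `&` Z t @^-1` B) = (W \x N)%E (joint A B).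
Proof.
move=> mA mB.
have mJ : measurable (joint setT B) by exact: measurable_joint.
have mfst : measurable_fun setT (fun p : R * R => sig p.1).
  exact: (measurableT_comp msig measurable_fst).
have [m1 [m1E _]] := exists_image_restr P (mZB mB) mG.
have [m2 [m2E _]] := exists_image_restr (W \x N)%E mJ mfst.
have J2 C : measurable C -> m2 C = (W \x N)%E (joint C B).
  move=> mC; rewrite m2E//; congr ((W \x N)%E _); apply/seteqP; split => p /=.
    by move=> [[h1 _ h2] h3].
  by move=> [h1 h2 h3].
rewrite -J2// setIC -m1E//.
apply: (measure_unique (@RGenInftyO.G R) (fun n => `]-oo, n%:R[%classic)) => //.
- exact: RGenInftyO.measurableE.
- move=> _ _ [x ->] [y ->]; exists (Num.min x y).
  by apply/seteqP; split=> z /=; rewrite !in_itv/= lt_min => /andP.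
- by move=> i; exists i%:R.
- apply/seteqP; split=> // x _; exists (Num.truncn `|x|).+1 => //=.
  by rewrite in_itv/=; apply: le_lt_trans (truncnS_gt _); exact: ler_norm.
- by move=> _ [x ->]; rewrite m1E// J2//; rewrite setIC; exact: joint_law_half_line.
- move=> k; rewrite m1E// (le_lt_trans (probability_le1 P _)) ?ltry//.
  by apply: measurableI; [exact: mZB|apply: measurable_preimage].
Qed.

(** [joint_law] with B full identifies the law of G as the image of [W] under [sig]. The section of
    [joint A B] at w has [N]-mass equal to the kernel at [sig w], so that Fubini disintegrates the
    joint law. *)
Lemma conditional_law A B : measurable A -> measurable B ->
  P (G @^-1` A `&` Z t @^-1` B) =
  (\int[distribution P G]_(s in A) linnik_kernel alpha t N s B)%E.
Proof.
move=> mA mB; rewrite joint_law//.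
have mRpos : measurable Rpos by exact: measurable_itv.
have [m [mE mI]] := exists_image_restr W mRpos msig.
have law C : measurable C -> distribution P G C = m C.
  move=> mC; rewrite mE//.
  have := joint_law mC measurableT; rewrite preimage_setT setIT => h.
  rewrite [LHS]h (_ : joint C setT = (Rpos `&` sig @^-1` C) `*` setT).
    rewrite product_measure1E//; last by apply: measurableI => //; exact: measurable_preimage.
    by rewrite [X in (_ * X)%E](probability_setT N) mule1.
  apply/seteqP; split => p /=; rewrite in_itv/= andbT; first by move=> [].
  by move=> [[]].
have -> : (\int[distribution P G]_(s in A) linnik_kernel alpha t N s B =
    \int[m]_(s in A) linnik_kernel alpha t N s B)%E.
  by apply: eq_measure_integral => C mC _; exact: law.
have mk : measurable_fun setT (fun s => linnik_kernel alpha t N s B).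
  exact: measurable_kernel.
rewrite integral_mkcond mI; last 2 first.
- exact: (measurable_restrictT _ mA).1 (measurable_funTS mk).
- by move=> s; rewrite patchE; case: ifPn.
rewrite integral_mkcond [LHS]/(\int[W]_w (N (xsection (joint A B) w)))%E.
apply: eq_integral => w _; rewrite patchE; case: ifPn => [/set_mem/=|/negP wn].
  rewrite in_itv/= andbT => w0; rewrite patchE; case: ifPn => [/set_mem sA|/negP sA].
    congr (N _); apply/seteqP; split => x; rewrite /xsection /=.
      by move/set_mem => [].
    by move=> h; apply/mem_set.
  rewrite (_ : xsection _ _ = set0) ?measure0//.
  apply/seteqP; split => // x; rewrite /xsection/= => /set_mem[_ h _].
  by apply: sA; exact/mem_set.
rewrite (_ : xsection _ _ = set0) ?measure0//.
apply/seteqP; split => // x; rewrite /xsection/= => /set_mem[/= h _ _].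
by apply: wn; rewrite inE/= in_itv/= andbT.
Qed.

End joint_law.

Theorem proposition12 (R : realType) (mu nu : probability nat R)
    (alpha c d : R)
    (mu1 : (mu [set 1%N] < 1)%E) (nu0 : (0 < nu [set 0%N])%E)
    (SL : assumption_SL mu nu alpha c d)
    (delta01 : 0 < d / (alpha * c) < 1)
    (dT : measure_display) (T : measurableType dT) (P : probability T R)
    (Z : R -> T -> R) (HZ : CBI_process P alpha c d Z)
    (t : R) (t0 : 0 < t) :
  exists kappa : R.-pker R ~> R,
    regular_cond_distribution P (Z t) (last_zero Z t) kappa /\
    (forall s, 0 < s < t -> linnik_law alpha c (t - s) (kappa s)).
Proof.
case: SL => /andP[alpha0 alpha1] c0 d0 _.
case: HZ => mZ Z_ge0 cadZ Z_start [Q [[[Q_half_line _ _] _] Q_laplace HM]].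
have [W [WRpos Wtot Wshift]] := exists_euler_law delta01.
(* The law of Z(1) from 0 has the transform (1 + alpha c lam^alpha)^(-del) from which the Linnik law
   is built. *)
have Q1 : Q 1 0 setT = 1%E by exact: prob_kernel.
have [q qE] := exists_probability Q1.
have qRp : q `[0, +oo[%classic = 1%E by rewrite qE; exact: Q_half_line.
have qlap lam : 0 <= lam ->
    laplace q lam = ((1 + alpha * c * lam `^ alpha) `^ (- (d / (alpha * c))))%:E.
  move=> l0; transitivity (laplace (Q 1 0) lam).
    by apply: eq_measure_integral => A mA _; exact: qE.
  by rewrite Q_laplace// mulr1 mulr0 mul0r expR0 mulr1.
have A0 : 0 <= alpha * c by apply: mulr_ge0; exact: ltW.
have del0 : 0 < d / (alpha * c) by case/andP: delta01.
have [N [NRp Nlap]] := exists_linnik_law alpha0 A0 del0 qRp qlap.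
have reach_zero_ae s : 0 <= s < t ->
    {ae P, forall w, reach Z s t w -> exists2 u, s <= u <= t & Z u w = 0}.
  move=> /andP[s0 st].
  exact: (reach_ae_zero mZ Z_ge0 cadZ HM alpha0 c0 delta01 Q_half_line Q_laplace s0 st).
have zero_free lam s : 0 <= lam -> 0 < s -> s < t ->
    \int[P]_(w in ~` reach Z s t) expR (- lam * Z t w) =
    \int[W]_(w in `]0, +oo[) (if s <= t * w / (1 + w) then 0
       else (1 + w) / (1 + w + alpha * c * lam `^ alpha * t)).
  exact: (zero_free_laplace mZ Z_ge0 cadZ Z_start HM alpha0 alpha1 c0 delta01
    WRpos Wtot Wshift Q_half_line Q_laplace).
(* [last_zero] is a supremum over uncountably many times and need not be measurable; this almost
   surely equal version is. *)
pose G : {RV P >-> R} := mfun_Sub (mem_set (measurable_last_approach mZ cadZ t0)).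
exists (linnik_kernel alpha t N); split; last first.
  by move=> s /andP[_ st]; exact: linnik_kernel_law.
exists G; split; first exact: (last_approach_last_zero Z_ge0 Z_start t0 reach_zero_ae).
move=> A B mA mB.
apply: (conditional_law mZ Z_ge0 cadZ alpha0 c0 t0 WRpos NRp Nlap zero_free) => //.
- by move=> w; exact: last_approach_ge0.
- by move=> s w s0 st; exact: reach_le_last_approach.
- by move=> s w s0; exact: lt_last_approach_reach.
Qed.
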